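(* Let $(u,n,v)$ be a solution, for $t\ge0$, of the first-order Zakharov system $$ i u_t+u_{xx}=nu,\qquad n_t+v_x=0,\qquad v_t+\left(n+|u|^2\right)_x=0,$$ with finite energy $E_s<\infty$ and finite mass $M_s<\infty$. 1. If $(u,n,v)\in C\left(\mathbb{R}^+,H^1(\mathbb{R})\times L^2(\mathbb{R})\times L^2(\mathbb{R})\right)$, then for every $\delta>0$ and every $\mu\in C^1(\mathbb{R})$ satisfying $\mu(t)\gtrsim t\log(t)^{1+\delta}$, $$\lim_{t\to\infty}\|u(t)\|_{L^2(|x|\sim\mu(t))}=0 .$$ 2. If $(u,n,v)\in C\left(\mathbb{R}^+,H^2(\mathbb{R})\times L^2(\mathbb{R})\times L^2(\mathbb{R})\right)$ and there exists a non-decreasing positive function $f\in C^1(\mathbb{R})$ such that $\|u(t)\|_{H^2(\mathbb{R})}\lesssim f(t)$ for $t\ge 0$, then for every $\delta>0$ and every $\mu\in C^1(\mathbb{R})$ satisfying $\mu(t)\gtrsim t\log(t)^{1+\delta}f(t)$, $$\lim_{t\to\infty}\left(\|u(t)\|_{H^1(|x|\sim\mu(t))}+\|n(t)\|_{L^2(|x|\sim\mu(t))}+\|v(t)\|_{L^2(|x|\sim\mu(t))}\right)=0 .$$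
   Context: Here $(t,x)\in\mathbb{R}^+\times\mathbb{R}$ with $\mathbb{R}^+=[0,\infty)$, $u$ is complex-valued, and $n,v$ are real-valued. The flow of the system preserves the mass $M_s=\int_{\mathbb{R}}|u|^2dx$, the energy $$E_s=\int_{\mathbb{R}}|u_x|^2+\tfrac12\left(|n|^2+|v|^2\right)+n|u|^2\,dx,$$ and the momentum $P_s=\mathrm{Im}\int_{\mathbb{R}}u\,\overline{u}_x\,dx-\int_{\mathbb{R}}vn\,dx$. Notation: $a(t)\gtrsim b(t)$ means that there is a constant $c>0$ with $a(t)\ge c\,b(t)$ (lower bounds on $\mu$ are for $t\ge2$); $\lesssim$ is defined analogously. $\|\cdot\|_{X(|x|\sim\mu(t))}$ denotes the $X$-norm ($X=L^2$ or $H^1$) over the region $\{x\in\mathbb{R}: c_1\mu(t)\le|x|\le c_2\mu(t)\}$, where $0<c_1<c_2$ are arbitrary fixed constants (independent of $t$). *)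

(* Defs.v *)
From HB Require Import structures.
From mathcomp Require Import all_boot all_order all_algebra.
From mathcomp Require Import complex.
From mathcomp Require Import all_classical all_reals all_analysis.

Set Implicit Arguments.
Unset Strict Implicit.
Unset Printing Implicit Defensive.

Import Order.TTheory GRing.Theory Num.Theory.
Import numFieldNormedType.Exports.
Import ComplexField.Normc.

Local Open Scope classical_set_scope.
Local Open Scope ring_scope.
Local Open Scope complex_scope.

Section ComplexValued.
Context {R : realType}.
Notation mu := (@lebesgue_measure R).
Implicit Types (f g : R -> R[i]) (h : R -> R) (A : set R).

Definition cRe f : R -> R := fun x => complex.Re (f x).
Definition cIm f : R -> R := fun x => complex.Im (f x).

Definition cabs f : R -> R := fun x => normc (f x).

Definition cintegral f : R[i] :=
  (\int[mu]_x cRe f x)%R +i* (\int[mu]_x cIm f x)%R.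

Definition is_cderive (g : R -> R[i]) (t : R) (d : R[i]) : Prop :=
  is_derive t 1 (cRe g) (complex.Re d) /\ is_derive t 1 (cIm g) (complex.Im d).

Definition L2norm A h : \bar R := 'N[mu]_2%:E[EFin \o (h \_ A)].

Definition in_L2 h : Prop := h \in Lfun mu 2%:E.

Definition in_cL2 f : Prop := in_L2 (cRe f) /\ in_L2 (cIm f).

Definition clocally_integrable f : Prop :=
  locally_integrable setT (cRe f) /\ locally_integrable setT (cIm f).

End ComplexValued.

Section Sobolev.
Context {R : realType}.
Implicit Types (f g : R -> R[i]) (h psi : R -> R) (A : set R).

Definition test_function psi : Prop :=
  (forall (k : nat) (x : R), derivable (psi^`(k)%classic) x 1) /\
  compact (closure [set x | psi x != 0]).

(* Real-valued test functions suffice: the identity is complex-linear in psi. *)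
Definition weak_derivative f g : Prop :=
  [/\ clocally_integrable f, clocally_integrable g &
    forall psi, test_function psi ->
      cintegral (fun x => f x * (psi^`()%classic x)%:C) =
      - cintegral (fun x => g x * (psi x)%:C)].

(* A representative of the weak derivative (unique up to a.e. equality);
   the zero function when there is none, so that [in_sobolev] must assert
   existence separately. *)
Definition wderiv f : R -> R[i] := xget (fun=> 0) [set g | weak_derivative f g].

Fixpoint in_sobolev (k : nat) f : Prop :=
  if k is k'.+1 then
    in_cL2 f /\ exists2 g, weak_derivative f g & in_sobolev k' g
  else in_cL2 f.

(* The H^k norm over the region A, with the weak derivatives taken on the
   whole line: the square root of the sum over j <= k of the squares of the
   L^2(A) norms of the j-th derivatives. *)
Definition sobolev_norm (k : nat) A f : \bar R :=
  ((\sum_(j < k.+1) (L2norm A (cabs (iter j wderiv f))) ^+ 2) `^ 2^-1)%E.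

(* u in C([0, +oo), H^k(R)) *)
Definition continuous_in_sobolev (k : nat) (u : R -> R -> R[i]) : Prop :=
  (forall t : R, 0 <= t -> in_sobolev k (u t)) /\
  forall s : R, 0 <= s ->
    sobolev_norm k setT (u t \- u s) @[t --> within [set t | 0 <= t] (nbhs s)]
      --> 0%E.

(* h in C([0, +oo), L^2(R)) *)
Definition continuous_in_L2 (h : R -> R -> R) : Prop :=
  (forall t : R, 0 <= t -> in_L2 (h t)) /\
  forall s : R, 0 <= s ->
    L2norm setT (h t \- h s) @[t --> within [set t | 0 <= t] (nbhs s)] --> 0%E.

(* h in C^1(R) *)
Definition is_C1 h : Prop :=
  (forall x : R, derivable h x 1) /\ continuous (h^`()%classic : R -> R).

End Sobolev.

Section Zakharov.
Context {R : realType}.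
Notation mu := (@lebesgue_measure R).
Implicit Types (u : R -> R -> R[i]) (n v : R -> R -> R).

(* The equations hold in the sense of distributions in x at every time t > 0,
   all space derivatives being moved onto the test function psi:
     i u_t + u_xx = n u,  n_t + v_x = 0,  v_t + (n + |u|^2)_x = 0. *)
Definition zakharov_solution u n v : Prop :=
  forall (psi : R -> R) (t : R), test_function psi -> 0 < t ->
  [/\ exists2 d : R[i],
        is_cderive (fun s => cintegral (fun x => u s x * (psi x)%:C)) t d &
        'i%C * d + cintegral (fun x => u t x * (psi^`(2)%classic x)%:C) =
        cintegral (fun x => (n t x)%:C * u t x * (psi x)%:C),
      exists2 d : R,
        is_derive t 1 (fun s => \int[mu]_x (n s x * psi x)) d &
        d - \int[mu]_x (v t x * psi^`()%classic x) = 0 &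
      exists2 d : R,
        is_derive t 1 (fun s => \int[mu]_x (v s x * psi x)) d &
        d - \int[mu]_x ((n t x + cabs (u t) x ^+ 2) * psi^`()%classic x) = 0].

(* Both are constant in time along the flow; the finite mass M_s and energy E_s
   of a solution are these constants. *)
Definition mass (f : R -> R[i]) : \bar R :=
  (\int[mu]_x (cabs f x ^+ 2)%:E)%E.

Definition energy (f : R -> R[i]) (a b : R -> R) : \bar R :=
  (\int[mu]_x (cabs (wderiv f) x ^+ 2 +
               2^-1 * (`|a x| ^+ 2 + `|b x| ^+ 2) +
               a x * cabs f x ^+ 2)%:E)%E.

End Zakharov.

(* The region |x| ~ r, for fixed 0 < c1 < c2. *)
Definition region {R : realType} (c1 c2 r : R) : set R :=
  [set x | c1 * r <= `|x| <= c2 * r].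

(* Main.v *)
Require Import Defs.
From HB Require Import structures.
From mathcomp Require Import all_boot all_order all_algebra.
From mathcomp Require Import complex.
From mathcomp Require Import all_classical all_reals all_analysis.
From mathcomp Require Import measurable_realfun.
From mathcomp Require Import ring lra.
Import Order.TTheory GRing.Theory Num.Theory.
Import numFieldNormedType.Exports.
Import ComplexField.Normc.
Set Implicit Arguments.
Unset Strict Implicit.
Unset Printing Implicit Defensive.
Local Open Scope classical_set_scope.
Local Open Scope ring_scope.
Local Open Scope complex_scope.

(** With a smooth cutoff [phi] equal to [1] on [|x| >= r] and to [0] on
    [|x| <= r / 8], whose derivative is [O(1 / r)], the local mass
    [int phi |u|^2] has a time derivative [O(1 / r)], since the energy and the
    mass bound the H^1 norm of [u]. Its value at time [1] tends to [0] as
    [r -> oo], so it is small at time [T] as soon as [r] and [r / T] are large: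
    take [r = c1 mu(T)]. The local energy is treated alike, with a time
    derivative [O(f / r)]; it controls the local H^1 norm of [u] and L^2 norms of
    [n] and [v] up to a multiple of the local mass, because [u] is bounded.

    The solution is too rough for the local energy to be differentiated
    directly. For the Schrodinger equation, a distributional time derivative that
    is continuous in time in L^2, or in the dual of H^1, is a genuine derivative
    there, because test functions are dense in H^1. The wave equation has no such
    regularity, but [n + v] and [n - v] become differentiable in L^2 along
    characteristics, where the derivative falls on the cutoff. *)

(* [^`()] is the derivative of polynomials in [ring_scope]. *)
Local Notation "f ^`()" := (derive1 f) : ring_scope.

(** Every estimate is run on the real and imaginary parts of [u], in the real pairing [ip], and
    starts at time [1] because the equations are given only for [t > 0]. The two parts of the
    theorem differ in where the time derivative of [u] lives. For [u] in H^1, [u_t] lies in the dual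
    of H^1; this suffices for the weighted mass, whose partner [phi u] is in H^1. For [u] in H^2,
    [u_t] is in L^2 and [u_xt] in the dual of H^1, so each quadratic term of the energy is again an
    increment paired with an admissible partner; the bound [f] enters through the norm of [u_t] in
    the flux. In the interaction [n |u|^2], [n_t = - v_x] lies in the dual of H^1 and is paired with
    [|u|^2], which is in H^1 because H^1 of the line is an algebra. All bulk terms then cancel
    exactly and only terms carrying [phi'] remain. The change up to time [T] is at most a constant
    times [T / r], respectively [T f(T) / r], and the logarithm in the lower bound on [mu] makes
    this eventually smaller than any given constant. *)

Section Calculus.
Context {R : realType}.
Implicit Types (f g : R -> R) (x t s : R).

(** Differentiability is handled through its remainder, which is stable under sums and domination,
    so that expansions are assembled from norm estimates without difference quotients. The
    neighbourhood contains [t], hence [r t = 0]. *)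
Definition little_o t (r : R -> R) : Prop :=
  forall e : R, 0 < e -> \forall s \near t, `|r s| <= e * `|s - t|.

Lemma little_oP f t d :
  is_derive t 1 f d <-> little_o t (fun s => f s - f t - (s - t) * d).
Proof.
split.
- move=> [df fd] e e0.
  have : (fun h => h^-1 *: (f (h + t) - f t)) @ 0^' --> d.
    move: df; rewrite /derivable => /cvg_ex[l /= fl].
    have <- : l = d.
      rewrite -fd; apply/esym/cvg_lim => //.
    by under eq_fun do rewrite -[X in f (X + _)]mulr1.
  move/cvgrPdist_le => /(_ e e0) /= H.
  move: H; rewrite /dnbhs /within /= => /nbhs_ballP[r /= r0 H].
  apply/nbhs_ballP; exists r => //= s; rewrite /ball /= => ts.
  have [->|st] := eqVneq s t; first by rewrite !subrr mul0r subrr !normr0 mulr0.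
  have st0 : s - t != 0 by rewrite subr_eq0.
  have := H (s - t); rewrite /ball /= sub0r opprB => /(_ ts st0).
  rewrite subrK => H1.
  rewrite [X in `|X|](_ : _ = (s - t) * ((s - t)^-1 *: (f s - f t) - d)); last first.
    by rewrite mulrBr -[in RHS]mulr_algl mulrA /GRing.scale/= mulr1 mulfV// mul1r.
  by rewrite normrM mulrC distrC ler_wpM2r.
- move=> H.
  have cv : (fun h => h^-1 *: (f (h *: 1 + t) - f t)) @ 0^' --> d.
    apply/cvgrPdist_le => /= e e0.
    have /nbhs_ballP[r /= r0 Hr] := H e e0.
    rewrite /dnbhs /within /=; apply/nbhs_ballP; exists r => //= h.
    rewrite /ball /= sub0r normrN => hr h0.
    have := Hr (h + t); rewrite /ball /= opprD addrC subrK normrN => /(_ hr).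
    rewrite addrK => H1.
    rewrite [X in f (X + _)]mulr1 -(ler_pM2r (x := `|h|)) ?normr_gt0// distrC -normrM mulrBl.
    by rewrite /GRing.scale/= mulrAC mulVf// mul1r [d * h]mulrC.
  apply: DeriveDef; first by apply/cvg_ex; exists d.
  by apply/cvg_lim.
Qed.

Lemma little_oD t r1 r2 : little_o t r1 -> little_o t r2 ->
  little_o t (fun s => r1 s + r2 s).
Proof.
move=> h1 h2 e e0; have e20 : 0 < e / 2 by rewrite divr_gt0.
near=> s; rewrite (le_trans (ler_normD _ _))// [e in leRHS](splitr e) mulrDl lerD//.
  by near: s; exact: h1.
by near: s; exact: h2.
Unshelve. all: by end_near. Qed.

Lemma little_oM t (c r : R -> R) M : (\forall s \near t, `|c s| <= M) -> little_o t r ->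
  little_o t (fun s => c s * r s).
Proof.
move=> cM h e e0.
pose M1 := `|M| + 1; have M0 : 0 < M1 by rewrite /M1 ltr_wpDl.
have eM : 0 < e / M1 by rewrite divr_gt0.
near=> s; rewrite normrM.
have -> : e * `|s - t| = M1 * (e / M1 * `|s - t|).
  by rewrite mulrA mulrC [M1 * _]mulrC divfK ?gt_eqF// mulrC.
rewrite ler_pM//; last by near: s; exact: h.
rewrite (@le_trans _ _ M)//; first by near: s.
by rewrite /M1 (le_trans (ler_norm _)) ?lerDl.
Unshelve. all: by end_near. Qed.

Lemma little_o_le t r1 r2 : (\forall s \near t, `|r1 s| <= `|r2 s|) ->
  little_o t r2 -> little_o t r1.
Proof.
move=> le12 h e e0; near=> s; apply: (@le_trans _ _ `|r2 s|).
  by near: s.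
by near: s; exact: h.
Unshelve. all: by end_near. Qed.

Lemma little_o_cvg0 t c : c @ t --> (0 : R) -> little_o t (fun s => (s - t) * c s).
Proof.
move=> /cvgrPdist_le h e e0; have := h e e0; apply: filterS => s.
by rewrite /= sub0r normrN normrM mulrC => ?; rewrite ler_wpM2r.
Qed.

(** The mean value theorem applied to [g x - x * D t]. It turns continuity in time of a derivative
    into a first-order remainder on an interval that is the same for all test functions. *)
Lemma mvt_increment (g D : R -> R) t s K :
  (forall x, `|x - t| <= `|s - t| -> is_derive x 1 g (D x)) ->
  (forall x, `|x - t| <= `|s - t| -> `|D x - D t| <= K) ->
  `|g s - g t - (s - t) * D t| <= K * `|s - t|.
Proof.
move=> dg DK.
pose h x := g x - x * D t.
have dh x : `|x - t| <= `|s - t| -> is_derive x 1 h (D x - D t).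
  move=> /dg dgx; rewrite /h.
  have : is_derive x 1 (fun x : R => x * D t) (D t).
    have -> : (fun x : R => x * D t) = D t \*: id by apply/funext => z /=; rewrite mulrC.
    apply: is_derive_eq; by rewrite scaler1.
  move=> ?; exact: is_deriveB.
have -> : g s - g t - (s - t) * D t = h s - h t by rewrite /h; ring.
have [st|ts|->] := ltgtP s t.
- have [||c cst hE] := @MVT R h (fun x => D x - D t) s t st.
  + move=> x; rewrite in_itv/= => /andP[sx xt]; apply: dh.
    by rewrite !ltr0_norm ?subr_lt0//; lra.
  + apply: derivable_within_continuous => x; rewrite in_itv/= => /andP[sx xt].
    have []// := dh x.
    by rewrite !ler0_norm ?subr_le0//; lra.
  move: cst; rewrite in_itv/= => /andP[sc ct].
  rewrite -normrN opprB hE normrM [`|s - t|]distrC ler_wpM2r// DK//.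
  by rewrite !ltr0_norm ?subr_lt0//; lra.
- have [||c cst hE] := @MVT R h (fun x => D x - D t) t s ts.
  + move=> x; rewrite in_itv/= => /andP[sx xt]; apply: dh.
    by rewrite !gtr0_norm ?subr_gt0//; lra.
  + apply: derivable_within_continuous => x; rewrite in_itv/= => /andP[sx xt].
    have []// := dh x.
    by rewrite !ger0_norm ?subr_ge0//; lra.
  move: cst; rewrite in_itv/= => /andP[sc ct].
  rewrite hE normrM ler_wpM2r// DK//.
  by rewrite !gtr0_norm ?subr_gt0//; lra.
- by rewrite !subrr normr0 mulr0.
Qed.

Lemma ler_increment (g D : R -> R) (a b K : R) : a <= b ->
  (forall x, a <= x <= b -> is_derive x 1 g (D x) /\ `|D x| <= K) ->
  `|g b - g a| <= K * (b - a).
Proof.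
rewrite le_eqVlt => /orP[/eqP <-|ab] dg; first by rewrite !subrr normr0 mulr0.
have [||c] := @MVT R g D a b ab.
- by move=> x /[!in_itv]/= /andP[ax xb]; have [|//] := dg x; rewrite !ltW.
- apply: derivable_within_continuous => x; rewrite in_itv/= => axb.
  by have [[]] := dg x axb.
rewrite in_itv/= => /andP[ac cb] ->.
rewrite normrM [`|b - a|]gtr0_norm ?subr_gt0//; apply: ler_wpM2r; first by rewrite subr_ge0 ltW.
have /dg[//] : a <= c <= b by rewrite !ltW.
Qed.

End Calculus.

(** * Smooth functions and test functions *)

Section Smooth.
Context {R : realType}.
Implicit Types (f g psi : R -> R) (x t s : R) (n : nat).

(** Peeling derivatives off from the outside suits induction: the derivative of a product is a sum
    of products of functions with one order less. [smoothP] links this form to the iterated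
    derivatives of [test_function]. *)
Fixpoint nderivable n f : Prop :=
  if n is m.+1 then (forall x, derivable f x 1) /\ nderivable m f^`()
  else True.

Definition smooth f : Prop := forall n, nderivable n f.

Lemma is_derive_derive1 f g : (forall x, is_derive x 1 f (g x)) ->
  f^`() = g.
Proof.
by move=> fg; apply/funext => x; rewrite derive1E; apply: derive_val.
Qed.

Lemma derivable_is_derive1 f x : derivable f x 1 ->
  is_derive x 1 f (f^`() x).
Proof. by move=> df; rewrite derive1E; exact/derivableP. Qed.

Lemma nderivableS n f g : (forall x, is_derive x 1 f (g x)) ->
  nderivable n g -> nderivable n.+1 f.
Proof.
by move=> fg ng; split=> [x|]; [have [] := fg x|rewrite (is_derive_derive1 fg)].
Qed.

Lemma nderivableW n f : nderivable n.+1 f -> nderivable n f.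
Proof.
by elim: n f => // n ih f [df nf]; split => //; exact: ih.
Qed.

Lemma nderivableD n f g : nderivable n f -> nderivable n g ->
  nderivable n (fun x => f x + g x).
Proof.
elim: n f g => // n ih f g [df nf] [dg ng].
by apply: nderivableS (ih _ _ nf ng) => x;
  apply: is_deriveD; exact: derivable_is_derive1.
Qed.

Lemma nderivableM n f g : nderivable n f -> nderivable n g ->
  nderivable n (fun x => f x * g x).
Proof.
elim: n f g => // n ih f g nf ng; case: (nf) => df nf'; case: (ng) => dg ng'.
have fgS := nderivableD (ih _ _ (nderivableW nf) ng') (ih _ _ (nderivableW ng) nf').
apply: nderivableS fgS => x.
have := is_deriveM (derivable_is_derive1 (df x)) (derivable_is_derive1 (dg x)).
by [].
Qed.

Lemma is_derive_affine f a b x d : is_derive (a * x + b) 1 f d ->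
  is_derive x 1 (fun x => f (a * x + b)) (a * d).
Proof.
move=> fd.
have h : is_derive x 1 (fun x : R => a * x + b) a.
  have -> : (fun x : R => a * x + b) = a \*: id + cst b by apply/funext.
  by apply: is_derive_eq; rewrite addr0 scaler1.
have := @is_derive1_comp _ f (fun x => a * x + b) x _ _ fd h.
by rewrite mulrC.
Qed.

Lemma nderivable_cst n (c : R) : nderivable n (fun=> c).
Proof.
elim: n c => // n ih c; apply: nderivableS (ih 0) => x; exact: is_derive_cst.
Qed.

Lemma nderivable_affine n f a b : nderivable n f ->
  nderivable n (fun x => f (a * x + b)).
Proof.
elim: n f => // n ih f [df nf].
apply: nderivableS (nderivableM (nderivable_cst n a) (ih _ nf)) => x.
by apply: is_derive_affine; exact: derivable_is_derive1.
Qed.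

Lemma smooth_derivable f x : smooth f -> derivable f x 1.
Proof. by move=> /(_ 1%N)[]. Qed.

Lemma smooth_is_derive f x : smooth f -> is_derive x 1 f (f^`() x).
Proof. by move=> sf; apply/derivable_is_derive1/smooth_derivable. Qed.

Lemma smooth_derive1 f : smooth f -> smooth f^`().
Proof. by move=> sf n; have [] := sf n.+1. Qed.

Lemma smooth_primitive f g : (forall x, is_derive x 1 f (g x)) -> smooth g -> smooth f.
Proof. by move=> fg sg [//|n]; exact: nderivableS fg (sg n). Qed.

Lemma smoothD f g : smooth f -> smooth g -> smooth (fun x => f x + g x).
Proof. by move=> sf sg n; exact: nderivableD. Qed.

Lemma smoothM f g : smooth f -> smooth g -> smooth (fun x => f x * g x).
Proof. by move=> sf sg n; exact: nderivableM. Qed.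

Lemma smooth_cst (c : R) : smooth (fun=> c).
Proof. by move=> n; exact: nderivable_cst. Qed.

Lemma smoothZ (c : R) f : smooth f -> smooth (fun x => c * f x).
Proof. by move=> sf; exact: smoothM (smooth_cst c) sf. Qed.

Lemma smoothB f g : smooth f -> smooth g -> smooth (fun x => f x - g x).
Proof.
move=> sf sg; have -> : (fun x => f x - g x) = (fun x => f x + -1 * g x).
  by apply/funext => x; rewrite mulN1r.
exact: smoothD sf (smoothZ _ sg).
Qed.

Lemma smooth_affine f a b : smooth f -> smooth (fun x => f (a * x + b)).
Proof. by move=> sf n; exact: nderivable_affine. Qed.

Lemma smooth_shift f b : smooth f -> smooth (fun x => f (x + b)).
Proof.
move=> sf; have -> : (fun x => f (x + b)) = (fun x => f (1 * x + b)).
  by apply/funext => x; rewrite mul1r.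
exact: smooth_affine.
Qed.

Lemma smooth_continuous f : smooth f -> continuous f.
Proof.
by move=> sf x; apply/differentiable_continuous/derivable1_diffP/smooth_derivable.
Qed.

Lemma derive1_smoothD f g x : smooth f -> smooth g ->
  (fun x => f x + g x)^`() x = f^`() x + g^`() x.
Proof.
move=> sf sg; rewrite derive1E; apply: derive_val.
by apply: is_deriveD; exact: smooth_is_derive.
Qed.

Lemma is_derive_smoothM f g x : smooth f -> smooth g ->
  is_derive x 1 (fun x => f x * g x) (f^`() x * g x + f x * g^`() x).
Proof.
move=> sf sg.
have := is_deriveM (smooth_is_derive x sf) (smooth_is_derive x sg).
by rewrite /GRing.scale/= addrC [g x * _]mulrC.
Qed.

Lemma derive1_smoothM f g x : smooth f -> smooth g ->
  (fun x => f x * g x)^`() x = f^`() x * g x + f x * g^`() x.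
Proof.
by move=> sf sg; rewrite derive1E; apply: derive_val; exact: is_derive_smoothM.
Qed.

Lemma derive1_smoothZ (c : R) f x : smooth f ->
  (fun x => c * f x)^`() x = c * f^`() x.
Proof.
move=> sf; rewrite (derive1_smoothM x (smooth_cst c) sf).
by rewrite derive1_cst mul0r add0r.
Qed.

Lemma derive1_smooth_affine f a b x : smooth f ->
  (fun x => f (a * x + b))^`() x = a * f^`() (a * x + b).
Proof.
move=> sf; rewrite derive1E; apply: derive_val.
by apply: is_derive_affine; exact: smooth_is_derive.
Qed.

Lemma smoothP f : smooth f <-> forall k x, derivable (f^`(k)%classic) x 1.
Proof.
split=> [sf k|df n].
  have : smooth f^`(k)%classic.
    by elim: k => [|k ih]; [rewrite derive1n0|rewrite derive1nS; exact: smooth_derive1].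
  by move=> s x; exact: smooth_derivable.
elim: n f df => // n ih f df; split; first by move=> x; have := df 0%N x.
by apply: ih => k x; have := df k.+1 x; rewrite derive1Sn.
Qed.

(** Working form of the definition: later arguments use compact support only as vanishing for large
    [|x|], with a bound [K] whose sign is left free. *)
Lemma test_functionP psi :
  test_function psi <->
  smooth psi /\ exists K : R, forall x, K < `|x| -> psi x = 0.
Proof.
split=> [[/smoothP sp cp]|[/smoothP sp [K psi0]]]; split => //.
  have /= := compact_bounded cp.
  case=> M [Mr HM]; exists (M + 1) => x Mx; apply: contra_ltP Mx => /eqP px.
  apply: HM; first by rewrite ltrDl.
  exact: subset_closure.
apply: (@subclosed_compact _ _ `[- K, K]%classic).
- exact: closed_closure.
- exact: segment_compact.
- rewrite closureE => y; apply; split; first exact: itv_closed.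
  move=> z /= /eqP pz; rewrite in_itv/=; rewrite -ler_norml leNgt.
  by apply/negP => /psi0.
Qed.

End Smooth.

(** * A smooth bump supported in [-1, 1] *)

Section Bump.
Context {R : realType}.
Implicit Types (f g psi : R -> R) (x t s : R) (n k : nat).

Lemma is_derive_near f g x d : (\forall y \near x, f y = g y) ->
  is_derive x 1 g d -> is_derive x 1 f d.
Proof.
move=> fg /little_oP gd; apply/little_oP; apply: little_o_le gd.
have fx := nbhs_singleton fg.
by apply: filterS fg => y ->; rewrite fx.
Qed.

(** The family [x^(-k) exp(-1/x)], extended by zero, is closed under differentiation up to linear
    combinations, so smoothness is proved for all [k] at once by induction on the order. *)
Definition flat_exp k x : R :=
  if 0 < x then x^-1 ^+ k * expR (- x^-1) else 0.

Lemma exprn_expRN_le k (y : R) : 0 <= y -> y ^+ k * expR (- y) <= k`!%:R.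
Proof.
move=> y0; rewrite expRN ler_pdivrMr ?expR_gt0//.
case: k => [|k]; first by rewrite expr0 fact0 mul1r -expR0 ler_expR.
rewrite -ler_pdivrMl ?ltr0n ?fact_gt0// mulrC.
by rewrite (le_trans _ (expR_ge1Dxn k y0))// lerDr.
Qed.

(** With [y = 1 / x] this is [y ^+ k.+2 * exp(-y) <= (k + 2)!]. Quadratic decay gives the derivative
    zero at the origin. *)
Lemma flat_exp_sqr_le k x : `|flat_exp k x| <= k.+2`!%:R * x ^+ 2.
Proof.
rewrite /flat_exp; case: ifPn => x0; last by rewrite normr0 mulr_ge0// sqr_ge0.
have xV0 : 0 <= x^-1 by rewrite invr_ge0 ltW.
rewrite ger0_norm; last by rewrite mulr_ge0 ?exprn_ge0 ?expR_ge0.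
have -> : x^-1 ^+ k * expR (- x^-1) = x^-1 ^+ k.+2 * expR (- x^-1) * x ^+ 2.
  have -> : x^-1 ^+ k = x^-1 ^+ k.+2 * x ^+ 2.
    by rewrite -addn2 exprD -mulrA -exprMn mulVf ?gt_eqF// expr1n mulr1.
  by rewrite mulrAC.
by rewrite ler_wpM2r ?sqr_ge0// exprn_expRN_le.
Qed.

Lemma is_derive_flat_exp k x :
  is_derive x 1 (flat_exp k) (- k%:R * flat_exp k.+1 x + flat_exp k.+2 x).
Proof.
have [x0|x0|->] := ltgtP x 0.
- apply: (@is_derive_near _ (fun=> 0)).
    near=> y; rewrite /flat_exp ifF//; apply/negbTE; rewrite -leNgt.
    by near: y; exact: lt_le_nbhsl.
  have fe0 j : flat_exp j x = 0 by rewrite /flat_exp ltNge (ltW x0).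
  by rewrite !fe0 mulr0 addr0; exact: is_derive_cst.
- apply: (@is_derive_near _ (fun y => y^-1 ^+ k * expR (- y^-1))).
    near=> y; rewrite /flat_exp ifT//.
    by near: y; exact: lt_nbhsr.
  rewrite /flat_exp x0.
  have dV : is_derive x 1 (fun y : R => y^-1) (- x ^- 2).
    have := @is_deriveV R id x 1 1 _ (is_derive_id _ _).
    by rewrite /GRing.scale/= mulr1; apply; rewrite gt_eqF.
  have dX := is_deriveX k dV.
  have dE := is_derive1_comp (is_derive_expR _) (is_deriveN dV).
  have -> : (fun y : R => y^-1 ^+ k * expR (- y^-1)) =
      (fun y : R => y^-1) ^+ k * (expR \o - (fun y : R => y^-1)).
    by apply/funext => y; rewrite !fctE.
  have dd := is_deriveM dX dE.
  apply: (is_derive_eq dd); rewrite !fctE /GRing.scale/= opprK -exprVn.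
  case: k {dX dd} => [|k] /=.
    by rewrite !expr0 !mul0r !mulr0 oppr0 mul0r add0r addr0 mul1r mulrC.
  by rewrite !exprS expr0; ring.
- have h : little_o 0 (fun s : R => s * (k.+2`!%:R * s)).
    have -> : (fun s => s * (k.+2`!%:R * s)) = (fun s => (s - 0) * (k.+2`!%:R * s)) :> (R -> R).
      by apply/funext => s; rewrite subr0.
    apply: little_o_cvg0; rewrite -[X in _ --> X](mulr0 (k.+2`!%:R : R)).
    by apply: cvgM; [exact: cvg_cst|exact: cvg_id].
  apply/little_oP; apply: little_o_le h; near=> s.
  have fe0 j : flat_exp j 0 = 0 by rewrite /flat_exp ltxx.
  rewrite !fe0 mulr0 addr0 mulr0 !subr0.
  by rewrite (le_trans (flat_exp_sqr_le k s))// expr2 mulrCA ler_norm.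
Unshelve. all: by end_near. Qed.

Lemma smooth_flat_exp k : smooth (flat_exp k).
Proof.
move=> n; elim: n k => // n ih k; apply: nderivableS (is_derive_flat_exp k) _.
apply: nderivableD; last exact: ih.
by apply: nderivableM; [exact: nderivable_cst|exact: ih].
Qed.

(** The factor [1 * x] keeps both arguments in the shape expected by [smooth_affine]. *)
Definition bump x : R := flat_exp 0 (1 * x + 1) * flat_exp 0 (-1 * x + 1).

Lemma smooth_bump : smooth bump.
Proof. by apply: smoothM; apply/smooth_affine/smooth_flat_exp. Qed.

Lemma flat_exp_ge0 k x : 0 <= flat_exp k x.
Proof.
rewrite /flat_exp; case: ifPn => // x0.
by rewrite mulr_ge0 ?expR_ge0// exprn_ge0// invr_ge0 ltW.
Qed.

Lemma bump_ge0 x : 0 <= bump x.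
Proof. by rewrite mulr_ge0 ?flat_exp_ge0. Qed.

Lemma bump_eq0 x : 1 <= `|x| -> bump x = 0.
Proof.
rewrite ler_normr /bump /flat_exp mul1r mulN1r => /orP[x1|x1].
  by rewrite [X in _ * X]ifF ?mulr0//; apply/negbTE; rewrite -leNgt; lra.
by rewrite ifF ?mul0r//; apply/negbTE; rewrite -leNgt; lra.
Qed.

(** Both factors are evaluated at points at least [1/2], where each is at least [exp(-2)]. This
    bounds the mass of the mollifying kernel from below. *)
Lemma bump_ge : exists2 c : R, 0 < c & forall x, `|x| <= 2^-1 -> c <= bump x.
Proof.
have fe (y : R) : 2^-1 <= y -> expR (- 2) <= flat_exp 0 y.
  move=> y1; have y0 : 0 < y by rewrite (lt_le_trans _ y1).
  rewrite /flat_exp y0 expr0 mul1r ler_expR lerN2 -[leRHS]invrK lef_pV2 ?posrE ?invr_gt0//.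
exists (expR (- 2) * expR (- 2)); first by rewrite mulr_gt0 ?expR_gt0.
move=> x; rewrite ler_norml => /andP[x1 x2].
by rewrite ler_pM ?expR_ge0// fe//; lra.
Qed.

End Bump.

(** * Primitives of functions that vanish near minus infinity *)

Section Primitive.
Context {R : realType}.
Notation mu := (@lebesgue_measure R).
Implicit Types (f g psi : R -> R) (x t s : R).

(** The base point [a - 1] leaves a margin: every [x >= a] is interior to the interval on which the
    fundamental theorem of calculus is applied, and to the left of [a] the primitive is zero. *)
Lemma primitive_of f (a : R) : continuous f -> (forall x, x < a -> f x = 0) ->
  let F x := \int[mu]_(t in `[a - 1, x]) f t in
  (forall x, is_derive x 1 F (f x)) /\ (forall x, x < a -> F x = 0).
Proof.
move=> cf f0 F.
have F0 x : x < a -> F x = 0.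
  move=> xa; rewrite /F (_ : 0 = \int[mu]_(t in `[a - 1, x]) 0); last first.
    by rewrite /Rintegral integral0.
  apply: eq_Rintegral => t; rewrite inE/= in_itv/= => /andP[_ tx].
  by rewrite f0// (le_lt_trans tx).
split=> // x; have [xa|ax] := ltP x a.
  rewrite f0//; apply: (@is_derive_near _ _ (fun=> 0)).
  by near=> y; apply: F0; near: y; exact: lt_nbhsl.
have [||||dF <-] := @continuous_FTC1_closed R f (a - 1) x (x + 1).
- by rewrite ltrDl.
- apply: continuous_compact_integrable; first exact: segment_compact.
  exact: continuous_subspaceT.
- by rewrite ltrBlDr (le_lt_trans ax)// ltrDl.
- exact: cf.
- exact: derivable_is_derive1.
Unshelve. all: by end_near. Qed.

Lemma Rintegral_support f (D : set R) :
  (forall x, f x != 0 -> D x) -> \int[mu]_(t in D) f t = \int[mu]_t f t.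
Proof.
move=> fD; rewrite Rintegral_mkcond; apply: eq_Rintegral => x _.
rewrite patchE; case: ifPn => //; rewrite notin_setE => nD.
by have [->|/fD] := eqVneq (f x) 0.
Qed.

Lemma smooth_primitive_of f (K : R) : smooth f -> (forall x, K < `|x| -> f x = 0) ->
  let F x := \int[mu]_(t in `[- K - 1, x]) f t in
  [/\ smooth F, F^`() = f, forall x, x < - K -> F x = 0 &
    forall x, K < x -> F x = \int[mu]_t f t].
Proof.
move=> sf f0.
have f0l x : x < - K -> f x = 0 by move=> xK; rewrite f0// lter_normr ltrNr xK orbT.
have [dF F0] := primitive_of (smooth_continuous sf) f0l.
split => //.
- exact: smooth_primitive sf.
- exact: is_derive_derive1.
move=> x Kx /=; apply: Rintegral_support => y.
apply: contraNP => /=; rewrite in_itv/= => /negP; rewrite negb_and -!ltNge => /orP[yK|xy].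
  by rewrite f0l// (lt_trans yK)// ltrBlDr ltrDl.
by rewrite f0// (lt_le_trans (lt_trans Kx xy))// ler_norm.
Qed.

End Primitive.

(** * The space L^2 of the real line *)

Section L2.
Context {R : realType}.
Notation mu := (@lebesgue_measure R).
Implicit Types (f g h : R -> R) (M c : R).

(** A real number by convention even when the product is not integrable, which is why the algebraic
    lemmas below carry [in_L2] hypotheses. [Lnorm2E] makes the link with the extended-real norm. *)
Definition ip f g : R := \int[mu]_x (f x * g x).
Definition nrm f : R := Num.sqrt (ip f f).
Definition ess_le f M : Prop := {ae mu, forall x, `|f x| <= M}.

Lemma ae_imp (P Q : R -> Prop) : (forall x, P x -> Q x) ->
  {ae mu, forall x, P x} -> {ae mu, forall x, Q x}.
Proof.
by move=> PQ; apply: filterS => [|x]; [exact: (ae_filter_ringOfSetsType mu)|exact: PQ].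
Qed.

Lemma ae_imp2 (P Q S : R -> Prop) : (forall x, P x -> Q x -> S x) ->
  {ae mu, forall x, P x} -> {ae mu, forall x, Q x} -> {ae mu, forall x, S x}.
Proof.
by move=> PQ; apply: filterS2 => [|x]; [exact: (ae_filter_ringOfSetsType mu)|exact: PQ].
Qed.

Lemma in_L2_measurable f : in_L2 f -> measurable_fun setT f.
Proof. by rewrite /in_L2 inE => /andP[/[!inE]]. Qed.

Lemma in_L2P f : in_L2 f <->
  measurable_fun setT f /\ mu.-integrable setT (EFin \o (fun x => f x ^+ 2)).
Proof.
split=> [f2|[mf /integrableP[_ f2]]].
  by split; [exact: in_L2_measurable|exact: Lfun2_integrable_sqr].
rewrite /in_L2 inE; apply/andP; split; rewrite inE//= /finite_norm.
apply: (lty_poweRy (r := 2)) => //; rewrite powR_Lnorm//.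
apply: le_lt_trans f2; rewrite le_eqVlt; apply/orP; left; apply/eqP.
by apply: eq_integral => x _ /=; rewrite powR_mulrn// normrX.
Qed.

Lemma in_L2_le f g : measurable_fun setT f -> in_L2 g ->
  {ae mu, forall x, f x ^+ 2 <= g x ^+ 2} -> in_L2 f.
Proof.
move=> mf /in_L2P[mg /integrableP[mg2 ig]] fg; apply/in_L2P; split => //.
apply/integrableP; split.
  by apply/measurable_EFinP; exact: measurable_funX.
apply: le_lt_trans ig; apply: ae_ge0_le_integral => //.
- apply/measurableT_comp => //; apply/measurable_EFinP; exact: measurable_funX.
- exact/measurableT_comp.
- apply: ae_imp fg => x fgx _ /=.
  by rewrite !ger0_norm ?sqr_ge0// lee_fin.
Qed.

Lemma integrable_ip f g : in_L2 f -> in_L2 g ->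
  mu.-integrable setT (EFin \o (fun x => f x * g x)).
Proof. by move=> f2 g2; apply/Lfun1_integrable; exact: Lfun2_mul_Lfun1. Qed.

Lemma in_L2Z c f : in_L2 f -> in_L2 (fun x => c * f x).
Proof.
move=> /in_L2P[mf f2]; apply/in_L2P; split.
  by apply: measurable_funM => //.
have := integrableZl measurableT (c ^+ 2) f2.
by apply: eq_integrable => // x _ /=; rewrite exprMn.
Qed.

Lemma in_L2D f g : in_L2 f -> in_L2 g -> in_L2 (fun x => f x + g x).
Proof.
move=> f2 g2; apply/in_L2P; split.
  by apply: measurable_funD; exact: in_L2_measurable.
have h1 := integrableD measurableT (integrable_ip f2 f2) (integrable_ip g2 g2).
have h2 := integrableD measurableT h1 (integrable_ip (in_L2Z 2 f2) g2).
move: h2; apply: eq_integrable => // x _ /=.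
by rewrite -!EFinD; congr EFin; ring.
Qed.

Lemma in_L2N f : in_L2 f -> in_L2 (fun x => - f x).
Proof. by move=> /(in_L2Z (-1)); under eq_fun do rewrite mulN1r. Qed.

Lemma in_L2B f g : in_L2 f -> in_L2 g -> in_L2 (fun x => f x - g x).
Proof. by move=> f2 g2; apply: in_L2D => //; exact: in_L2N. Qed.

Lemma in_L2_0 : in_L2 (fun=> 0 : R).
Proof.
apply/in_L2P; split; first exact: measurable_cst.
rewrite [X in _.-integrable _ X](_ : _ = cst 0%E).
  exact: integrable0.
by apply/funext => x /=; rewrite expr0n.
Qed.

(** A negative bound would make the whole line a null set, although [0, 1] has measure one. *)
Lemma ess_le_ge0 f M : ess_le f M -> 0 <= M.
Proof.
move=> fM; rewrite leNgt; apply/negP => M0.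
have : {ae mu, forall x : R, False}.
  by apply: ae_imp fM => x /le_lt_trans/(_ M0); rewrite normr_lt0.
case=> A [mA A0 AT].
have AsetT : A = setT by apply/seteqP; split => // x _; apply: AT => /=; exact.
move: A0; rewrite AsetT => A0.
have : (mu `[0%R, 1%R]%classic <= mu setT)%E by apply: le_measure => //; rewrite inE.
by rewrite A0 lebesgue_measure_itv/= lte01 oppr0 adde0 leNgt lte01.
Qed.

Lemma in_L2M M f g : measurable_fun setT f -> ess_le f M -> in_L2 g ->
  in_L2 (fun x => f x * g x).
Proof.
move=> mf fM g2; apply: (@in_L2_le _ (fun x => M * g x)).
- by apply: measurable_funM => //; exact: in_L2_measurable.
- exact: in_L2Z.
- apply: ae_imp fM => x fx; rewrite !exprMn ler_wpM2r ?sqr_ge0//.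
  rewrite -[f x ^+ 2]real_normK ?num_real//.
  by rewrite lerXn2r// ?nnegrE// (le_trans _ fx).
Qed.

Lemma ipC f g : ip f g = ip g f.
Proof. by apply: eq_Rintegral => x _; rewrite mulrC. Qed.

Lemma ipZl c f g : in_L2 f -> in_L2 g -> ip (fun x => c * f x) g = c * ip f g.
Proof.
move=> f2 g2; rewrite /ip -RintegralZl//; last exact: integrable_ip.
by apply: eq_Rintegral => x _; rewrite mulrA.
Qed.

Lemma ipDl f g h : in_L2 f -> in_L2 g -> in_L2 h ->
  ip (fun x => f x + g x) h = ip f h + ip g h.
Proof.
move=> f2 g2 h2; rewrite /ip -RintegralD//; [|exact: integrable_ip..].
by apply: eq_Rintegral => x _; rewrite mulrDl.
Qed.

Lemma ipBl f g h : in_L2 f -> in_L2 g -> in_L2 h ->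
  ip (fun x => f x - g x) h = ip f h - ip g h.
Proof.
move=> f2 g2 h2; rewrite /ip -RintegralB//; [|exact: integrable_ip..].
by apply: eq_Rintegral => x _; rewrite mulrBl.
Qed.

Lemma ipZr c f g : in_L2 f -> in_L2 g -> ip f (fun x => c * g x) = c * ip f g.
Proof. by move=> f2 g2; rewrite ipC ipZl// ipC. Qed.

Lemma ipDr f g h : in_L2 f -> in_L2 g -> in_L2 h ->
  ip h (fun x => f x + g x) = ip h f + ip h g.
Proof. by move=> f2 g2 h2; rewrite ipC ipDl// ipC [ip g _]ipC. Qed.

Lemma ipBr f g h : in_L2 f -> in_L2 g -> in_L2 h ->
  ip h (fun x => f x - g x) = ip h f - ip h g.
Proof. by move=> f2 g2 h2; rewrite ipC ipBl// ipC [ip g _]ipC. Qed.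

Lemma ipMr f g h : ip (fun x => g x * f x) h = ip f (fun x => g x * h x).
Proof. by apply: eq_Rintegral => x _; ring. Qed.

Lemma ipNl f g : in_L2 f -> in_L2 g -> ip (fun x => - f x) g = - ip f g.
Proof.
by move=> f2 g2; rewrite -mulN1r -ipZl//; congr ip; apply/funext => x; rewrite mulN1r.
Qed.

Lemma ip0l f : ip (fun=> 0) f = 0.
Proof.
by transitivity (\int[mu]_x (0 : R)); [apply: eq_Rintegral => x _; rewrite mul0r|rewrite /Rintegral integral0].
Qed.

Lemma ip_ge0 f : 0 <= ip f f.
Proof. by apply: Rintegral_ge0 => x _; rewrite -expr2 sqr_ge0. Qed.

Lemma nrm_ge0 f : 0 <= nrm f.
Proof. exact: sqrtr_ge0. Qed.

Lemma dist0_nrm f : `|0 - nrm f| = nrm f.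
Proof. by rewrite sub0r normrN ger0_norm// nrm_ge0. Qed.

Lemma sqr_nrm f : nrm f ^+ 2 = ip f f.
Proof. by rewrite sqr_sqrtr// ip_ge0. Qed.

Lemma nrm_le f c : 0 <= c -> ip f f <= c ^+ 2 -> nrm f <= c.
Proof.
by move=> c0 fc; rewrite -(ler_pXn2r (ltn0Sn 1)) ?nnegrE ?nrm_ge0// sqr_nrm.
Qed.

Lemma le_ip f g h k : in_L2 f -> in_L2 g -> in_L2 h -> in_L2 k ->
  {ae mu, forall x, f x * g x <= h x * k x} -> ip f g <= ip h k.
Proof.
move=> f2 g2 h2 k2 fg.
rewrite -subr_ge0 /ip -RintegralB//; [|exact: integrable_ip..].
apply: fine_ge0.
(* The integrand is replaced by its positive part, equal to it almost everywhere, so that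
   nonnegativity holds at every point. *)
have -> : (\int[mu]_x (h x * k x - f x * g x)%:E =
    \int[mu]_x (Num.max 0 (h x * k x - f x * g x))%:E)%E.
  apply: ae_eq_integral => //.
  - apply/measurable_EFinP; apply: measurable_funB; apply: measurable_funM; exact: in_L2_measurable.
  - apply/measurable_EFinP; apply: measurable_maxr => //.
    apply: measurable_funB; apply: measurable_funM; exact: in_L2_measurable.
  - by apply: ae_imp fg => x fgx _; rewrite max_r// subr_ge0.
by apply: integral_ge0 => x _; rewrite lee_fin le_max lexx.
Qed.

Lemma cauchy_schwarz f g : in_L2 f -> in_L2 g -> `|ip f g| <= nrm f * nrm g.
Proof.
move=> f2 g2.
(* The squared norm of [f - c g] as a quadratic polynomial in [c]. *)
have q c : 0 <= ip f f - c * ip f g *+ 2 + c ^+ 2 * ip g g.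
  have := ip_ge0 (fun x => f x - c * g x).
  have cg2 := in_L2Z c g2; have fg2 := in_L2B f2 cg2.
  by rewrite ipBl// !ipBr// !ipZl// !ipZr// [ip g f]ipC => /le_trans; apply; lra.
have : ip f g ^+ 2 <= ip f f * ip g g.
  have [g0|g0] := eqVneq (ip g g) 0.
    have [->|fg0] := eqVneq (ip f g) 0; first by rewrite expr0n mulr_ge0// ip_ge0.
    (* With [ip g g = 0] the polynomial is affine in [c]; this [c] gives it the negative value
       [- ip f f - 2]. *)
    have := q ((ip f f + 1) / ip f g).
    rewrite g0 mulr0 addr0 divfK//; have := ip_ge0 f; lra.
  have gp : 0 < ip g g by rewrite lt_def g0 ip_ge0.
  have := q (ip f g / ip g g).
  rewrite -(pmulr_lge0 _ gp).
  have -> : (ip f f - ip f g / ip g g * ip f g *+ 2 + (ip f g / ip g g) ^+ 2 * ip g g) * ip g g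
    = ip f f * ip g g - ip f g ^+ 2 by field.
  by rewrite subr_ge0.
rewrite -!sqr_nrm -exprMn -[X in X <= _]real_normK ?num_real//.
by rewrite ler_pXn2r// nnegrE// mulr_ge0// nrm_ge0.
Qed.

Lemma ler_ip f g : in_L2 f -> in_L2 g -> ip f g <= nrm f * nrm g.
Proof. by move=> f2 g2; rewrite (le_trans (ler_norm _))// cauchy_schwarz. Qed.

Lemma norm_ip_le f g c : in_L2 f -> in_L2 g -> nrm g <= c -> `|ip f g| <= nrm f * c.
Proof.
by move=> f2 g2 gc; rewrite (le_trans (cauchy_schwarz f2 g2))// ler_wpM2l// nrm_ge0.
Qed.

Lemma nrmD f g : in_L2 f -> in_L2 g -> nrm (fun x => f x + g x) <= nrm f + nrm g.
Proof.
move=> f2 g2; apply: nrm_le; first by rewrite addr_ge0// nrm_ge0.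
have fg2 := in_L2D f2 g2.
rewrite ipDl// !ipDr// sqrrD !sqr_nrm [ip g f]ipC.
have := ler_ip f2 g2; lra.
Qed.

Lemma nrmZ c f : in_L2 f -> nrm (fun x => c * f x) = `|c| * nrm f.
Proof.
move=> f2; rewrite /nrm ipZl// ?ipZr//; last exact: in_L2Z.
by rewrite mulrA -expr2 sqrtrM ?sqr_ge0// sqrtr_sqr.
Qed.

Lemma nrmN f : nrm (fun x => - f x) = nrm f.
Proof. by rewrite /nrm /ip; under eq_Rintegral do rewrite mulrNN. Qed.

Lemma nrmB f g : in_L2 f -> in_L2 g -> nrm (fun x => f x - g x) <= nrm f + nrm g.
Proof. by move=> f2 g2; rewrite -(nrmN g) nrmD//; exact: in_L2N. Qed.

Lemma nrmBC f g : nrm (fun x => f x - g x) = nrm (fun x => g x - f x).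
Proof. by rewrite -nrmN; congr nrm; apply/funext => x; rewrite opprB. Qed.

Lemma nrm_le_addB f g : in_L2 f -> in_L2 g -> nrm f <= nrm g + nrm (fun x => f x - g x).
Proof.
move=> f2 g2; rewrite [X in nrm X <= _](_ : f = (fun x => g x + (f x - g x))).
  by apply: nrmD => //; exact: in_L2B.
by apply/funext => x; rewrite addrC subrK.
Qed.

Lemma nrmB_trans f g h : in_L2 f -> in_L2 g -> in_L2 h ->
  nrm (fun x => f x - h x) <= nrm (fun x => f x - g x) + nrm (fun x => g x - h x).
Proof.
move=> f2 g2 h2.
have -> : (fun x => f x - h x) = (fun x => (f x - g x) + (g x - h x)).
  by apply/funext => x; rewrite addrA subrK.
by apply: nrmD; exact: in_L2B.
Qed.

Lemma nrmM_le M f g : measurable_fun setT f -> ess_le f M -> in_L2 g ->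
  nrm (fun x => f x * g x) <= M * nrm g.
Proof.
move=> mf fM g2; have M0 := ess_le_ge0 fM.
have fg2 := in_L2M mf fM g2.
apply: nrm_le; first by rewrite mulr_ge0// nrm_ge0.
rewrite exprMn sqr_nrm -ipZl//.
apply: le_ip => //; first exact: in_L2Z.
apply: ae_imp fM => x fx; have -> : f x * g x * (f x * g x) = f x ^+ 2 * g x ^+ 2 by ring.
rewrite -(mulrA (M ^+ 2)) -[g x * g x]expr2 ler_wpM2r ?sqr_ge0//.
by rewrite -[f x ^+ 2]real_normK ?num_real// lerXn2r// ?nnegrE// (le_trans _ fx).
Qed.

Lemma le_nrm f g : measurable_fun setT f -> in_L2 g -> {ae mu, forall x, `|f x| <= `|g x|} ->
  nrm f <= nrm g.
Proof.
move=> mf g2 fg.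
have fg' : {ae mu, forall x, f x ^+ 2 <= g x ^+ 2}.
  apply: ae_imp fg => x fgx.
  by rewrite -[f x ^+ 2]real_normK ?num_real// -[g x ^+ 2]real_normK ?num_real// lerXn2r.
have f2 := in_L2_le mf g2 fg'.
by rewrite ler_wsqrtr// le_ip//; apply: ae_imp fg' => x; rewrite !expr2.
Qed.

Lemma ip_ae f g h : measurable_fun setT f -> measurable_fun setT g -> measurable_fun setT h ->
  {ae mu, forall x, f x = g x} -> ip f h = ip g h.
Proof.
move=> mf mg mh fg; congr fine; apply: ae_eq_integral => //.
- by apply/measurable_EFinP; exact: measurable_funM.
- by apply/measurable_EFinP; exact: measurable_funM.
- by apply: ae_imp fg => x -> _.
Qed.

Lemma nrm_ae f g : measurable_fun setT f -> measurable_fun setT g ->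
  {ae mu, forall x, f x = g x} -> nrm f = nrm g.
Proof.
by move=> mf mg fg; rewrite /nrm (ip_ae mf mg mf fg) ipC (ip_ae mf mg mg fg).
Qed.

Lemma Lnorm2E f (A : set R) : measurable A -> in_L2 f ->
  L2norm A f = (nrm (fun x => \1_A x * f x))%:E.
Proof.
move=> mA f2.
have fA2 : in_L2 (fun x => \1_A x * f x).
  apply: (@in_L2M 1) => //; apply: aeW => x; rewrite indicE; case: (_ \in _) => /=.
    by rewrite normr1.
  by rewrite normr0.
rewrite /L2norm; have -> : f \_ A = (fun x => \1_A x * f x).
  apply/funext => x; rewrite patchE indicE; case: ifPn => _; first by rewrite mul1r.
  by rewrite mul0r.
rewrite unlock /= /nrm -powR12_sqrt ?ip_ge0// -poweR_EFin.
congr (_ `^ _)%E; rewrite /ip /Rintegral fineK; last first.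
  by apply: integrable_fin_num => //; exact: integrable_ip.
apply: eq_integral => x _ /=.
by rewrite -expr2 powR_mulrn// real_normK// num_real.
Qed.

End L2.

Local Notation wsq phi f := (ip (fun x => phi x * f x) f).
Local Notation L2dist f g := (nrm (fun x => f x - g x)).

(** * Translation invariance of the integral *)

Section Translation.
Context {R : realType}.
Notation mu := (@lebesgue_measure R).
Implicit Types (f g : R -> R) (a : R).

Lemma measurable_shift a : measurable_fun setT (fun x : R => x + a).
Proof. by apply: measurable_funD. Qed.

(** The image of the measure under the shift gives half-open intervals their length, and this
    characterises Lebesgue measure. *)
Lemma lebesgue_measure_shift a (A : set R) : measurable A ->
  mu ((fun x => x + a) @^-1` A) = mu A.
Proof.
move=> mA; have ms := measurable_shift a.
apply/esym.
apply: (@lebesgue_measure_unique _ (pushforward mu (fun x : measurableTypeR R => x + a : measurableTypeR R)) _ A mA).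
move=> _ [[b c] bc <-] /=.
have -> : pushforward mu (fun x : measurableTypeR R => x + a : measurableTypeR R) `]b, c]%classic
    = mu `](b - a), (c - a)]%classic.
  rewrite /pushforward; congr (mu _); apply/seteqP.
  by split=> x /=; rewrite !in_itv/= ltrBlDr lerBrDr.
rewrite !lebesgue_measure_itv /= !lte_fin ltrD2r; case: ifP => // _.
by rewrite -!EFinD; congr EFin; lra.
Qed.

Lemma ge0_integral_shift a (f : R -> \bar R) : measurable_fun setT f ->
  (forall x, (0 <= f x)%E) ->
  (\int[mu]_x f (x + a)%R = \int[mu]_x f x)%E.
Proof.
move=> mf f0; have ms := measurable_shift a.
have := @ge0_integral_pushforward _ _ (measurableTypeR R) (measurableTypeR R) R (fun x => x + a)
  ms mu setT f measurableT mf (fun y _ => f0 y).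
rewrite preimage_setT => <-.
apply: eq_measure_integral => A mA _; exact: lebesgue_measure_shift.
Qed.

Lemma in_L2_shift a f : in_L2 f -> in_L2 (fun x => f (x + a)).
Proof.
move=> /in_L2P[mf /integrableP[m2 i2]]; apply/in_L2P; split.
  by apply: (measurableT_comp mf); exact: measurable_shift.
apply/integrableP; split.
  by apply: (measurableT_comp m2); exact: measurable_shift.
rewrite (ge0_integral_shift a (f := fun x => `|(f x ^+ 2)%:E|%E))//.
exact: measurableT_comp.
Qed.

Lemma Rintegral_shift a f : mu.-integrable setT (EFin \o f) ->
  \int[mu]_x f (x + a) = \int[mu]_x f x.
Proof.
move=> fi; have ms := measurable_shift a.
congr fine; rewrite integralE [RHS]integralE.
have mf : measurable_fun setT (EFin \o f) by case/integrableP: fi.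
congr (_ - _)%E.
  rewrite -(ge0_integral_shift a (measurable_funepos mf)); last by move=> x; exact: funepos_ge0.
  by apply: eq_integral => x _; rewrite !funeposE.
rewrite -(ge0_integral_shift a (measurable_funeneg mf)); last by move=> x; exact: funeneg_ge0.
by apply: eq_integral => x _; rewrite !funenegE.
Qed.

Lemma ip_shift a f g : in_L2 f -> in_L2 g ->
  ip (fun x => f (x + a)) (fun x => g (x + a)) = ip f g.
Proof.
by move=> f2 g2; rewrite /ip (Rintegral_shift a (integrable_ip f2 g2)).
Qed.

Lemma nrm_shift a f : in_L2 f -> nrm (fun x => f (x + a)) = nrm f.
Proof. by move=> f2; rewrite /nrm ip_shift. Qed.

End Translation.

(** * Stability and integrability of test functions *)

Section TestFunctions.
Context {R : realType}.
Notation mu := (@lebesgue_measure R).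
Implicit Types (f g psi phi : R -> R) (K : R).

Lemma test_smooth psi : test_function psi -> smooth psi.
Proof. by case/test_functionP. Qed.

Lemma test_functionM phi psi : smooth phi -> test_function psi ->
  test_function (fun x => phi x * psi x).
Proof.
move=> sphi /test_functionP[sp [K psi0]]; apply/test_functionP; split.
  exact: smoothM.
by exists K => x /psi0 ->; rewrite mulr0.
Qed.

Lemma test_functionD f g : test_function f -> test_function g ->
  test_function (fun x => f x + g x).
Proof.
move=> /test_functionP[sf [K f0]] /test_functionP[sg [L g0]]; apply/test_functionP; split.
  exact: smoothD.
by exists (Num.max K L) => x; rewrite gt_max => /andP[/f0-> /g0->]; rewrite addr0.
Qed.

Lemma test_functionZ (c : R) f : test_function f -> test_function (fun x => c * f x).
Proof. by move=> tf; apply: test_functionM => //; exact: smooth_cst. Qed.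

Lemma test_functionB f g : test_function f -> test_function g ->
  test_function (fun x => f x - g x).
Proof.
move=> tf tg; rewrite (_ : (fun _ => _) = (fun x => f x + -1 * g x)).
  by apply: test_functionD => //; exact: test_functionZ.
by apply/funext => x; rewrite mulN1r.
Qed.

Lemma derive1_support psi K : smooth psi -> (forall x, K < `|x| -> psi x = 0) ->
  forall x, K < `|x| -> psi^`() x = 0.
Proof.
move=> sp psi0 x Kx; rewrite derive1E; apply: derive_val.
apply: is_derive_near (is_derive_cst 0 x 1).
have /nbhs_ballP[r /= r0 xr] : nbhs `|x| [set y | K < y] by exact: lt_nbhsr.
apply/nbhs_ballP; exists r => //= y xy; apply: psi0; apply: xr.
rewrite /ball /= in xy *; exact: le_lt_trans (ler_dist_dist _ _) xy.
Qed.

Lemma test_function_derive1 psi : test_function psi -> test_function psi^`().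
Proof.
move=> /test_functionP[sp [K psi0]]; apply/test_functionP; split.
  exact: smooth_derive1.
by exists K; exact: derive1_support.
Qed.

Lemma test_function_shift psi a : test_function psi -> test_function (fun x => psi (x + a)).
Proof.
move=> /test_functionP[sp [K psi0]]; apply/test_functionP; split.
  exact: smooth_shift.
exists (K + `|a|) => x Kx; apply: psi0.
have := ler_normB (x + a) a; rewrite addrK; lra.
Qed.

Lemma bounded_continuous_support f K : continuous f -> (forall x, K < `|x| -> f x = 0) ->
  exists B : R, forall x, `|f x| <= B.
Proof.
move=> cf f0.
have [K0|K0] := ltP K 0.
  by exists 0 => x; rewrite f0 ?normr0// (lt_le_trans K0).
have [c _ cmax] : exists2 c, c \in `[- K, K] & forall t, t \in `[- K, K] -> `|f t| <= `|f c|.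
  apply: (@EVT_max R (fun x => `|f x|)); first by lra.
  by apply: continuous_subspaceT => x; apply: continuous_comp; [exact: cf|exact: norm_continuous].
exists `|f c| => x; have [xK|/f0 ->] := leP `|x| K; last by rewrite normr0.
by apply: cmax; rewrite in_itv/= -ler_norml.
Qed.

Lemma test_bounded psi : test_function psi -> exists B : R, forall x, `|psi x| <= B.
Proof.
move=> /test_functionP[/smooth_continuous cp [K psi0]].
exact: bounded_continuous_support psi0.
Qed.

Lemma smooth_measurable f : smooth f -> measurable_fun setT f.
Proof. by move=> /smooth_continuous; exact: continuous_measurable_fun. Qed.

Lemma in_L2_indic (A : set R) : measurable A -> (mu A < +oo)%E -> in_L2 (\1_A : R -> R).
Proof.
move=> mA Aoo; apply/in_L2P; split; first exact: measurable_indic.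
apply/integrableP; split.
  by apply/measurable_EFinP; apply: measurable_funX; exact: measurable_indic.
rewrite (_ : integral _ _ _ = \int[mu]_x (\1_A x)%:E)%E; first by rewrite integral_indic// setIT.
apply: eq_integral => x _ /=; rewrite indicE; case: (_ \in _) => /=.
  by rewrite expr1n normr1.
by rewrite expr0n normr0.
Qed.

Lemma in_L2_indic_itv K : in_L2 (\1_(`[- K, K]%classic) : R -> R).
Proof.
apply: in_L2_indic => //; rewrite lebesgue_measure_itv /=.
by case: ifP => //; rewrite -EFinD ltry.
Qed.

Lemma in_L2_bounded_support f B K : measurable_fun setT f -> (forall x, `|f x| <= B) ->
  (forall x, K < `|x| -> f x = 0) -> in_L2 f.
Proof.
move=> mf fB f0.
apply: (@in_L2_le _ _ (fun x => B * \1_(`[- K, K]%classic) x)) => //; first exact/in_L2Z/in_L2_indic_itv.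
apply: aeW => x; rewrite indicE; case: (boolP (_ \in _)) => [_|xK] /=.
  rewrite mulr1 -[f x ^+ 2]real_normK ?num_real// lerXn2r// ?nnegrE// (le_trans _ (fB x))//.
rewrite f0 ?mulr0 ?expr0n// ltNge; apply: contra xK => xK; rewrite inE/=.
by rewrite in_itv/= -ler_norml.
Qed.

Lemma test_in_L2 psi : test_function psi -> in_L2 psi.
Proof.
move=> tp; have [B pB] := test_bounded tp; move: tp => /test_functionP[sp [K p0]].
exact: in_L2_bounded_support (smooth_measurable sp) pB p0.
Qed.

Lemma test_derive1_L2 psi : test_function psi -> in_L2 psi^`().
Proof. by move=> tp; exact/test_in_L2/test_function_derive1. Qed.

Lemma bounded_ess f B : (forall x, `|f x| <= B) -> ess_le f B.
Proof. by move=> fB; exact: aeW. Qed.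

End TestFunctions.

(** * Density of test functions *)

Section Mollifier.
Context {R : realType}.
Notation mu := (@lebesgue_measure R).
Implicit Types (f g psi phi : R -> R) (K e x : R).

(** The kernel is not normalised; [mollify] divides by its mass, which by [mker_mass] does not
    depend on the point. The [+ 0] fits [smooth_affine]. *)
Definition mker e (z : R) : R := bump (e^-1 * z + 0).

Lemma smooth_mker e : smooth (mker e).
Proof. by apply: smooth_affine; exact: smooth_bump. Qed.

Lemma mker_eq0 e z : 0 < e -> e <= `|z| -> mker e z = 0.
Proof.
move=> e0 ez; apply: bump_eq0; rewrite addr0 normrM gtr0_norm ?invr_gt0//.
by rewrite ler_pdivlMl// mulr1.
Qed.

Lemma test_mker e : 0 < e -> test_function (mker e).
Proof.
move=> e0; apply/test_functionP; split; first exact: smooth_mker.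
by exists e => x /ltW; exact: mker_eq0.
Qed.

Lemma test_mker_refl e x : 0 < e -> test_function (fun y => mker e (x - y)).
Proof.
move=> e0; apply/test_functionP; split.
  have -> : (fun y => mker e (x - y)) = (fun y => mker e (-1 * y + x)).
    by apply/funext => y; rewrite mulN1r addrC.
  exact: smooth_affine (smooth_mker e).
exists (e + `|x|) => y ey; apply: mker_eq0 => //.
have := ler_normB x (x - y); rewrite opprB addrC subrK; lra.
Qed.

Lemma test_integrable psi : test_function psi -> mu.-integrable setT (EFin \o psi).
Proof.
move=> tp; move: (tp) => /test_functionP[sp [K psi0]].
have [B pB] := test_bounded tp.
have := integrable_ip (in_L2_indic_itv K) (test_in_L2 tp).
apply: eq_integrable => // x _ /=; congr EFin.
have [xK|/psi0 ->] := leP `|x| K; last by rewrite mulr0.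
rewrite indicE mem_set ?mul1r//= in_itv/=; by rewrite -ler_norml.
Qed.

Lemma mker_mass e x : 0 < e -> \int[mu]_y mker e (x - y) = \int[mu]_y mker e (- y).
Proof.
move=> e0; have := test_integrable (test_mker_refl 0 e0).
under [X in EFin \o X]eq_fun do rewrite sub0r.
move=> /(Rintegral_shift (- x)) <-.
by apply: eq_Rintegral => y _; rewrite opprB.
Qed.

Lemma mker_mass_ge : exists2 c : R, 0 < c &
  forall e, 0 < e -> c * e <= \int[mu]_y mker e (- y).
Proof.
have [c c0 bc] := @bump_ge R; exists c => // e e0.
pose A : set R := `[- (e / 2), e / 2]%classic.
have iA : mu.-integrable setT (EFin \o (\1_A : R -> R)).
  have := integrable_ip (in_L2_indic_itv (e / 2)) (in_L2_indic_itv (e / 2)).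
  apply: eq_integrable => // y _ /=; congr EFin.
  by rewrite indicE; case: (_ \in _); rewrite ?mulr0 ?mulr1.
have mA : mu A = e%:E.
  have ee : - (e / 2) < e / 2 by lra.
  by rewrite /A lebesgue_measure_itv /= lte_fin ee -EFinD; congr EFin; lra.
have -> : c * e = \int[mu]_y (c * \1_A y).
  rewrite RintegralZl//; congr (_ * _).
  rewrite /Rintegral (_ : integral _ _ _ = \int[mu]_x (\1_A x)%:E)%E//.
  rewrite integral_indic //; last exact: measurable_itv.
  suff -> : A `&` setT = A by exact: esym (congr1 fine mA).
  exact: setIT.
have i0 := test_integrable (test_mker_refl 0 e0).
rewrite -(mker_mass 0 e0).
apply: le_Rintegral => //.
  have := integrableZl measurableT c iA.
  by apply: eq_integrable => // y _ /=.
move=> y _; rewrite indicE; case: (boolP (_ \in _)); last by rewrite mulr0 bump_ge0.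
rewrite inE /A/= in_itv/= mulr1 => /andP[y1 y2]; apply: bc.
rewrite sub0r addr0 normrM gtr0_norm ?invr_gt0// ler_pdivrMl// normrN ler_norml.
by apply/andP; split; lra.
Qed.

Lemma mker_le : exists2 B : R, 0 < B & forall e z, `|mker e z| <= B.
Proof.
have [B hB] : exists B : R, forall x, `|bump x| <= B.
  apply: test_bounded; apply/test_functionP; split; first exact: smooth_bump.
  by exists 1 => x /ltW; exact: bump_eq0.
by exists (`|B| + 1) => [|e z]; [rewrite ltr_wpDl|rewrite (le_trans (hB _))// ler_wpDr// ler_norm].
Qed.

Lemma locally_integrable_test f psi : locally_integrable setT f -> test_function psi ->
  mu.-integrable setT (EFin \o (fun x => f x * psi x)).
Proof.
move=> [mf _ li] tp; have [B pB] := test_bounded tp.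
move: (tp) => /test_functionP[/smooth_measurable mp [K p0]].
have iK : mu.-integrable setT (EFin \o (f \_ `[- K, K])).
  rewrite -restrict_EFin -integrable_mkcond//; apply/integrableP; split.
    by apply/measurable_EFinP; exact: measurable_funTS.
  by apply: li => //; exact: segment_compact.
apply: (le_integrable _ _ _ (integrableZl measurableT B iK)) => //.
  by apply/measurable_EFinP; exact: measurable_funM.
move=> x _ /=; rewrite lee_fin patchE; case: ifPn => [_|xK].
  by rewrite normrM mulrC normrM ler_wpM2r// (le_trans (pB x))// ler_norm.
rewrite p0 ?mulr0 ?normr0// ltNge; apply: contra xK => xK; rewrite inE/= in_itv/=.
by rewrite -ler_norml.
Qed.

Definition mollify f e x : R :=
  (\int[mu]_y mker e (- y))^-1 * \int[mu]_y (f y * mker e (x - y)).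

(** The kernel is at most [B], lives on the ball of radius [e] and length [2 * e], and has mass at
    least [c * e]: hence the constant [B * 2 / c]. Mollification therefore converges at every
    Lebesgue point. *)
Lemma mollify_davg : exists2 C : R, 0 < C & forall f e x, locally_integrable setT f ->
  0 < e -> (`|mollify f e x - f x|%:E <= C%:E * davg f x e)%E.
Proof.
have [c c0 mc] := mker_mass_ge; have [B B0 mB] := mker_le.
exists (B * 2 / c); first by rewrite !mulr_gt0// invr_gt0.
move=> f e x lf e0.
have tk := test_mker_refl x e0.
have ik := test_integrable tk.
have I0 : 0 < \int[mu]_y mker e (- y) by rewrite (lt_le_trans _ (mc e e0))// mulr_gt0.
have mf : measurable_fun setT f by case: lf.
pose g y := (f y - f x) * mker e (x - y).
have lfx : locally_integrable setT (fun y => f y - f x).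
  apply: (@locally_integrableB R setT f (cst (f x))) => //.
  split; [exact: measurable_cst|exact: openT|move=> K _ cK].
  rewrite (eq_integral (cst `|f x|%:E))// integral_cst//=; last exact: compact_measurable.
  by rewrite lte_mul_pinfty// compact_finite_measure.
have ig : mu.-integrable setT (EFin \o g) := locally_integrable_test lfx tk.
have -> : mollify f e x - f x = (\int[mu]_y mker e (- y))^-1 * \int[mu]_y g y.
  rewrite /mollify.
  have -> : \int[mu]_y g y = \int[mu]_y (f y * mker e (x - y)) - f x * \int[mu]_y mker e (x - y).
    rewrite -RintegralZl// -RintegralB//; last 2 first.
    - exact: locally_integrable_test.
    - exact: (integrableZl measurableT (f x) ik).
    by apply: eq_Rintegral => y _; rewrite /g mulrBl.
  by rewrite (mker_mass x e0) mulrBr [f x * _]mulrC mulKf// gt_eqF.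
have ballx : (\int[mu]_y `|g y|%:E <= B%:E * \int[mu]_(y in ball x e) `|f y - f x|%:E)%E.
  rewrite -ge0_integralZl//; last 3 first.
  - exact: measurable_ball.
  - apply/measurable_EFinP/measurableT_comp => //.
    by apply: measurable_funB => //; exact: measurable_funTS.
  - by rewrite lee_fin ltW.
  rewrite [leRHS]integral_mkcond; apply: ge0_le_integral => //.
  - apply/measurable_EFinP/measurableT_comp => //.
    by case/integrableP: ig => /measurable_EFinP.
  - apply/(measurable_restrictT _ _).1; first exact: measurable_ball.
    apply/measurable_funeM/measurable_EFinP/measurableT_comp => //.
    by apply: measurable_funB => //; exact: measurable_funTS.
  - move=> y _; rewrite patchE; case: ifPn => [_|].
      by rewrite -EFinM lee_fin /g normrM mulrC ler_wpM2r.
    rewrite notin_setE /ball/= => /negP; rewrite -leNgt => yx.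
    by rewrite /g mker_eq0 ?mulr0 ?normr0.
rewrite normrM normfV [`|\int[mu]_y mker e (- y)|]gtr0_norm//.
have le1 : (\int[mu]_y mker e (- y))^-1 <= (c * e)^-1.
  by rewrite lef_pV2 ?posrE ?mulr_gt0// mc.
have lhs : ((`|\int[mu]_y g y|)%:E <= B%:E * \int[mu]_(y in ball x e) `|f y - f x|%:E)%E.
  apply: le_trans ballx.
  rewrite (EFin_normr_Rintegral measurableT ig); apply: le_abse_integral => //.
  by case/integrableP: ig.
rewrite EFinM; apply: (@le_trans _ _ ((c * e)^-1%:E * (B%:E * \int[mu]_(y in ball x e) `|f y - f x|%:E))%E).
  by apply: lee_pmul => //; rewrite lee_fin// invr_ge0 ltW.
rewrite /davg /iavg (lebesgue_measure_ball _ (ltW e0)) inver mulrn_eq0/= gt_eqF//.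
rewrite !muleA -!EFinM; apply: lee_wpmul2r; first by apply: integral_ge0.
rewrite lee_fin le_eqVlt; apply/orP; left; apply/eqP.
by rewrite -mulr_natr; field; rewrite !gt_eqF.
Qed.

Lemma mollify_cvg f x : locally_integrable setT f -> lebesgue_pt f x ->
  mollify f e x @[e --> 0^'+] --> f x.
Proof.
move=> lf /= lpt; have [C C0 hC] := mollify_davg.
apply/cvgrPdist_le => r r0.
have : (C%:E * davg f x e @[e --> (0:R)^'+] --> C%:E * 0)%E by apply: cvgeZl.
rewrite mule0 => /fine_cvgP[fin cv].
near=> e.
have e0 : 0 < e by near: e; exact: nbhs_right_gt.
rewrite distrC -lee_fin (le_trans (hC f e x lf e0))//.
rewrite -[leLHS]fineK; last by near: e; exact: fin.
rewrite lee_fin (le_trans (ler_norm _))//.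
rewrite -[X in `|X|]subr0 distrC; near: e.
by move/cvgrPdist_le : cv => /(_ r r0).
Unshelve. all: by end_near. Qed.

(** Reflected kernels are test functions, so every mollification of [f] vanishes; yet mollifications
    converge to [f] at almost every point. *)
Lemma locally_integrable_ae0 f : locally_integrable setT f ->
  (forall psi, test_function psi -> \int[mu]_y (f y * psi y) = 0) ->
  {ae mu, forall x, f x = 0}.
Proof.
move=> lf f0; have := lebesgue_differentiation lf.
apply: ae_imp => x /(mollify_cvg lf) fx.
have : mollify f e x @[e --> 0^'+] --> (0 : R).
  apply: cvg_near_cst; near=> e.
  rewrite /mollify f0 ?mulr0//; apply: test_mker_refl.
  by near: e; exact: nbhs_right_gt.
move=> h0; exact: (cvg_unique _ fx h0).
Unshelve. all: by end_near. Qed.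

End Mollifier.

(** * Density of test functions in L^2 *)

Section Density.
Context {R : realType}.
Notation mu := (@lebesgue_measure R).
Implicit Types (f g psi phi : R -> R) (K M e x : R).

Lemma nrm_dominated (f_ : nat -> R -> R) f g :
  (forall k, measurable_fun setT (f_ k)) -> measurable_fun setT f -> in_L2 g ->
  (forall k x, `|f_ k x - f x| <= g x) ->
  {ae mu, forall x, f_ k x @[k --> \oo] --> f x} ->
  L2dist (f_ k) f @[k --> \oo] --> 0.
Proof.
move=> mf_ mf g2 fg cf.
have md k : measurable_fun setT (fun x => f_ k x - f x) by exact: measurable_funB.
have sq k x : (f_ k x - f x) ^+ 2 <= g x ^+ 2.
  by rewrite -[leLHS]real_normK ?num_real// lerXn2r// nnegrE// (le_trans _ (fg k x))//.
have := @dominated_convergence _ (measurableTypeR R) R mu setT measurableT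
  (fun k x => ((f_ k x - f x) ^+ 2)%:E) (cst 0%E) (fun x => (g x ^+ 2)%:E).
case=> //.
- by move=> k; apply/measurable_EFinP; apply: measurable_funX; exact: md.
- apply: ae_imp cf => x fx _; rewrite /cst; apply/fine_cvgP; split; first by near=> k.
  have h : f_ k x - f x @[k --> \oo] --> 0 by apply/subr_cvg0.
  have h2 : (fun k => (f_ k x - f x) * (f_ k x - f x)) @ \oo --> (0 * 0 : R).
    exact: cvgM.
  by rewrite mulr0 in h2; exact: h2.
- by have /in_L2P[] := g2.
- by apply: aeW => x k _; rewrite /= lee_fin ger0_norm ?sqr_ge0.
move=> _ _ cv.
have cv0 : ip (fun x => f_ k x - f x) (fun x => f_ k x - f x) @[k --> \oo] --> (0:R).
  by move: cv; rewrite integral0 => /fine_cvgP[_]; exact.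
have := @continuous_cvg _ _ _ _ _ _ (@Num.sqrt R) _ (@sqrt_continuous R 0) cv0.
rewrite sqrtr0; exact.
Unshelve. all: by end_near. Qed.

Lemma is_derive_convolution f psi x : mu.-integrable setT (EFin \o f) -> test_function psi ->
  is_derive x 1 (fun x => \int[mu]_y (f y * psi (x - y)))
    (\int[mu]_y (f y * psi^`() (x - y))).
Proof.
move=> fi tp; have [B pB] := test_bounded (test_function_derive1 tp).
have [B0 pB0] := test_bounded tp.
have sp := test_smooth tp.
have mf : measurable_fun setT f by case/integrableP: fi => /measurable_EFinP.
have d1 (z y : R) : is_derive z 1 (fun z => f y * psi (z - y)) (f y * psi^`() (z - y)).
  have h : is_derive z 1 (fun z => psi (z + - y)) (psi^`() (z + - y)).
    have := is_derive_affine (smooth_is_derive (1 * z + - y) sp).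
    by rewrite !mul1r; under eq_fun do rewrite mul1r.
  exact: is_deriveZ.
pose F (z y : R) := f y * psi (z - y).
have mp (z : R) : measurable_fun setT (fun y : R => psi (z - y)).
  apply: (measurableT_comp (smooth_measurable sp)).
  by apply: measurable_funB.
have iF (z : R) : mu.-integrable setT (EFin \o F z).
  apply: (le_integrable _ _ _ (integrableZl measurableT B0 fi)) => //.
    by apply/measurable_EFinP; apply: measurable_funM => //; exact: mp.
  move=> y _ /=; rewrite lee_fin /F normrM mulrC normrM ler_wpM2r//.
  by rewrite (le_trans (pB0 _))// ler_norm.
have a0 : `](x - 1), (x + 1)[%classic x by rewrite /= in_itv/=; apply/andP; split; lra.
have iG : mu.-integrable setT (EFin \o (fun y => `|B| * `|f y|)).
  have := integrableZl measurableT `|B| (integrable_abse fi).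
  by apply: eq_integrable => // y _ /=.
have dF1 (z y : R) : partial1of2 F z y = f y * psi^`() (z - y).
  by rewrite /partial1of2 derive1E; apply: derive_val.
have d2 (z y : R) : `](x - 1), (x + 1)[%classic z -> [set: R] y -> derivable (F ^~ y) z 1.
  by move=> _ _; have [] := d1 z y.
have ub (z y : R) : `](x - 1), (x + 1)[%classic z -> [set: R] y -> `|partial1of2 F z y| <= `|B| * `|f y|.
  by move=> _ _; rewrite dF1 normrM mulrC ler_wpM2r// (le_trans (pB _))// ler_norm.
have G0 (y : R) : 0 <= `|B| * `|f y| by rewrite mulr_ge0.
have hd := @derivable_under_integral R _ (measurableTypeR R) mu F setT measurableT x _ _ a0
   (fun z _ => iF z) d2 _ G0 iG ub.
have hv := @differentiation_under_integral R _ (measurableTypeR R) mu F setT measurableT x _ _ a0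
   (fun z _ => iF z) d2 _ G0 iG ub.
have := derivable_is_derive1 hd; rewrite hv => h.
by apply: (is_derive_eq h); apply: eq_Rintegral => y _; rewrite dF1.
Qed.

Lemma smooth_convolution f psi : mu.-integrable setT (EFin \o f) -> test_function psi ->
  smooth (fun x => \int[mu]_y (f y * psi (x - y))).
Proof.
move=> fi tp n; elim: n psi tp => // n ih psi tp.
apply: nderivableS (ih _ (test_function_derive1 tp)) => x.
exact: is_derive_convolution.
Qed.

(** Mollifications are weighted averages, so they keep the bound [M], and widths at most [1] enlarge
    the support by at most [1]. Dominated convergence then turns convergence at Lebesgue points into
    convergence in L^2. *)
Lemma test_dense_bounded f M K e : measurable_fun setT f -> (forall x, `|f x| <= M) ->
  (forall x, K < `|x| -> f x = 0) -> 0 < e ->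
  exists2 psi, test_function psi & L2dist psi f <= e.
Proof.
move=> mf fM f0 e0.
have M0 : 0 <= M by apply: le_trans (fM 0).
have f2 := in_L2_bounded_support mf fM f0.
have fi : mu.-integrable setT (EFin \o f).
  have := integrable_ip (in_L2_indic_itv K) f2.
  apply: eq_integrable => // x _ /=; congr EFin.
  have [xK|/f0 ->] := leP `|x| K; last by rewrite mulr0.
  by rewrite indicE mem_set ?mul1r//= in_itv/= -ler_norml.
have lf : locally_integrable setT f by apply: open_integrable_locally => //; exact: openT.
pose f_ k := mollify f k.+1%:R^-1.
have e_gt0 k : 0 < k.+1%:R^-1 :> R by rewrite invr_gt0.
have f_0 k x : K + 1 < `|x| -> f_ k x = 0.
  move=> xK; rewrite /f_ /mollify [X in _ * X](_ : _ = 0) ?mulr0//.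
  transitivity (\int[mu]_y (0 : R)); last by rewrite /Rintegral integral0.
  apply: eq_Rintegral => y0 _; move: (y0 : R) => {y0} y.
  have [yK|/f0 ->] := leP `|y| K; last by rewrite mul0r.
  rewrite mker_eq0 ?mulr0//; have := ler_normD (x - y) y.
  have : k.+1%:R^-1 <= 1 :> R by rewrite invf_le1// ler1n.
  rewrite subrK => h1 h2; apply: (le_trans h1).
  rewrite -(lerD2r `|y|) (le_trans _ h2)// (le_trans _ (ltW xK))// addrC lerD2r.
  exact: yK.
have test_f k : test_function (f_ k).
  apply/test_functionP; split; last by exists (K + 1) => x; exact: f_0.
  by apply: smoothZ; apply: smooth_convolution => //; exact: test_mker.
have [c c0 mc] := @mker_mass_ge R.
have f_M k x : `|f_ k x| <= M.
  pose I := \int[mu]_y mker k.+1%:R^-1 (- y).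
  have I0 : 0 < I by rewrite (lt_le_trans _ (mc _ (e_gt0 k)))// mulr_gt0.
  rewrite /f_ /mollify normrM gtr0_norm ?invr_gt0// ler_pdivrMl//.
  have tk := test_mker_refl x (e_gt0 k).
  rewrite (le_trans (le_normr_Rintegral _ _))//; first exact: locally_integrable_test.
  rewrite mulrC -(mker_mass x (e_gt0 k)) -RintegralZl//; last exact: test_integrable.
  apply: le_Rintegral => //.
  - by have := integrable_abse (locally_integrable_test lf tk).
  - exact: (integrableZl measurableT M (test_integrable tk)).
  by move=> y _; rewrite normrM [X in _ * X]ger0_norm ?bump_ge0// ler_wpM2r ?bump_ge0.
have : L2dist (f_ k) f @[k --> \oo] --> 0.
  pose L := Num.max (K + 1) K.
  apply: (@nrm_dominated _ _ (fun x => (M + M) * \1_(`[- L, L]%classic) x)).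
  - by move=> k; apply: smooth_measurable; apply: test_smooth; exact: test_f.
  - by [].
  - exact/in_L2Z/in_L2_indic_itv.
  - move=> k x; rewrite indicE; case: (boolP (_ \in _)) => [_|xL].
      by rewrite mulr1 (le_trans (ler_normB _ _))// lerD.
    have : L < `|x|.
      rewrite ltNge; apply: contra xL => xL; rewrite inE/=.
      by rewrite in_itv/= -ler_norml.
    by rewrite gt_max => /andP[/f_0-> /f0->]; rewrite subrr normr0 mulr0.
  - apply: ae_imp (lebesgue_differentiation lf) => x /(mollify_cvg lf) fx.
    have /cvg_at_rightP := fx; apply; split => //.
    exact: (@cvg_harmonic R).
move=> /cvgrPdist_le/(_ e e0)[k _ /(_ k (leqnn _))] /=.
by rewrite dist0_nrm => hk; exists (f_ k).
Qed.

Lemma test_dense f e : in_L2 f -> 0 < e ->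
  exists2 psi, test_function psi & L2dist psi f <= e.
Proof.
move=> f2 e0; have mf := in_L2_measurable f2.
(* The two indicators truncate in space and in size at once, which makes [f_ k] bounded with bounded
   support. *)
pose f_ (k : nat) x := f x * (\1_(`[- k%:R, k%:R]%classic) x * \1_(`[- k%:R, k%:R]%classic) (f x)).
have mi k : measurable_fun setT (\1_(`[- k%:R, k%:R]%classic) : R -> R).
  exact: measurable_indic.
have mf_ k : measurable_fun setT (f_ k).
  apply: measurable_funM => //; apply: measurable_funM => //.
  exact: (measurableT_comp (mi k)).
have in_ind (k : nat) (y : R) : `|y| <= k%:R -> \1_(`[- k%:R, k%:R]%classic) y = 1 :> R.
  by move=> yk; rewrite indicE mem_set//= in_itv/= -ler_norml.
have out_ind (k : nat) (y : R) : k%:R < `|y| -> \1_(`[- k%:R, k%:R]%classic) y = 0 :> R.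
  move=> yk; rewrite indicE; case: (boolP (_ \in _)) => //; rewrite inE/= in_itv/=.
  by rewrite -ler_norml leNgt yk.
have : L2dist (f_ k) f @[k --> \oo] --> 0.
  apply: (@nrm_dominated _ _ (fun x => `|f x|)) => //.
  - apply: (@in_L2_le _ _ f) => //; first exact: measurableT_comp.
    by apply: aeW => x; rewrite real_normK// num_real.
  - move=> k x; rewrite /f_ !indicE; case: (_ \in _); case: (_ \in _);
      by rewrite ?(mulr1, mulr0, mul0r, subrr, sub0r, normrN, normr0).
  - apply: aeW => x; apply: cvg_near_cst.
    near=> k; rewrite /f_ !in_ind ?mulr1//.
      by near: k; exact: nbhs_infty_ger.
    by near: k; exact: nbhs_infty_ger.
have e20 : 0 < e / 2 by rewrite divr_gt0.
move=> /cvgrPdist_le/(_ _ e20)[k _ /(_ k (leqnn _))] /=.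
rewrite dist0_nrm => hk.
have fk : forall x, `|f_ k x| <= k%:R.
  move=> x; rewrite /f_; have [xk|xk] := leP `|f x| k%:R; last first.
    by rewrite (out_ind _ _ xk) !mulr0 normr0.
  rewrite (in_ind _ _ xk) mulr1 normrM -[leRHS]mulr1 ler_pM//.
  by rewrite indicE; case: (_ \in _); rewrite ?normr1 ?normr0.
have fk0 : forall x, k%:R < `|x| -> f_ k x = 0.
  by move=> x xk; rewrite /f_ (out_ind _ _ xk) mul0r mulr0.
have [psi tp hp] := test_dense_bounded (mf_ k) fk fk0 e20.
exists psi => //; have fk2 := in_L2_bounded_support (mf_ k) fk fk0.
have p2 := test_in_L2 tp.
by rewrite (le_trans (nrmB_trans p2 fk2 f2))// [leRHS]splitr lerD.
Unshelve. all: by end_near. Qed.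

(** Duality: weak estimates against test functions become estimates in norm. This is how
    distributional time derivatives are promoted to derivatives in L^2. *)
Lemma nrm_le_test f c : in_L2 f -> 0 <= c ->
  (forall psi, test_function psi -> `|ip f psi| <= c * nrm psi) -> nrm f <= c.
Proof.
move=> f2 c0 fc; rewrite leNgt; apply/negP => cf.
have f0 : 0 < nrm f by rewrite (le_lt_trans c0).
(* Testing with a function [e]-close to [f] yields [4 * e * nrm f <= e * (c + nrm f)], which is
   absurd since [c < nrm f]. *)
pose e := (nrm f - c) / 4; have e0 : 0 < e by rewrite divr_gt0// subr_gt0.
have [psi tp hp] := test_dense f2 e0; have p2 := test_in_L2 tp.
have d2 := in_L2B p2 f2.
have h1 : nrm f ^+ 2 = ip f psi - ip f (fun x => psi x - f x).
  by rewrite sqr_nrm ipBr// opprB addrC subrK.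
have h2 := cauchy_schwarz f2 d2.
have h3 := fc _ tp.
have h4 : nrm psi <= nrm f + e.
  by rewrite (le_trans (nrm_le_addB p2 f2))// lerD.
have : nrm f ^+ 2 <= c * (nrm f + e) + nrm f * e.
  rewrite h1; move: h2 h3; rewrite !ler_norml => /andP[h21 h22] /andP[h31 h32].
  have : c * nrm psi <= c * (nrm f + e) by rewrite ler_wpM2l.
  have : nrm f * L2dist psi f <= nrm f * e by rewrite ler_wpM2l// ltW.
  lra.
rewrite /e; nra.
Qed.

End Density.

(** * Cutoffs *)

Section Cutoff.
Context {R : realType}.
Notation mu := (@lebesgue_measure R).
Implicit Types (f g psi phi : R -> R) (K M e x r : R).

(** The primitive is zero on the left and equal to the total integral on the right, so it is again a
    test function exactly when that integral vanishes. The L^1 bound feeds the supremum and Poincare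
    inequalities. *)
Lemma test_primitive psi K : test_function psi -> (forall x, K < `|x| -> psi x = 0) ->
  exists F : R -> R, [/\ smooth F, F^`() = psi, forall x, x < - K -> F x = 0,
    forall x, K < x -> F x = \int[mu]_t psi t &
    forall x, `|F x| <= \int[mu]_t `|psi t| ].
Proof.
move=> tp p0; have [sF dF Fl Fr] := smooth_primitive_of (test_smooth tp) p0.
have ip := test_integrable tp.
eexists; split; [exact: sF|exact: dF|exact: Fl|exact: Fr|move=> x].
have mI : measurable (`[- K - 1, x]%classic : set R) by exact: measurable_itv.
have iI : mu.-integrable `[- K - 1, x] (EFin \o psi) by apply: integrableS ip.
rewrite (le_trans (le_normr_Rintegral _ _))//.
rewrite Rintegral_mkcond; apply: le_Rintegral => //.
- rewrite -restrict_EFin -integrable_mkcond//.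
  by have := integrable_abse iI.
- by have := integrable_abse ip.
by move=> y _; rewrite patchE; case: ifP => // _; exact: normr_ge0.
Qed.

Lemma eq_derive1_smooth f g a : smooth f -> smooth g ->
  f^`() = g^`() -> f a = g a -> f = g.
Proof.
move=> sf sg dfg fga; apply/funext => x.
have h : f x - g x = f a - g a.
  apply: (@is_derive_0_is_cst R (fun x => f x - g x)) => y.
  have := is_deriveB (smooth_is_derive y sf) (smooth_is_derive y sg).
  by rewrite dfg subrr.
by apply/eqP; rewrite -subr_eq0 h fga subrr.
Qed.

Lemma test_primitive_eq psi K F : test_function psi -> (forall x, K < `|x| -> psi x = 0) ->
  smooth F -> F^`() = psi^`() -> (forall x, x < - K -> F x = 0) -> F = psi.
Proof.
move=> tp p0 sF dF Fl; pose a := - (`|K| + 1).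
have aK : a < - K by rewrite ltrN2 (le_lt_trans (ler_norm K))// ltrDl.
apply: (@eq_derive1_smooth _ _ a) => //; first exact: test_smooth.
by rewrite Fl// p0// lter_normr; apply/orP; right; rewrite ltrNr.
Qed.

Lemma Rintegral_derive1 psi : test_function psi -> \int[mu]_t psi^`() t = 0.
Proof.
move=> tp; have td := test_function_derive1 tp.
move: (tp) => /test_functionP[sp [K p0]].
have d0 := derive1_support sp p0.
have [F [sF dF Fl Fr _]] := test_primitive td d0.
have FE := test_primitive_eq tp p0 sF dF Fl.
have Kr : K < `|K| + 1 by rewrite (le_lt_trans (ler_norm K))// ltrDl.
by rewrite -(Fr _ Kr) FE p0// lter_normr Kr.
Qed.

Lemma nrm_normr f : nrm (fun y => `|f y|) = nrm f.
Proof.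
congr Num.sqrt; apply: eq_Rintegral => y _.
by rewrite -normrM ger0_norm// -expr2 sqr_ge0.
Qed.

Lemma in_L2_normr f : in_L2 f -> in_L2 (fun y => `|f y|).
Proof.
move=> f2; apply: (@in_L2_le _ _ f) => //.
  by apply: measurableT_comp => //; exact: in_L2_measurable.
by apply: aeW => y; rewrite real_normK ?num_real.
Qed.

(** The square of [psi] is the primitive of [2 psi psi'], hence bounded by its L^1 norm;
    Cauchy-Schwarz concludes. This is the one-dimensional Agmon inequality, with a constant that is
    not optimal. *)
Lemma test_sup psi x : test_function psi ->
  psi x ^+ 2 <= 2 * (nrm psi * nrm psi^`()).
Proof.
move=> tp; have td := test_function_derive1 tp; have sp := test_smooth tp.
have tpp : test_function (fun x => psi x * psi x) by exact: test_functionM.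
move: (tpp) => /test_functionP[spp [K p0]].
have [F [sF dF Fl _ FB]] := test_primitive (test_function_derive1 tpp) (derive1_support spp p0).
have FE := test_primitive_eq tpp p0 sF dF Fl.
have := FB x; rewrite FE ger0_norm; last by rewrite -expr2 sqr_ge0.
rewrite -expr2 => /le_trans; apply.
have ap2 := in_L2_normr (test_in_L2 tp); have ad2 := in_L2_normr (test_in_L2 td).
have -> : \int[mu]_t `|(fun x => psi x * psi x)^`() t| =
    2 * ip (fun y => `|psi y|) (fun y => `|psi^`() y|).
  rewrite -ipZl//; apply: eq_Rintegral => y _.
  rewrite derive1_smoothM// [X in `|X|](_ : _ = 2 * (psi y * psi^`() y)); last by ring.
  by rewrite !normrM [`|2|]ger0_norm// mulrA.
by rewrite ler_wpM2l// (le_trans (ler_ip _ _))// !nrm_normr.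
Qed.

(** A fixed nonnegative test function of positive integral. Its primitive is the smooth step, and
    its multiples correct the mean of other test functions. *)
Definition eta (y : R) : R := mker 1 (0 - y).

Lemma eta_props : [/\ test_function eta, forall x, 0 <= eta x,
  forall x, 1 <= `|x| -> eta x = 0 & 0 < \int[mu]_t eta t].
Proof.
split; first exact: test_mker_refl.
- by move=> x; exact: bump_ge0.
- by move=> x x1; rewrite /eta mker_eq0// sub0r normrN.
- have [c c0 mc] := @mker_mass_ge R.
  by rewrite mker_mass// (lt_le_trans _ (mc 1 ltr01))// mulr1.
Qed.

Lemma smooth_step : exists S : R -> R, [/\ smooth S, forall x, x <= -1 -> S x = 0,
  forall x, 1 <= x -> S x = 1, forall x, 0 <= S x <= 1 & test_function S^`()].
Proof.
have [te e0 e1 I0] := eta_props; set I := \int[mu]_t eta t in I0.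
have e1' x : 1 < `|x| -> eta x = 0 by move=> /ltW; exact: e1.
have [F [sF dF Fl Fr _]] := test_primitive te e1'.
have Fmono x y : x <= y -> F x <= F y.
  move=> xy; have [yx|xy'|->//] := ltgtP y x; first by rewrite leNgt yx in xy.
  have dFx (z : R) : is_derive z 1 F (eta z) by rewrite -dF; exact: smooth_is_derive.
  have [|c _ h] := @MVT R F eta x y xy' (fun z _ => dFx z).
    by apply: derivable_within_continuous => z _; exact: smooth_derivable.
  by rewrite -subr_ge0 h mulr_ge0// subr_ge0 ltW.
have F1 x : F x <= I.
  have -> : I = F (Num.max x 2) by rewrite Fr// lt_max; apply/orP; right; lra.
  by apply: Fmono; rewrite le_max lexx.
have F0 x : 0 <= F x.
  have <- : F (Num.min x (-2)) = 0 by rewrite Fl// gt_min; apply/orP; right; lra.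
  by apply: Fmono; rewrite ge_min lexx.
have cF := smooth_continuous sF.
(* The primitive is known only strictly outside the support; its values at the two endpoints follow
   from continuity. *)
have Fn1 : F (-1) = 0.
  have cl := cF (-1).
  have h : F y @[y --> (-1)^'-] --> F (-1) by apply: cvg_at_left_filter.
  have h0 : F y @[y --> (-1)^'-] --> (0 : R).
    apply: cvg_near_cst; near=> y; apply: Fl; near: y; exact: nbhs_left_lt.
  exact: (cvg_unique _ h h0).
have Fp1 : F 1 = I.
  have h : F y @[y --> 1^'+] --> F 1 by apply: cvg_at_right_filter; exact: cF.
  have h0 : F y @[y --> 1^'+] --> I.
    apply: cvg_near_cst; near=> y; apply: Fr; near: y; exact: nbhs_right_gt.
  exact: (cvg_unique _ h h0).
exists (fun x => I^-1 * F x); split.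
- exact: smoothZ.
- move=> x; rewrite le_eqVlt => /orP[/eqP ->|/Fl ->]; first by rewrite Fn1 mulr0.
  by rewrite mulr0.
- move=> x; rewrite le_eqVlt => /orP[/eqP <-|/Fr ->].
    by rewrite Fp1 mulVf// gt_eqF.
  by rewrite mulVf// gt_eqF.
- by move=> x; rewrite mulr_ge0 ?invr_ge0 ?(ltW I0)//= ler_pdivrMl// mulr1.
- rewrite (_ : _^`() = fun x => I^-1 * eta x); first exact: test_functionZ.
  by apply/funext => x; rewrite derive1_smoothZ// dF.
Unshelve. all: by end_near. Qed.

(** The first derivative needs the uniform scaling [C / r], the source of every decay rate. The
    second derivative only has to be bounded for each [r], to justify Taylor expansions of the
    weight. *)
Record tail_cutoff (phi : R -> R -> R) : Prop := TailCutoff {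
  tail_smooth : forall r, 0 < r -> smooth (phi r);
  tail_itv : forall r x, 0 < r -> 0 <= phi r x <= 1;
  tail_eq1 : forall r x, 0 < r -> r <= `|x| -> phi r x = 1;
  tail_eq0 : forall r x, 0 < r -> `|x| <= r / 8 -> phi r x = 0;
  tail_derive : exists2 C : R, 0 < C & forall r x, 0 < r -> `|(phi r)^`() x| <= C / r;
  tail_derive2 : forall r, 0 < r -> exists C : R, forall x, `|(phi r)^`()^`() x| <= C
}.

Lemma tail_cutoff_exists : exists phi : R -> R -> R, tail_cutoff phi.
Proof.
have [S [sS S0 S1 S01 tS]] := smooth_step.
have sS1 := smooth_derive1 sS.
have [B1 hB1] := test_bounded tS.
have [B2 hB2] := test_bounded (test_function_derive1 tS).
(* Since [S] rises between [-1] and [1], the transitions occur for [|x|] between [r / 4] and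
   [3 r / 4], within the announced thresholds [r / 8] and [r]. *)
pose phi (r x : R) := S (4 / r * x + - 2) + S (- (4 / r) * x + -2).
have dphi r : (phi r)^`() = fun x =>
    4 / r * S^`() (4 / r * x + - 2) + - (4 / r) * S^`() (- (4 / r) * x + -2).
  apply/funext => x; rewrite derive1_smoothD; [|exact: smooth_affine..].
  by rewrite !derive1_smooth_affine.
have ddphi r : (phi r)^`()^`() = fun x =>
    4 / r * (4 / r * S^`()^`() (4 / r * x + - 2)) +
    4 / r * (4 / r * S^`()^`() (- (4 / r) * x + -2)).
  rewrite dphi; apply/funext => x.
  rewrite derive1_smoothD; [|exact/smoothZ/smooth_affine..].
  rewrite !derive1_smoothZ ?derive1_smooth_affine//; [|exact: smooth_affine..].
  by rewrite !mulNr mulrN opprK.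
have r4 r : 0 < r -> 0 < 4 / r by move=> r0; rewrite divr_gt0.
exists phi; split.
- by move=> r r0; apply: smoothD; exact: smooth_affine.
- move=> r x r0; have rr := r4 r r0.
  have [x0|x0] := leP 0 x.
    rewrite /phi [X in _ + X]S0 ?addr0//.
    have : 0 <= 4 / r * x by rewrite mulr_ge0// ltW.
    rewrite mulNr; lra.
  rewrite /phi [X in X + _]S0 ?add0r//.
  have : 4 / r * x <= 0 by rewrite nmulr_lle0// ltW.
  lra.
- move=> r x r0 rx; have rr := r4 r r0; have rK : 4 / r * r = 4 by rewrite divfK// gt_eqF.
  rewrite /phi; move: rx; rewrite ler_normr => /orP[rx|rx].
    have : 4 / r * r <= 4 / r * x by rewrite ler_pM2l.
    move=> h; rewrite S1; last lra.
    by rewrite S0 ?addr0// mulNr; lra.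
  have : 4 / r * r <= 4 / r * - x by rewrite ler_pM2l.
  move=> h; rewrite S0; last by rewrite mulrN in h; lra.
  by rewrite S1 ?add0r// mulNr; rewrite mulrN in h; lra.
- move=> r x r0; rewrite ler_norml => /andP[x1 x2]; have rr := r4 r r0.
  have rK : 4 / r * (r / 8) = 2^-1 by field; rewrite gt_eqF.
  have h1 : 4 / r * x <= 4 / r * (r / 8) by rewrite ler_pM2l.
  have h2 : 4 / r * - (r / 8) <= 4 / r * x by rewrite ler_pM2l.
  by rewrite /phi !S0 ?addr0// ?mulNr; rewrite ?mulrN in h2; lra.
- exists (8 * (`|B1| + 1)); first by rewrite mulr_gt0// ltr_wpDl.
  move=> r x r0; rewrite dphi (le_trans (ler_normD _ _))//.
  have nM y : `|4 / r * y| = 4 / r * `|y| by rewrite normrM [`|4 / r|]gtr0_norm// r4.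
  rewrite mulNr normrN !nM.
  have h1 y : `|S^`() y| <= `|B1| + 1.
    by rewrite (le_trans (hB1 _))// (le_trans (ler_norm _))// lerDl.
  have -> : 8 * (`|B1| + 1) / r = 4 / r * (`|B1| + 1) + 4 / r * (`|B1| + 1) by field; rewrite gt_eqF.
  by apply: lerD; apply: ler_wpM2l => //; rewrite ltW// r4.
- move=> r r0; exists (4 / r * (4 / r * B2) + 4 / r * (4 / r * B2)) => x.
  have r40 := r4 r r0.
  have le2 z : `|z| <= B2 -> `|4 / r * (4 / r * z)| <= 4 / r * (4 / r * B2).
    by move=> zB; rewrite !(normrM (4 / r)) [`|4 / r|]gtr0_norm// !ler_pM2l.
  rewrite ddphi; apply: (le_trans (ler_normD _ _)).
  by apply: lerD; apply: le2.
Qed.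

End Cutoff.

(** * Weak derivatives *)

Section Sobolev.
Context {R : realType}.
Notation mu := (@lebesgue_measure R).
Implicit Types (f g h psi phi : R -> R) (K M e x r c : R).

(** Membership of [f] in H^1 with derivative [g], for real functions: unlike [weak_derivative],
    square integrability of both is built in. *)
Definition weakd f g : Prop := [/\ in_L2 f, in_L2 g &
  forall psi, test_function psi -> ip f psi^`() = - ip g psi].

Lemma weakd_L2 f g : weakd f g -> in_L2 f. Proof. by case. Qed.
Lemma weakd_L2' f g : weakd f g -> in_L2 g. Proof. by case. Qed.

Lemma weakd_test psi : test_function psi -> weakd psi psi^`().
Proof.
move=> tp; have td := test_function_derive1 tp; have sp := test_smooth tp.
split; [exact: test_in_L2|exact: test_in_L2|move=> xi tx].
have := Rintegral_derive1 (test_functionM sp tx).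
have -> : (fun x => psi x * xi x)^`() =
    (fun x => psi^`() x * xi x + psi x * xi^`() x).
  by apply/funext => x; rewrite derive1_smoothM//; exact: test_smooth.
rewrite RintegralD//; last 2 first.
- exact: integrable_ip (test_derive1_L2 tp) (test_in_L2 tx).
- exact: integrable_ip (test_in_L2 tp) (test_derive1_L2 tx).
by rewrite /ip => h; lra.
Qed.

Lemma weakdD f f' g g' : weakd f f' -> weakd g g' ->
  weakd (fun x => f x + g x) (fun x => f' x + g' x).
Proof.
move=> [f2 f'2 ff'] [g2 g'2 gg']; split; [exact: in_L2D|exact: in_L2D|move=> psi tp].
have p2 := test_in_L2 tp; have d2 := test_derive1_L2 tp.
by rewrite !ipDl// ff'// gg'// opprD.
Qed.

Lemma weakdB f f' g g' : weakd f f' -> weakd g g' ->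
  weakd (fun x => f x - g x) (fun x => f' x - g' x).
Proof.
move=> [f2 f'2 ff'] [g2 g'2 gg']; split; [exact: in_L2B|exact: in_L2B|move=> psi tp].
have p2 := test_in_L2 tp; have d2 := test_derive1_L2 tp.
by rewrite !ipBl// ff'// gg'// opprB addrC opprK.
Qed.

(** The multipliers of H^1 in use. They are smooth, so that their products with test functions stay
    test functions, and they need not have compact support. *)
Definition bounded_C1 phi : Prop := [/\ smooth phi, exists M, forall x, `|phi x| <= M &
  exists M, forall x, `|phi^`() x| <= M].

Lemma bounded_C1_L2 phi f : bounded_C1 phi -> in_L2 f -> in_L2 (fun x => phi x * f x).
Proof.
move=> [sp [M pM] _] f2; apply: (in_L2M (smooth_measurable sp)) => //.
exact: (bounded_ess pM).
Qed.

Lemma bounded_C1_L2' phi f : bounded_C1 phi -> in_L2 f ->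
  in_L2 (fun x => phi^`() x * f x).
Proof.
move=> [sp _ [M pM]] f2; apply: (in_L2M (smooth_measurable (smooth_derive1 sp))) => //.
exact: (bounded_ess pM).
Qed.

Lemma test_bounded_C1 psi : test_function psi -> bounded_C1 psi.
Proof.
move=> tp; split; [exact: test_smooth|exact: test_bounded|].
exact/test_bounded/test_function_derive1.
Qed.

Lemma weakdM_smooth phi f f' : bounded_C1 phi -> weakd f f' ->
  weakd (fun x => phi x * f x) (fun x => phi^`() x * f x + phi x * f' x).
Proof.
move=> bp [f2 f'2 ff']; have [sp _ _] := bp.
have l1 := bounded_C1_L2 bp f2; have l2 := bounded_C1_L2 bp f'2.
have l3 := bounded_C1_L2' bp f2.
split => //; first exact: in_L2D.
move=> psi tp; have tpp := test_functionM sp tp.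
have p2 := test_in_L2 tp; have d2 := test_derive1_L2 tp.
have := ff' _ tpp.
have -> : (fun x => phi x * psi x)^`() =
    (fun x => phi^`() x * psi x + phi x * psi^`() x).
  by apply/funext => x; rewrite derive1_smoothM//; exact: test_smooth.
rewrite ipDr//; last 2 first.
- exact: bounded_C1_L2'.
- exact: bounded_C1_L2.
rewrite ipDl// !(ipMr f) (ipMr f'); lra.
Qed.

Definition cut : R -> R -> R := sval (cid (@tail_cutoff_exists R)).

Lemma cutP : tail_cutoff cut.
Proof. exact: svalP (cid (@tail_cutoff_exists R)). Qed.

Lemma cut_bounded_C1 r : 0 < r -> bounded_C1 (cut r).
Proof.
move=> r0; split; first exact: (tail_smooth cutP).
  by exists 1 => x; have /andP[? ?] := tail_itv cutP x r0; rewrite ger0_norm.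
by have [C _ hC] := tail_derive cutP; exists (C / r) => x; exact: hC.
Qed.

Lemma cut_L2 r f : 0 < r -> in_L2 f -> in_L2 (fun x => cut r x * f x).
Proof. by move=> r0; apply: bounded_C1_L2; exact: cut_bounded_C1. Qed.

(** Once [r / 8] exceeds the radius of the support of an approximating test function, the cutoff
    annihilates that function and only the approximation error survives. *)
Lemma cut_small f e : in_L2 f -> 0 < e ->
  exists2 r0, 0 < r0 & forall r, r0 <= r -> nrm (fun x => cut r x * f x) <= e.
Proof.
move=> f2 e0; have [psi tp hp] := test_dense f2 e0; have p2 := test_in_L2 tp.
move: (tp) => /test_functionP[sp [K p0]].
exists (8 * (`|K| + 1)); first by rewrite mulr_gt0// ltr_wpDl.
move=> r Kr; have r0 : 0 < r by rewrite (lt_le_trans _ Kr)// mulr_gt0// ltr_wpDl.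
apply: le_trans hp; rewrite nrmBC -[leRHS]mul1r.
have -> : (fun x => cut r x * f x) = (fun x => cut r x * (f x - psi x)).
  apply/funext => x; have [xr|xr] := leP `|x| (r / 8).
    by rewrite (tail_eq0 cutP)// !mul0r.
  rewrite p0 ?subr0// (le_lt_trans _ xr)// ler_pdivlMr//.
  rewrite mulrC (le_trans _ Kr)// ler_pM2l// (le_trans (ler_norm _))// lerDl//.
apply: nrmM_le; last exact: in_L2B.
  exact: (smooth_measurable (tail_smooth cutP r0)).
by apply: bounded_ess => x; have /andP[? ?] := tail_itv cutP x r0; rewrite ger0_norm.
Qed.

Definition cocut r x : R := 1 - cut r x.

Lemma cocut_eq1 r x : 0 < r -> `|x| <= r / 8 -> cocut r x = 1.
Proof. by move=> r0 xr; rewrite /cocut (tail_eq0 cutP)// subr0. Qed.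

Lemma cocut_eq0 r x : 0 < r -> r <= `|x| -> cocut r x = 0.
Proof. by move=> r0 xr; rewrite /cocut (tail_eq1 cutP)// subrr. Qed.

Lemma smooth_cocut r : 0 < r -> smooth (cocut r).
Proof. by move=> r0; apply: smoothB; [exact: smooth_cst|exact: (tail_smooth cutP)]. Qed.

Lemma test_cocut r : 0 < r -> test_function (cocut r).
Proof.
move=> r0; apply/test_functionP; split; first exact: smooth_cocut.
by exists r => x /ltW; exact: cocut_eq0.
Qed.

Lemma cocut_itv r x : 0 < r -> 0 <= cocut r x <= 1.
Proof. by move=> r0; have := tail_itv cutP x r0; rewrite /cocut; lra. Qed.

Lemma derive1_cocut r x : 0 < r -> (cocut r)^`() x = - (cut r)^`() x.
Proof.
move=> r0; rewrite derive1E; apply: derive_val.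
have sc : is_derive x 1 (cut r) _ := smooth_is_derive x (tail_smooth cutP r0).
have := is_deriveB (is_derive_cst (1 : R) x 1) sc.
by rewrite sub0r.
Qed.

Lemma derive1_cocut_eq0 r x : 0 < r -> `|x| < r / 8 -> (cocut r)^`() x = 0.
Proof.
move=> r0 xr; rewrite derive1E; apply: derive_val.
apply: is_derive_near (is_derive_cst (1 : R) x 1).
have /nbhs_ballP[d /= d0 xd] : nbhs `|x| [set y | y < r / 8] by exact: lt_nbhsl.
apply/nbhs_ballP; exists d => //= y xy; apply: cocut_eq1 => //; apply/ltW/xd.
rewrite /ball /= in xy *; exact: le_lt_trans (ler_dist_dist _ _) xy.
Qed.

(* duality: pair [h] with [zeta], replaced by the derivative of a truncated primitive *)
Lemma poincare L : 0 < L -> exists2 C, 0 <= C &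
  forall h h', weakd h h' -> (forall x, L < `|x| -> h x = 0) -> nrm h <= C * nrm h'.
Proof.
(* With this [r], [r / 8 = 2 * L], so [cocut r] equals one and has zero derivative wherever [h] may
   be nonzero. *)
move=> L0; pose r := 16 * L; have r0 : 0 < r by rewrite mulr_gt0.
have tc := test_cocut r0; have c2 := test_in_L2 tc; have sc := test_smooth tc.
exists (nrm (cocut r) ^+ 2); first by rewrite sqr_ge0.
move=> h h' [h2 h'2 hh'] h0.
apply: nrm_le_test => //; first by rewrite mulr_ge0 ?sqr_ge0 ?nrm_ge0.
move=> zeta tz; have z2 := test_in_L2 tz.
have tcz : test_function (fun x => cocut r x * zeta x) by exact: test_functionM.
move: (tcz) => /test_functionP[_ [K cz0]].
have [Z [sZ dZ _ _ ZB]] := test_primitive tcz cz0.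
have ZB' x : `|Z x| <= nrm (cocut r) * nrm zeta.
  rewrite (le_trans (ZB x))//.
  have -> : \int[mu]_t `|cocut r t * zeta t| = ip (fun t => `|cocut r t|) (fun t => `|zeta t|).
    by apply: eq_Rintegral => t _; rewrite normrM.
  by rewrite (le_trans (ler_ip _ _)) ?nrm_normr//; exact: in_L2_normr.
pose theta x := Z x * cocut r x.
have tt : test_function theta by apply: test_functionM.
have ntheta : nrm theta <= nrm (cocut r) * nrm zeta * nrm (cocut r).
  by apply: nrmM_le => //; [exact: smooth_measurable|exact: (bounded_ess ZB')].
have -> : ip h zeta = ip h theta^`().
  apply: eq_Rintegral => x _; have [xL|/h0 ->] := leP `|x| L; last by rewrite !mul0r.
  have xr : `|x| < r / 8 by rewrite (le_lt_trans xL)// /r; lra.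
  rewrite derive1_smoothM// dZ derive1_cocut_eq0// cocut_eq1 ?(ltW xr)//.
  by rewrite mulr0 addr0 mulr1 mul1r.
rewrite hh'// normrN (le_trans (cauchy_schwarz _ _))//; first exact: test_in_L2.
rewrite mulrC [leRHS](_ : _ = nrm (cocut r) * nrm zeta * nrm (cocut r) * nrm h'); last by ring.
by rewrite ler_wpM2r// nrm_ge0.
Qed.

(** The derivative is approximated first. After a correction of its mean the approximation has a
    compactly supported primitive, and the Poincare inequality shows that this primitive is close to
    [f]. *)
Lemma test_dense_H1_support f g K e : 0 < K -> weakd f g -> (forall x, K < `|x| -> f x = 0) ->
  (forall x, K < `|x| -> g x = 0) -> 0 < e ->
  exists psi, [/\ test_function psi, L2dist psi f <= e &
    L2dist psi^`() g <= e].
Proof.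
move=> K0 wfg f0 g0 e0; have [f2 g2 fg] := wfg.
pose r := 16 * K; have r0 : 0 < r by rewrite mulr_gt0.
have tc := test_cocut r0; have c2 := test_in_L2 tc; have sc := test_smooth tc.
have [te _ e1 I0] := @eta_props R; set I := \int[mu]_t eta t in I0.
pose L := r + 1.
have L0 : 0 < L by rewrite addr_gt0.
have [C C0 hC] := poincare L0.
(* The factor by which the mean correction may enlarge the error on the derivative; [1 + C] accounts
   for the passage to the primitive. *)
pose D := 1 + nrm (cocut r) * nrm (fun x => I^-1 * eta x).
have D1 : 1 <= D by rewrite lerDl mulr_ge0// nrm_ge0.
pose d := e / (D * (1 + C)).
have CC : 0 < 1 + C by rewrite ltr_pwDl.
have D0 : 0 < D by rewrite (lt_le_trans ltr01).
have d0 : 0 < d by rewrite divr_gt0// mulr_gt0.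
have [psi0 tp0 hp0] := test_dense g2 d0; have p02 := test_in_L2 tp0.
pose psi1 x := cocut r x * psi0 x.
have tp1 : test_function psi1 by exact: test_functionM.
have p12 := test_in_L2 tp1.
have gE : g = (fun x => cocut r x * g x).
  apply/funext => x; have [xK|/g0 ->] := leP `|x| K; last by rewrite mulr0.
  by rewrite cocut_eq1 ?mul1r// /r; lra.
have h1 : L2dist psi1 g <= d.
  have -> : (fun x => psi1 x - g x) = (fun x => cocut r x * (psi0 x - g x)).
    by apply/funext => x; rewrite {1}gE /psi1 mulrBr.
  rewrite (le_trans _ hp0)// -[leRHS]mul1r; apply: nrmM_le; last exact: in_L2B.
    exact: smooth_measurable.
  by apply: bounded_ess => x; have /andP[? ?] := cocut_itv x r0; rewrite ger0_norm.
pose m := ip psi0 (cocut r).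
(* Since [g] lives where [cocut r] is one, this says that [g] has mean zero; hence the mean [m] of
   [psi1] is small. *)
have gc : ip g (cocut r) = 0.
  apply/eqP; rewrite -oppr_eq0 -fg//; apply/eqP.
  transitivity (\int[mu]_x (0 : R)); last by rewrite /Rintegral integral0.
  apply: eq_Rintegral => x _; have [xK|/f0 ->] := leP `|x| K; last by rewrite mul0r.
  by rewrite derive1_cocut_eq0 ?mulr0// /r; lra.
have hm : `|m| <= d * nrm (cocut r).
  have -> : m = ip (fun x => psi0 x - g x) (cocut r) by rewrite ipBl// gc subr0.
  by rewrite ipC mulrC; apply: norm_ip_le => //; exact: in_L2B.
(* The integral of [psi2] is zero, because [I^-1 * eta] has integral one and [psi1] has integral
   [m]. *)
pose psi2 x := psi1 x - m * (I^-1 * eta x).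
have tIe : test_function (fun x => I^-1 * eta x) by exact: test_functionZ.
have tmIe : test_function (fun x => m * (I^-1 * eta x)) by exact: test_functionZ.
have tp2 : test_function psi2 by exact: test_functionB.
have p22 := test_in_L2 tp2.
have p2L x : L < `|x| -> psi2 x = 0.
  move=> Lx; rewrite /psi2 /psi1 cocut_eq0//; last by rewrite (le_trans _ (ltW Lx))// lerDl.
  by rewrite mul0r e1 ?mulr0 ?subr0// (le_trans _ (ltW Lx))// lerDr ltW.
have int2 : \int[mu]_t psi2 t = 0.
  rewrite RintegralB//; [|exact: test_integrable..].
  rewrite RintegralZl//; last exact: test_integrable.
  rewrite RintegralZl//; last exact: test_integrable.
  rewrite -/I mulVf ?gt_eqF// mulr1 /m /ip.
  by apply/eqP; rewrite subr_eq0; apply/eqP/eq_Rintegral => x _; rewrite mulrC.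
have [Psi [sP dP Pl Pr _]] := test_primitive tp2 p2L.
have P0 x : L < `|x| -> Psi x = 0.
  by rewrite ltr_normr => /orP[Lx|Lx]; [rewrite Pr|rewrite Pl// ltrNr].
have tP : test_function Psi by apply/test_functionP; split => //; exists L.
have h2 : L2dist psi2 g <= d * D.
  have -> : (fun x => psi2 x - g x) = (fun x => (psi1 x - g x) - m * (I^-1 * eta x)).
    by apply/funext => x; rewrite /psi2 addrAC.
  rewrite (le_trans (nrmB _ _))//; [exact: in_L2B|exact: test_in_L2|].
  rewrite nrmZ; last exact: test_in_L2.
  by rewrite /D mulrDr mulr1 lerD// mulrA ler_wpM2r// nrm_ge0.
have dDe : d * D * (1 + C) = e by rewrite /d; field; rewrite !gt_eqF.
have dD0 : 0 <= d * D by rewrite mulr_ge0// ltW.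
have hh : L2dist Psi f <= C * L2dist psi2 g.
  apply: hC; first by rewrite -dP; apply: weakdB => //; exact: weakd_test.
  move=> x Lx; rewrite P0// f0 ?subr0// (le_lt_trans _ Lx)// /L /r; lra.
exists Psi; rewrite dP; split => //.
  by have := ler_wpM2l C0 h2; rewrite -dDe; lra.
by have := mulr_ge0 dD0 C0; rewrite -dDe; lra.
Qed.

(** Multiplying by [cocut r] reduces to bounded support; the extra term [(cocut r)' f] in the
    derivative is at most [C / r * nrm f]. *)
Lemma test_dense_H1 f g e : weakd f g -> 0 < e ->
  exists psi, [/\ test_function psi, L2dist psi f <= e &
    L2dist psi^`() g <= e].
Proof.
move=> wfg e0; have [f2 g2 fg] := wfg.
have e40 : 0 < e / 4 by rewrite divr_gt0.
have [r1 r10 h1] := cut_small f2 e40; have [r2 r20 h2] := cut_small g2 e40.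
have [C C0 hC] := tail_derive cutP.
(* A sum of positive thresholds exceeds each of them; the last one makes the commutator term at most
   [e / 4]. *)
pose r := r1 + r2 + C * (nrm f + 1) / (e / 4).
have r3 : 0 < C * (nrm f + 1) / (e / 4).
  by rewrite divr_gt0// mulr_gt0// ltr_wpDl// nrm_ge0.
have r0 : 0 < r by rewrite !addr_gt0.
have r1r : r1 <= r by rewrite /r; lra.
have r2r : r2 <= r by rewrite /r; lra.
have r3r : C * (nrm f + 1) / (e / 4) <= r by rewrite /r; lra.
have tc := test_cocut r0; have bc := test_bounded_C1 tc.
pose f1 x := cocut r x * f x.
pose g1 x := (cocut r)^`() x * f x + cocut r x * g x.
have w1 : weakd f1 g1 := weakdM_smooth bc wfg.
have [f12 g12 _] := w1.
have hf : L2dist f1 f <= e / 4.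
  have -> : (fun x => f1 x - f x) = (fun x => - (cut r x * f x)).
    by apply/funext => x; rewrite /f1 /cocut; ring.
  by rewrite nrmN h1.
have hg : L2dist g1 g <= e / 4 + e / 4.
  have -> : (fun x => g1 x - g x) = (fun x => (cocut r)^`() x * f x - cut r x * g x).
    by apply/funext => x; rewrite /g1 /cocut; ring.
  rewrite (le_trans (nrmB _ _))//; [exact: bounded_C1_L2'|exact: cut_L2|].
  rewrite lerD//; last by rewrite h2.
  have hb : ess_le (cocut r)^`() (C / r).
    by apply: bounded_ess => x; rewrite derive1_cocut// normrN hC.
  rewrite (le_trans (nrmM_le _ hb f2))//.
    exact: (smooth_measurable (smooth_derive1 (test_smooth tc))).
  rewrite mulrAC ler_pdivrMr//; move: r3r; rewrite ler_pdivrMr//.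
  by have := ltW C0; lra.
have f10 x : r < `|x| -> f1 x = 0 by move=> xr; rewrite /f1 cocut_eq0 ?mul0r// ltW.
have g10 x : r < `|x| -> g1 x = 0.
  move=> xr; rewrite /g1 cocut_eq0 ?mul0r ?addr0//; last exact: ltW.
  rewrite (derive1_support (test_smooth tc) _ xr) ?mul0r// => y /ltW; exact: cocut_eq0.
have [psi [tp hp1 hp2]] := test_dense_H1_support r0 w1 f10 g10 e40.
have p2 := test_in_L2 tp; have d2 := test_derive1_L2 tp.
exists psi; split => //.
  by rewrite (le_trans (nrmB_trans p2 f12 f2))//; have := lerD hp1 hf; lra.
by rewrite (le_trans (nrmB_trans d2 g12 g2))//; have := lerD hp2 hg; lra.
Qed.

End Sobolev.

(** * H^1 of the line: integration by parts, boundedness, products *)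

Section SobolevProducts.
Context {R : realType}.
Notation mu := (@lebesgue_measure R).
Implicit Types (f g h psi phi : R -> R) (K M e x r c : R).

Lemma le_small_eq0 (a C : R) : 0 <= a -> (forall e, 0 < e -> a <= C * e) -> a = 0.
Proof.
move=> a0 aC; apply/eqP; rewrite eq_le a0 andbT leNgt; apply/negP => ap.
have C0 : 0 < `|C| + 1 by rewrite ltr_wpDl.
have := aC (a / (2 * (`|C| + 1))); rewrite divr_gt0// ?mulr_gt0// => /(_ isT).
rewrite mulrA ler_pdivlMr ?mulr_gt0//.
have : C * a <= `|C| * a by rewrite ler_pM2r// ler_norm.
nra.
Qed.

Lemma integration_by_parts_H1 f f' g g' : weakd f f' -> weakd g g' ->
  ip f g' = - ip f' g.
Proof.
move=> wf wg; have [f2 f'2 ff'] := wf; have [g2 g'2 gg'] := wg.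
apply/eqP; rewrite -subr_eq0 opprK -normr_eq0; apply/eqP.
apply: (@le_small_eq0 _ (nrm f + nrm f')) => // e e0.
have [psi [tp hp hp']] := test_dense_H1 wg e0.
have p2 := test_in_L2 tp; have d2 := test_derive1_L2 tp.
have -> : ip f g' + ip f' g = - (ip f (fun x => psi^`() x - g' x) +
    ip f' (fun x => psi x - g x)).
  by rewrite !ipBr// ff'//; ring.
rewrite normrN (le_trans (ler_normD _ _))// mulrDl lerD//.
- by apply: norm_ip_le => //; exact: in_L2B.
- by apply: norm_ip_le => //; exact: in_L2B.
Qed.

Lemma nrm_eq0_ae f : in_L2 f -> nrm f = 0 -> {ae mu, forall x, f x = 0}.
Proof.
move=> f2 f0; have mf := in_L2_measurable f2.
have ff : ip f f = 0 by rewrite -sqr_nrm f0 expr0n.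
have iff := integrable_ip f2 f2.
have : (\int[mu]_x `|(f x * f x)%:E| = 0)%E.
  have <- : (ip f f)%:E = 0%E by rewrite ff.
  rewrite /ip /Rintegral fineK; last exact: integrable_fin_num.
  by apply: eq_integral => x _; rewrite gee0_abs// lee_fin -expr2 sqr_ge0.
have mff : measurable_fun setT (fun x => (f x * f x)%:E) by case/integrableP: iff.
move/(ae_eq_integral_abs mu measurableT mff) => h.
apply: ae_imp h => x /(_ I) /= [] /eqP; rewrite mulf_eq0 orbb => /eqP//.
Qed.

(** The countably many tolerances [1 / (k + 1)] suffice, and a countable union of null sets is
    null. *)
Lemma ess_le_eps f M : measurable_fun setT f -> (forall e, 0 < e -> ess_le f (M + e)) -> ess_le f M.
Proof.
move=> mf h.
have : {ae mu, forall x, forall k : nat, `|f x| <= M + k.+1%:R^-1}.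
  by apply: ae_foralln => k; apply: h; rewrite invr_gt0.
apply: ae_imp => x hx; apply/ler_addgt0Pr => e e0.
have [k hk] : exists k : nat, k.+1%:R^-1 <= e.
  exists (Num.trunc e^-1); rewrite -[leRHS]invrK lef_pV2 ?posrE ?invr_gt0//.
  by rewrite ltW// truncnS_gt.
by rewrite (le_trans (hx k))// lerD2l.
Qed.

(** The supremum inequality passes from test functions to H^1 without pointwise convergence: when
    [|psi| <= M + d], the excess of [|f|] over [M + d] is at most [|psi - f|], so its norm is
    arbitrarily small. *)
Lemma H1_ess_le f f' : weakd f f' -> ess_le f (Num.sqrt (2 * (nrm f * nrm f'))).
Proof.
move=> wf; have [f2 f'2 ff'] := wf; have mf := in_L2_measurable f2.
apply: ess_le_eps => // d d0; set M := Num.sqrt _.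
have M0 : 0 <= M by exact: sqrtr_ge0.
have n0 := nrm_ge0 f; have n'0 := nrm_ge0 f'.
pose h x := Num.max 0 (`|f x| - (M + d)).
have mh : measurable_fun setT h.
  apply: measurable_maxr => //; apply: measurable_funB => //.
  exact: measurableT_comp.
have h2 : in_L2 h.
  apply: (@in_L2_le _ _ f) => //; apply: aeW => x; rewrite /h.
  rewrite -[f x ^+ 2]real_normK ?num_real//.
  have [fx|fx] := leP 0 (`|f x| - (M + d)).
    by rewrite lerXn2r// ?nnegrE//; lra.
  by rewrite expr0n sqr_ge0.
suff h0 : nrm h = 0.
  apply: ae_imp (nrm_eq0_ae h2 h0) => x; rewrite /h.
  by have [fx|fx] := leP 0 (`|f x| - (M + d)); lra.
apply: (@le_small_eq0 _ 1); first exact: nrm_ge0.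
move=> e e0; rewrite mul1r.
(* choose the approximation so close that its supremum is below M + d *)
pose e1 := Num.min (Num.min e 1) (d ^+ 2 / (2 * (nrm f + nrm f' + 1))).
have N0 : 0 < 2 * (nrm f + nrm f' + 1) by rewrite mulr_gt0//; lra.
have e10 : 0 < e1 by rewrite !lt_min e0 ltr01/= divr_gt0// exprn_gt0.
have [e1e e11] : e1 <= e /\ e1 <= 1.
  by split; rewrite /e1 !ge_min lexx ?orbT.
have e1d : e1 * (2 * (nrm f + nrm f' + 1)) <= d ^+ 2.
  by rewrite -ler_pdivlMr// /e1 ge_min lexx orbT.
have [psi [tp hp hp']] := test_dense_H1 wf e10.
have p2 := test_in_L2 tp; have d2 := test_derive1_L2 tp.
have np : nrm psi <= nrm f + e1.
  by rewrite (le_trans (nrm_le_addB p2 f2))// lerD.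
have np' : nrm psi^`() <= nrm f' + e1.
  by rewrite (le_trans (nrm_le_addB d2 f'2))// lerD.
have psiM x : `|psi x| <= M + d.
  rewrite -(ler_pXn2r (ltn0Sn 1)) ?nnegrE ?addr_ge0// ?(ltW d0)//.
  rewrite real_normK ?num_real// (le_trans (test_sup x tp))//.
  have h1 : nrm psi * nrm psi^`() <= (nrm f + e1) * (nrm f' + e1).
    by rewrite ler_pM// nrm_ge0.
  have MM : M ^+ 2 = 2 * (nrm f * nrm f') by rewrite sqr_sqrtr// !mulr_ge0.
  have : e1 * e1 <= e1 by rewrite -[leRHS]mulr1 ler_pM2l.
  have : 0 <= M * d by rewrite mulr_ge0// ltW.
  nra.
apply: le_trans e1e; apply: le_trans hp.
apply: le_nrm => //; first exact: in_L2B.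
apply: aeW => x; rewrite /h.
have := psiM x; have := ler_normD (psi x) (f x - psi x).
rewrite addrC subrK [`|psi x - f x|]distrC => h3 h4.
have [fx|fx] := leP 0 (`|f x| - (M + d)); last by rewrite normr0.
by rewrite ger0_norm//; lra.
Qed.

Lemma H1_in_L2M f f' g : weakd f f' -> in_L2 g -> in_L2 (fun x => f x * g x).
Proof.
move=> wf; apply: in_L2M (H1_ess_le wf).
by case: wf => /in_L2_measurable.
Qed.

Lemma H1_nrmM f f' g : weakd f f' -> in_L2 g ->
  nrm (fun x => f x * g x) <= Num.sqrt (2 * (nrm f * nrm f')) * nrm g.
Proof.
move=> wf; apply: nrmM_le (H1_ess_le wf).
by case: wf => /in_L2_measurable.
Qed.

(** Testing the product with [psi] amounts to integrating [f] by parts against [psi g], itself an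
    H^1 function. *)
Lemma weakdM f f' g g' : weakd f f' -> weakd g g' ->
  weakd (fun x => f x * g x) (fun x => f' x * g x + f x * g' x).
Proof.
move=> wf wg; have [f2 f'2 ff'] := wf; have [g2 g'2 gg'] := wg.
have l1 : in_L2 (fun x => f' x * g x).
  by under eq_fun do rewrite mulrC; exact: H1_in_L2M wg f'2.
have l2 := H1_in_L2M wf g'2.
split; [exact: H1_in_L2M wf g2|exact: in_L2D|move=> psi tp].
have p2 := test_in_L2 tp; have td := test_function_derive1 tp; have d2 := test_in_L2 td.
have bp := test_bounded_C1 tp.
have := integration_by_parts_H1 wf (weakdM_smooth bp wg).
rewrite ipDr//; last 2 first.
- exact: bounded_C1_L2'.
- exact: bounded_C1_L2.
rewrite ipDl//.
have -> : ip (fun x => f x * g x) psi^`() = ip f (fun x => psi^`() x * g x).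
  by apply: eq_Rintegral => x _; ring.
have -> : ip (fun x => f' x * g x) psi = ip f' (fun x => psi x * g x).
  by apply: eq_Rintegral => x _; ring.
have -> : ip (fun x => f x * g' x) psi = ip f (fun x => psi x * g' x).
  by apply: eq_Rintegral => x _; ring.
lra.
Qed.

End SobolevProducts.

(** * Time-dependent functions *)

Section TimeDependence.
Context {R : realType}.
Implicit Types (f g w : R -> R -> R) (h psi phi : R -> R) (K M e t s c : R).

(** Square integrability near [t] is part of the notion, since [nrm] takes a default value outside
    L^2 and convergence of [nrm] alone would say nothing. *)
Definition L2cont f t : Prop := (\forall s \near t, in_L2 (f s)) /\
  L2dist (f s) (f t) @[s --> t] --> 0.

Definition H1cont f (f' : R -> R -> R) t : Prop := [/\ \forall s \near t, weakd (f s) (f' s),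
  L2cont f t & L2cont f' t].

Lemma L2cont_at f t : L2cont f t -> in_L2 (f t).
Proof. by case=> /nbhs_singleton. Qed.

Lemma H1cont_at f f' t : H1cont f f' t -> weakd (f t) (f' t).
Proof. by case=> /nbhs_singleton. Qed.

Lemma cvg0_le (u v : R -> R) t : (\forall s \near t, 0 <= u s <= v s) ->
  v @ t --> (0 : R) -> u @ t --> (0 : R).
Proof. by move=> uv v0; apply: (@squeeze_cvgr _ _ _ _ (fun=> 0) _ _ uv _ _ v0); exact: cvg_cst. Qed.

Lemma nrm_cvg f t : L2cont f t -> nrm (f s) @[s --> t] --> nrm (f t).
Proof.
move=> [f2 fc]; have f2t := nbhs_singleton f2.
apply/subr_cvg0/norm_cvg0P; apply: cvg0_le fc; near=> s; rewrite normr_ge0/=.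
have fs2 : in_L2 (f s) by near: s.
rewrite ler_norml; apply/andP; split.
  by rewrite nrmBC lerNl opprB lerBlDl nrm_le_addB.
by rewrite lerBlDl nrm_le_addB.
Unshelve. all: by end_near. Qed.

Lemma L2contD f g t : L2cont f t -> L2cont g t -> L2cont (fun s x => f s x + g s x) t.
Proof.
move=> [f2 fc] [g2 gc]; have f2t := nbhs_singleton f2; have g2t := nbhs_singleton g2.
split; first by near=> s; apply: in_L2D; near: s.
apply: cvg0_le (_ : (fun s => L2dist (f s) (f t) + L2dist (g s) (g t)) @ t --> 0).
  near=> s; rewrite nrm_ge0/=.
  have fs2 : in_L2 (f s) by near: s.
  have gs2 : in_L2 (g s) by near: s.
  rewrite [X in nrm X <= _](_ : _ = (fun x => (f s x - f t x) + (g s x - g t x))).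
    by apply: nrmD; exact: in_L2B.
  by apply/funext => x; ring.
by rewrite -[X in _ --> X](addr0 (0 : R)); exact: cvgD.
Unshelve. all: by end_near. Qed.

Lemma L2contM h M f t : measurable_fun setT h -> ess_le h M -> L2cont f t ->
  L2cont (fun s x => h x * f s x) t.
Proof.
move=> mh hM [f2 fc]; have f2t := nbhs_singleton f2.
split; first by near=> s; apply: (in_L2M mh hM); near: s.
apply: cvg0_le (_ : (fun s => M * L2dist (f s) (f t)) @ t --> 0).
  near=> s; rewrite nrm_ge0/=.
  have fs2 : in_L2 (f s) by near: s.
  rewrite [X in nrm X <= _](_ : _ = (fun x => h x * (f s x - f t x))).
    by apply: nrmM_le => //; exact: in_L2B.
  by apply/funext => x; rewrite mulrBr.
by rewrite -[X in _ --> X](mulr0 M); apply: cvgM => //; exact: cvg_cst.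
Unshelve. all: by end_near. Qed.

Lemma L2contZ c f t : L2cont f t -> L2cont (fun s x => c * f s x) t.
Proof.
apply: (@L2contM (fun=> c) `|c|); first exact: measurable_cst.
exact: bounded_ess.
Qed.

Lemma L2contN f t : L2cont f t -> L2cont (fun s x => - f s x) t.
Proof.
move=> /(L2contZ (-1)); congr L2cont; apply/funext => s; apply/funext => x.
by rewrite mulN1r.
Qed.

Lemma L2contB f g t : L2cont f t -> L2cont g t -> L2cont (fun s x => f s x - g s x) t.
Proof. by move=> fc /L2contN; exact: L2contD. Qed.

Lemma L2cont_cst h t : in_L2 h -> L2cont (fun=> h) t.
Proof.
move=> h2; split; first by near=> s.
rewrite [X in X @ _ --> _](_ : _ = (fun=> 0)); first exact: cvg_cst.
apply/funext => s; rewrite (_ : (fun _ => _) = (fun x => 0 * h x)).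
  by rewrite nrmZ// normr0 mul0r.
by apply/funext => x; rewrite subrr mul0r.
Unshelve. all: by end_near. Qed.

(** Multiplication is continuous from H^1 times L^2 to L^2, because [H1_nrmM] bounds the factor in
    H^1 uniformly in space. *)
Lemma H1cont_L2M f f' g t : H1cont f f' t -> L2cont g t ->
  L2cont (fun s x => f s x * g s x) t.
Proof.
move=> [wf [f2 fc] [f'2 f'c]] gC; have [g2 gc] := gC.
have wft := nbhs_singleton wf; have g2t := nbhs_singleton g2.
split; first by near=> s; apply: (@H1_in_L2M _ _ (f' s)); near: s.
pose v s := Num.sqrt (2 * (L2dist (f s) (f t) * L2dist (f' s) (f' t))) * nrm (g s)
  + Num.sqrt (2 * (nrm (f t) * nrm (f' t))) * L2dist (g s) (g t).
apply: (@cvg0_le _ v).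
  near=> s; rewrite nrm_ge0/=.
  have wfs : weakd (f s) (f' s) by near: s.
  have gs2 : in_L2 (g s) by near: s.
  have wd := weakdB wfs wft.
  rewrite [X in nrm X <= _](_ : _ =
     (fun x => (f s x - f t x) * g s x + f t x * (g s x - g t x))); last first.
    by apply/funext => x; ring.
  rewrite (le_trans (nrmD _ _))//.
  - exact: H1_in_L2M wd gs2.
  - by apply: H1_in_L2M wft _; exact: in_L2B.
  by apply: lerD; [exact: H1_nrmM wd gs2|apply: H1_nrmM wft _; exact: in_L2B].
have h1 : (fun s => 2 * (L2dist (f s) (f t) * L2dist (f' s) (f' t))) @ t --> (2 * (0 * 0) : R).
  by apply: cvgM; [exact: cvg_cst|exact: cvgM].
have h2 : (fun s => Num.sqrt (2 * (L2dist (f s) (f t) * L2dist (f' s) (f' t))))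
    @ t --> Num.sqrt (2 * (0 * 0) : R).
  exact: (@continuous_cvg _ _ _ _ _ _ (@Num.sqrt R) _ (@sqrt_continuous R _) h1).
have -> : (0 : R) = Num.sqrt (2 * (0 * 0)) * nrm (g t) + Num.sqrt (2 * (nrm (f t) * nrm (f' t))) * 0.
  by rewrite !mulr0 sqrtr0 mul0r addr0.
apply: cvgD; first exact: cvgM (nrm_cvg gC).
by apply: cvgM => //; exact: cvg_cst.
Unshelve. all: by end_near. Qed.

Lemma H1contD f f' g g' t : H1cont f f' t -> H1cont g g' t ->
  H1cont (fun s x => f s x + g s x) (fun s x => f' s x + g' s x) t.
Proof.
move=> [wf fc f'c] [wg gc g'c]; split; [|exact: L2contD|exact: L2contD].
by near=> s; apply: weakdD; near: s.
Unshelve. all: by end_near. Qed.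

Lemma H1cont_smoothM phi f f' t : bounded_C1 phi -> H1cont f f' t ->
  H1cont (fun s x => phi x * f s x) (fun s x => phi^`() x * f s x + phi x * f' s x) t.
Proof.
move=> bp [wf fc f'c]; have [sp [M hM] [M' hM']] := bp.
split.
- by near=> s; apply: (weakdM_smooth bp); near: s.
- exact: (L2contM (smooth_measurable sp) (bounded_ess hM)).
- apply: L2contD.
    exact: (L2contM (smooth_measurable (smooth_derive1 sp)) (bounded_ess hM')).
  exact: (L2contM (smooth_measurable sp) (bounded_ess hM)).
Unshelve. all: by end_near. Qed.

Lemma H1contM f f' g g' t : H1cont f f' t -> H1cont g g' t ->
  H1cont (fun s x => f s x * g s x) (fun s x => f' s x * g s x + f s x * g' s x) t.
Proof.
move=> fC gC; have [wf fc f'c] := fC; have [wg gc g'c] := gC.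
split.
- by near=> s; apply: weakdM; near: s.
- exact: H1cont_L2M fC gc.
- apply: L2contD; last exact: H1cont_L2M fC g'c.
  have := H1cont_L2M gC f'c; congr L2cont; apply/funext => s; apply/funext => x.
  by rewrite mulrC.
Unshelve. all: by end_near. Qed.

Definition L2diff f (F : R -> R) t : Prop := [/\ \forall s \near t, in_L2 (f s), in_L2 F &
  little_o t (fun s => nrm (fun x => f s x - f t x - (s - t) * F x))].

(* differentiability in the dual of H^1, the derivative being [F0 - F1'] *)
Definition H1dual_diff f (F0 F1 : R -> R) t : Prop :=
  [/\ \forall s \near t, in_L2 (f s), in_L2 F0, in_L2 F1 &
  forall e, 0 < e -> \forall s \near t, forall h h', weakd h h' ->
    `|ip (fun x => f s x - f t x) h - (s - t) * (ip F0 h + ip F1 h')|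
      <= e * `|s - t| * (nrm h + nrm h')].

(** For each [psi] the mean value inequality bounds the remainder by [e * |s - t| * nrm psi] on one
    neighbourhood of [t] common to all [psi]; [nrm_le_test] converts this into a bound in L^2. *)
Lemma weak_L2diff f (F : R -> R -> R) t : L2cont F t ->
  (\forall s \near t, in_L2 (f s) /\
     forall psi, test_function psi -> is_derive s 1 (fun s => ip (f s) psi) (ip (F s) psi)) ->
  L2diff f (F t) t.
Proof.
move=> [F2 Fc] fF; have F2t := nbhs_singleton F2; have [f2t _] := nbhs_singleton fF.
split => //; first by apply: filterS fF => s [].
move=> e e0; move/cvgrPdist_le : Fc => /(_ e e0) Fc.
have FfF : nbhs t (fun s => (in_L2 (F s) /\ (in_L2 (f s) /\ forall psi, test_function psi ->
    is_derive s 1 (fun s => ip (f s) psi) (ip (F s) psi))) /\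
    `|0 - L2dist (F s) (F t)| <= e).
  exact: (filterI (filterI F2 fF) Fc).
move: FfF => /nbhs_ballP[d /= d0 H].
apply/nbhs_ballP; exists d => //= s; rewrite /ball/= => ts.
have Hs y : `|y - t| <= `|s - t| -> ball t d y.
  by move=> ys; rewrite /ball/= distrC (le_lt_trans ys)// distrC.
have [[Fs2 [fs2 _]] _] : (_ /\ _) /\ _ := H s ts.
rewrite ger0_norm ?nrm_ge0//; apply: nrm_le_test.
- by apply: in_L2B; [exact: in_L2B|exact: in_L2Z].
- by rewrite mulr_ge0// ltW.
move=> psi tp; have p2 := test_in_L2 tp.
rewrite ipBl//; [|exact: in_L2B|exact: in_L2Z].
rewrite ipBl// ipZl//.
have := @mvt_increment R (fun s => ip (f s) psi) (fun s => ip (F s) psi) t s (e * nrm psi).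
rewrite mulrAC; apply.
- by move=> y /Hs /H[[_ [_]]] h _; exact: h.
- move=> y /Hs /H[[Fy2 _]]; rewrite dist0_nrm => hy.
  by rewrite -ipBl// ipC mulrC; apply: norm_ip_le => //; exact: in_L2B.
Qed.

(** Same mechanism as [weak_L2diff], with the H^1 size of [psi] in the bound; the inequality then
    extends to all of H^1. *)
Lemma weak_H1dual_diff f (F0 F1 : R -> R -> R) t : L2cont F0 t -> L2cont F1 t ->
  (\forall s \near t, in_L2 (f s) /\ forall psi, test_function psi ->
    is_derive s 1 (fun s => ip (f s) psi) (ip (F0 s) psi + ip (F1 s) psi^`())) ->
  H1dual_diff f (F0 t) (F1 t) t.
Proof.
move=> [F02 F0c] [F12 F1c] fF; have F02t := nbhs_singleton F02; have F12t := nbhs_singleton F12.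
have [f2t _] := nbhs_singleton fF.
split => //; first by apply: filterS fF => s [].
move=> e e0; move/cvgrPdist_le : F0c => /(_ e e0) F0c.
move/cvgrPdist_le : F1c => /(_ e e0) F1c.
have FfF : nbhs t (fun s => ((in_L2 (F0 s) /\ in_L2 (F1 s)) /\ (in_L2 (f s) /\
    forall psi, test_function psi ->
    is_derive s 1 (fun s => ip (f s) psi) (ip (F0 s) psi + ip (F1 s) psi^`()))) /\
    (`|0 - L2dist (F0 s) (F0 t)| <= e /\ `|0 - L2dist (F1 s) (F1 t)| <= e)).
  exact: (filterI (filterI (filterI F02 F12) fF) (filterI F0c F1c)).
move: FfF => /nbhs_ballP[d /= d0 H].
apply/nbhs_ballP; exists d => //= s; rewrite /ball/= => ts h h' wh.
have Hs y : `|y - t| <= `|s - t| -> ball t d y.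
  by move=> ys; rewrite /ball/= distrC (le_lt_trans ys)// distrC.
have [[_ [fs2 _]] _] : (_ /\ _) /\ _ := H s ts.
have [h2 h'2 _] := wh.
have d2 := in_L2B fs2 f2t.
have key psi : test_function psi ->
  `|ip (fun x => f s x - f t x) psi - (s - t) * (ip (F0 t) psi + ip (F1 t) psi^`())|
      <= e * `|s - t| * (nrm psi + nrm psi^`()).
  move=> tp; have p2 := test_in_L2 tp; have p'2 := test_derive1_L2 tp.
  rewrite ipBl//.
  have := @mvt_increment R (fun s => ip (f s) psi)
    (fun s => ip (F0 s) psi + ip (F1 s) psi^`()) t s (e * (nrm psi + nrm psi^`())).
  rewrite mulrAC; apply.
  + by move=> y /Hs /H[[_ [_]]] hh _; exact: hh.
  + move=> y /Hs /H[[[F0y F1y] _]] [].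
    rewrite dist0_nrm => h0.
    rewrite dist0_nrm => h1.
    rewrite opprD addrACA -!ipBl// (le_trans (ler_normD _ _))// mulrDr lerD//;
      by rewrite ipC mulrC; apply: norm_ip_le => //; exact: in_L2B.
(* extend to [H^1] by density *)
apply/ler_addgt0Pr => c c0.
(* Collects all coefficients of the approximation error, so that an error of [c / C] costs at most
   [c]; the [+ 1] ensures positivity. *)
pose C := L2dist (f s) (f t) + `|s - t| * (nrm (F0 t) + nrm (F1 t)) + 2 * (e * `|s - t|) + 1.
have C0 : 0 < C.
  have n1 := mulr_ge0 (normr_ge0 (s - t)) (addr_ge0 (nrm_ge0 (F0 t)) (nrm_ge0 (F1 t))).
  have n2 := mulr_ge0 (ltW e0) (normr_ge0 (s - t)).
  have n3 := nrm_ge0 (fun x => f s x - f t x).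
  by rewrite /C; lra.
have cC : 0 < c / C by rewrite divr_gt0.
have [psi [tp hp hp']] := test_dense_H1 wh cC.
have p2 := test_in_L2 tp; have p'2 := test_derive1_L2 tp.
have dp2 := in_L2B p2 h2; have dp'2 := in_L2B p'2 h'2.
have k := key psi tp.
have e1 : ip (fun x => f s x - f t x) h - (s - t) * (ip (F0 t) h + ip (F1 t) h') =
  (ip (fun x => f s x - f t x) psi - (s - t) * (ip (F0 t) psi + ip (F1 t) psi^`()))
  - (ip (fun x => f s x - f t x) (fun x => psi x - h x) - (s - t) *
     (ip (F0 t) (fun x => psi x - h x) + ip (F1 t) (fun x => psi^`() x - h' x))).
  by rewrite !ipBr//; ring.
have np : nrm psi <= nrm h + c / C.
  by rewrite (le_trans (nrm_le_addB p2 h2))// lerD.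
have np' : nrm psi^`() <= nrm h' + c / C.
  by rewrite (le_trans (nrm_le_addB p'2 h'2))// lerD.
rewrite e1 (le_trans (ler_normB _ _))//.
have b1 : `|ip (fun x => f s x - f t x) (fun x => psi x - h x)| <=
    L2dist (f s) (f t) * (c / C).
  exact: norm_ip_le.
have b2 : `|ip (F0 t) (fun x => psi x - h x)| <= nrm (F0 t) * (c / C).
  exact: norm_ip_le.
have b3 : `|ip (F1 t) (fun x => psi^`() x - h' x)| <= nrm (F1 t) * (c / C).
  exact: norm_ip_le.
have b4 : `|(s - t) * (ip (F0 t) (fun x => psi x - h x) +
    ip (F1 t) (fun x => psi^`() x - h' x))| <= `|s - t| * ((nrm (F0 t) + nrm (F1 t)) * (c / C)).
  rewrite normrM ler_wpM2l// (le_trans (ler_normD _ _))// mulrDl.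
  exact: lerD.
have b5 := le_trans (ler_normB (ip (fun x => f s x - f t x) (fun x => psi x - h x)) _) (lerD b1 b4).
have CcC : C * (c / C) = c by rewrite mulrC divfK// gt_eqF.
have es0 : 0 <= e * `|s - t| by rewrite mulr_ge0// ltW.
have k' : e * `|s - t| * (nrm psi + nrm psi^`()) <=
    e * `|s - t| * (nrm h + nrm h' + 2 * (c / C)) by rewrite ler_wpM2l//; lra.
apply: (le_trans (lerD k b5)).
have CE : c = (L2dist (f s) (f t) + `|s - t| * (nrm (F0 t) + nrm (F1 t)) +
  2 * (e * `|s - t|) + 1) * (c / C) := esym CcC.
have q0 : 0 <= c / C by exact: ltW.
clear -CE k' q0; move: (c / C) CE k' q0 => q -> k' q0.
lra.
Qed.

(** The partner may move: its variation tends to zero and meets an increment of order [s - t].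
    Quadratic quantities are differentiated in this way, pairing [f s - f t] with a multiple of
    [f s + f t]. *)
Lemma L2diff_pair f F w t : L2diff f F t -> L2cont w t ->
  little_o t (fun s => ip (fun x => f s x - f t x) (w s) - (s - t) * ip F (w t)).
Proof.
move=> [f2 F2 fd] wC; have [w2 wc] := wC.
have f2t := nbhs_singleton f2; have w2t := nbhs_singleton w2.
pose r1 s := nrm (w s) * nrm (fun x => f s x - f t x - (s - t) * F x).
have o1 : little_o t r1.
  apply: (@little_oM _ _ _ _ (nrm (w t) + 1)) => //.
  have /cvgrPdist_le/(_ 1 ltr01) := nrm_cvg wC; apply: filterS => s.
  by rewrite ler_norml => /andP[h1 h2]; rewrite ger0_norm ?nrm_ge0//; lra.
have o2 : little_o t (fun s => (s - t) * (nrm F * L2dist (w s) (w t))).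
  apply: little_o_cvg0; rewrite -[X in _ --> X](mulr0 (nrm F)).
  by apply: cvgM => //; exact: cvg_cst.
have o3 : little_o t (fun s => r1 s + `|(s - t) * (nrm F * L2dist (w s) (w t))|).
  apply: little_oD => //; apply: little_o_le o2; near=> s; by rewrite normr_id.
apply: little_o_le o3; near=> s.
have fs2 : in_L2 (f s) by near: s.
have ws2 : in_L2 (w s) by near: s.
have d2 := in_L2B fs2 f2t; have tF := in_L2Z (s - t) F2; have dw2 := in_L2B ws2 w2t.
have dd2 := in_L2B d2 tF.
have -> : ip (fun x => f s x - f t x) (w s) - (s - t) * ip F (w t) =
   ip (fun x => f s x - f t x - (s - t) * F x) (w s) + (s - t) * ip F (fun x => w s x - w t x).
  by rewrite (ipBl d2)// ipZl// ipBr//; ring.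
have r10 : 0 <= r1 s by apply: mulr_ge0; exact: nrm_ge0.
rewrite [leRHS]ger0_norm; last exact: addr_ge0.
rewrite (le_trans (ler_normD _ _))// lerD//.
  by rewrite /r1 mulrC cauchy_schwarz.
have n0 : 0 <= nrm F * L2dist (w s) (w t) by apply: mulr_ge0; exact: nrm_ge0.
rewrite normrM [leRHS]normrM; apply: ler_wpM2l => //; rewrite (ger0_norm n0).
exact: cauchy_schwarz.
Unshelve. all: by end_near. Qed.

Lemma H1dual_pair f F0 F1 w w' t : H1dual_diff f F0 F1 t -> H1cont w w' t ->
  little_o t (fun s => ip (fun x => f s x - f t x) (w s) - (s - t) * (ip F0 (w t) + ip F1 (w' t))).
Proof.
move=> [f2 F02 F12 fd] [ww wC w'C]; have [w2 wc] := wC; have [w'2 w'c] := w'C.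
have f2t := nbhs_singleton f2; have w2t := nbhs_singleton w2; have w'2t := nbhs_singleton w'2.
pose N s := nrm (w s) + nrm (w' s).
have Nb : \forall s \near t, N s <= N t + 2.
  have /cvgrPdist_le/(_ 1 ltr01) h1 := nrm_cvg wC.
  have /cvgrPdist_le/(_ 1 ltr01) h2 := nrm_cvg w'C.
  apply: filterS2 h1 h2 => s.
  by rewrite !ler_norml /N => /andP[? ?] /andP[? ?]; lra.
have N0 : 0 < N t + 2 by rewrite ltr_wpDl// addr_ge0// nrm_ge0.
have o2 : little_o t (fun s => (s - t) * (nrm F0 * L2dist (w s) (w t)
    + nrm F1 * L2dist (w' s) (w' t))).
  apply: little_o_cvg0; rewrite -[X in _ --> X](addr0 (0:R)).
  apply: cvgD; rewrite -[X in _ --> X](mulr0 (0:R)) ?mulr0.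
    by rewrite -[X in _ --> X](mulr0 (nrm F0)); apply: cvgM => //; exact: cvg_cst.
  by rewrite -[X in _ --> X](mulr0 (nrm F1)); apply: cvgM => //; exact: cvg_cst.
have o1 : little_o t (fun s => ip (fun x => f s x - f t x) (w s) -
    (s - t) * (ip F0 (w s) + ip F1 (w' s))).
  move=> e e0; have eN : 0 < e / (N t + 2) by rewrite divr_gt0.
  near=> s.
  have wws : weakd (w s) (w' s) by near: s.
  have Ns : N s <= N t + 2 by near: s.
  have hs : `|ip (fun x => f s x - f t x) (w s) - (s - t) * (ip F0 (w s) + ip F1 (w' s))|
      <= e / (N t + 2) * `|s - t| * N s.
    by move: wws; near: s; apply: filterS (fd _ eN) => s h; exact: h.
  apply: (le_trans hs).
  rewrite [X in _ <= X * _](_ : e = e / (N t + 2) * (N t + 2)); last by rewrite divfK// gt_eqF.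
  rewrite -[leLHS]mulrA -[leRHS]mulrA; apply: ler_wpM2l; first exact: ltW.
  by rewrite mulrC; apply: ler_wpM2r.
have o3 := little_oD o1 (little_o_le (r1 := fun s => (s - t) *
   (ip F0 (fun x => w s x - w t x) + ip F1 (fun x => w' s x - w' t x))) _ o2).
apply: (little_o_le _ (o3 _)).
  near=> s; rewrite le_eqVlt; apply/orP; left; apply/eqP; congr `| _ |.
  have ws2 : in_L2 (w s) by near: s.
  have w's2 : in_L2 (w' s) by near: s.
  by rewrite !ipBr//; ring.
near=> s; rewrite !normrM ler_wpM2l//.
have ws2 : in_L2 (w s) by near: s.
have w's2 : in_L2 (w' s) by near: s.
rewrite [leRHS]ger0_norm; last by apply: addr_ge0; apply: mulr_ge0; exact: nrm_ge0.
rewrite (le_trans (ler_normD _ _))// lerD// cauchy_schwarz//; exact: in_L2B.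
Unshelve. all: by end_near. Qed.

End TimeDependence.

(** * Characteristics *)

Section Transport.
Context {R : realType}.
Implicit Types (f g p m : R -> R -> R) (h psi phi : R -> R) (K M e t s c x a : R).

Lemma near_dist t e : 0 < e -> \forall s \near t, `|s - t| < e.
Proof.
by move=> e0; apply/nbhs_ballP; exists e => //= s; rewrite /ball/= distrC.
Qed.

Lemma lipschitz_derive1 h M : smooth h -> (forall x, `|h^`() x| <= M) ->
  forall x y, `|h y - h x| <= M * `|y - x|.
Proof.
move=> sh hM x y; wlog xy : x y / x <= y.
  move=> H; have [xy|yx] := leP x y; first exact: H.
  by rewrite distrC [`|y - x|]distrC; apply: H; exact: ltW.
rewrite [`|y - x|]ger0_norm ?subr_ge0//.
by apply: (@ler_increment R h h^`()) => // z _; split => //; exact: smooth_is_derive.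
Qed.

Lemma taylor1_derive1 h M : smooth h -> (forall x, `|h^`()^`() x| <= M) ->
  forall x y, `|h y - h x - (y - x) * h^`() x| <= M * `|y - x| ^+ 2.
Proof.
move=> sh hM x y; have M0 : 0 <= M := le_trans (normr_ge0 _) (hM x).
rewrite expr2 mulrA; apply: (@mvt_increment R h h^`()).
  by move=> z _; exact: smooth_is_derive.
move=> z zy; apply: (le_trans (lipschitz_derive1 (smooth_derive1 sh) hM x z)).
by rewrite ler_wpM2l.
Qed.

(** Second-order Taylor expansion, pointwise; for shifts of size at most [1] the remainder vanishes
    beyond [|K| + 1], which makes the bound square integrable. *)
Lemma translation_test psi : test_function psi -> exists2 C, 0 <= C & forall a, `|a| <= 1 ->
  nrm (fun x => psi (x + a) - psi x - a * psi^`() x) <= C * `|a| ^+ 2.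
Proof.
move=> tp; have sp := test_smooth tp.
have [M hM] := test_bounded (test_function_derive1 (test_function_derive1 tp)).
have M0 : 0 <= M := le_trans (normr_ge0 _) (hM 0).
move: (tp) => /test_functionP[_ [K p0]].
pose I : R -> R := \1_(`[- (`|K| + 1), `|K| + 1]%classic).
have I2 : in_L2 I := in_L2_indic_itv _.
exists (M * nrm I) => [|a a1]; first by rewrite mulr_ge0// nrm_ge0.
have tpa := test_function_shift a tp.
have t2 : test_function (fun x => psi (x + a) - psi x - a * psi^`() x).
  apply: test_functionB; first exact: test_functionB.
  exact/test_functionZ/test_function_derive1.
have -> : M * nrm I * `|a| ^+ 2 = nrm (fun x => M * `|a| ^+ 2 * I x).
  have Ma : 0 <= M * `|a| ^+ 2 by rewrite mulr_ge0// exprn_ge0.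
  by rewrite (nrmZ _ I2) (ger0_norm Ma); ring.
apply: le_nrm; [exact: (smooth_measurable (test_smooth t2))|exact: in_L2Z|].
apply: aeW => x; have [xK|xK] := leP `|x| (`|K| + 1).
  have -> : I x = 1 by rewrite /I indicE mem_set//= in_itv/= -ler_norml.
  rewrite mulr1 [leRHS]ger0_norm ?mulr_ge0 ?exprn_ge0//.
  by have := taylor1_derive1 sp hM x (x + a); rewrite [x + a]addrC addrK.
have Kx : K < `|x| by rewrite (le_lt_trans _ xK)// (le_trans (ler_norm K))// lerDl.
have Kxa : K < `|x + a|.
  have := ler_normB (x + a) a; rewrite addrK => h.
  by have := ler_norm K; lra.
by rewrite !p0// (derive1_support sp p0 Kx) mulr0 !subr0 normr0.
Qed.

Lemma translation_continuous h e : in_L2 h -> 0 < e ->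
  exists2 d, 0 < d & forall a, `|a| < d -> nrm (fun x => h (x + a) - h x) <= e.
Proof.
move=> h2 e0; have e30 : 0 < e / 3 by rewrite divr_gt0.
have [psi tp hp] := test_dense h2 e30; have p2 := test_in_L2 tp.
have d2 := test_derive1_L2 tp.
have [C C0 hC] := translation_test tp.
pose N := nrm psi^`(); have N0 : 0 <= N := nrm_ge0 _.
have CN : 0 < C + N + 1 by lra.
exists (Num.min 1 (e / 3 / (C + N + 1))).
  by rewrite lt_min ltr01 divr_gt0.
move=> a; rewrite lt_min => /andP[a1 ae].
have pa2 := in_L2_shift a p2; have ha2 := in_L2_shift a h2.
have hpa : nrm (fun x => h (x + a) - psi (x + a)) <= e / 3.
  by rewrite (nrm_shift a (in_L2B h2 p2)) nrmBC.
have pp : nrm (fun x => psi (x + a) - psi x) <= e / 3.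
  rewrite [X in nrm X <= _](_ : _ = (fun x => (psi (x + a) - psi x - a * psi^`() x)
     + a * psi^`() x)); last by apply/funext => x; rewrite subrK.
  rewrite (le_trans (nrmD _ _))//; [|exact: in_L2Z|].
    by apply: in_L2B; [exact: in_L2B|exact: in_L2Z].
  rewrite nrmZ//; have := hC a (ltW a1).
  move: ae; rewrite ltr_pdivlMr// => ae h1.
  have a2 : `|a| ^+ 2 <= `|a| by rewrite expr2 ler_piMr// ltW.
  have := ler_wpM2l C0 a2.
  rewrite -/N; have := normr_ge0 a; nra.
by have := nrmB_trans ha2 pa2 h2; have := nrmB_trans pa2 p2 h2; lra.
Qed.

(** The intermediate function [g t (x + c * s)] separates the change of [g], invariant under
    translation, from the continuity of translations at the fixed [g t]. *)
Lemma L2cont_moving g c t : L2cont g t -> L2cont (fun s x => g s (x + c * s)) t.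
Proof.
move=> [g2 gc]; have g2t := nbhs_singleton g2; split.
  by near=> s; apply: (@in_L2_shift _ (c * s)); near: s.
apply/cvgrPdist_le => e e0; have e20 : 0 < e / 2 by rewrite divr_gt0.
have [d d0 hd] := translation_continuous g2t e20.
have dc : 0 < d / (`|c| + 1) by rewrite divr_gt0// ltr_wpDl.
near=> s; rewrite dist0_nrm.
have gs2 : in_L2 (g s) by near: s.
have l1 := in_L2_shift (c * s) gs2; have l2 := in_L2_shift (c * s) g2t.
have l3 := in_L2_shift (c * t) g2t.
rewrite (le_trans (nrmB_trans l1 l2 l3))// [leRHS]splitr lerD//.
  rewrite (nrm_shift (c * s) (in_L2B gs2 g2t)).
  have : `|0 - L2dist (g s) (g t)| <= e / 2.
    by near: s; move/cvgrPdist_le : gc; exact.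
  by rewrite dist0_nrm.
have l4 := in_L2_shift (c * (s - t)) g2t.
have := nrm_shift (c * t) (in_L2B l4 g2t).
have -> : (fun x => g t (x + c * t + c * (s - t)) - g t (x + c * t)) =
    (fun x => g t (x + c * s) - g t (x + c * t)).
  by apply/funext => x; congr (g t _ - _); ring.
move=> ->; apply: hd; rewrite normrM.
have st : `|s - t| < d / (`|c| + 1).
  by near: s; exact: near_dist.
move: st; rewrite ltr_pdivlMr; last by rewrite ltr_wpDl.
by have := normr_ge0 (s - t); nra.
Unshelve. all: by end_near. Qed.

(** One constant [B] serves both as a bound and as a Lipschitz constant in time for the moving
    multiplier. *)
Lemma L2cont_mulvar m f B t : (forall s, measurable_fun setT (m s)) ->
  (forall s x, `|m s x| <= B) -> (forall s x, `|m s x - m t x| <= B * `|s - t|) ->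
  L2cont f t -> L2cont (fun s x => m s x * f s x) t.
Proof.
move=> mm mB mL [f2 fc]; have f2t := nbhs_singleton f2.
have mD s : measurable_fun setT (fun x => m s x - m t x) by exact: measurable_funB.
split; first by near=> s; apply: (in_L2M (mm s) (bounded_ess (mB s))); near: s.
apply: (@cvg0_le _ _ (fun s => B * L2dist (f s) (f t) + `|s - t| * (B * nrm (f t)))).
  near=> s; rewrite nrm_ge0/=.
  have fs2 : in_L2 (f s) by near: s.
  rewrite [X in nrm X <= _](_ : _ = (fun x => m s x * (f s x - f t x) + (m s x - m t x) * f t x)).
    have k1 := in_L2M (mm s) (bounded_ess (mB s)) (in_L2B fs2 f2t).
    have k2 := in_L2M (mD s) (bounded_ess (mL s)) f2t.
    rewrite (le_trans (nrmD k1 k2))// lerD//.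
      exact: (nrmM_le (mm s) (bounded_ess (mB s)) (in_L2B fs2 f2t)).
    by rewrite mulrA [`|s - t| * B]mulrC; exact: (nrmM_le (mD s) (bounded_ess (mL s)) f2t).
  by apply/funext => x; ring.
have -> : (0 : R) = B * 0 + 0 * (B * nrm (f t)) by rewrite mulr0 mul0r addr0.
apply: cvgD; first by apply: cvgM => //; exact: cvg_cst.
apply: cvgM; last exact: cvg_cst.
by apply/norm_cvg0P/subr_cvg0; exact: cvg_id.
Unshelve. all: by end_near. Qed.

(** The weak form of [p_t + c p_x = g] at time [s]. *)
Definition transport_at p g c s : Prop := L2cont p s /\ in_L2 (g s) /\
  forall psi, test_function psi ->
    is_derive s 1 (fun s => ip (p s) psi) (c * ip (p s) psi^`() + ip (g s) psi).

(** In the moving frame the shift can be put on the test function as [psi (x - c * r)];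
    differentiating this shift produces [- c * Psi'], which cancels the transport term and leaves
    the source alone. *)
Lemma transport_is_derive p g c s : transport_at p g c s ->
  forall psi, test_function psi ->
  is_derive s 1 (fun s => ip (fun x => p s (x + c * s)) psi) (ip (fun x => g s (x + c * s)) psi).
Proof.
move=> [pC [g2 pg]] psi tp; have [p2 pc] := pC; have p2s := nbhs_singleton p2.
have tps := test_function_shift (- (c * s)) tp.
pose Psi x := psi (x - c * s); have {}tps : test_function Psi by exact: tps.
have P2 := test_in_L2 tps; have P'2 := test_derive1_L2 tps.
have s2 := test_in_L2 tp.
have ipE f r : in_L2 (f r) -> ip (fun x => f r (x + c * r)) psi = ip (f r) (fun x => psi (x - c * r)).
  move=> f2; rewrite -(ip_shift (c * r) f2 (in_L2_shift (- (c * r)) s2)).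
  by congr ip; apply/funext => x; rewrite addrK.
apply/little_oP.
have /little_oP o1 := pg Psi tps.
have [C C0 hC] := translation_test tps.
have Np := nrm_cvg pC.
have o2 : little_o s (fun r => (r - s) * (`|c| * (L2dist (p r) (p s) * nrm Psi^`()))).
  apply: little_o_cvg0.
  have -> : (0 : R) = `|c| * (0 * nrm Psi^`()) by rewrite mul0r mulr0.
  by apply: cvgM; [exact: cvg_cst|apply: cvgM => //; exact: cvg_cst].
have o3 : little_o s (fun r => (r - s) * (C * `|c| ^+ 2 * (nrm (p s) + 1) * (r - s))).
  apply: little_o_cvg0.
  have -> : (0 : R) = C * `|c| ^+ 2 * (nrm (p s) + 1) * 0 by rewrite mulr0.
  by apply: cvgM; [exact: cvg_cst|apply/subr_cvg0; exact: cvg_id].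
have cs0 : 0 < (`|c| + 1)^-1 by rewrite invr_gt0 ltr_wpDl.
apply: (@little_o_le _ _ _ (fun r => `|ip (p r) Psi - ip (p s) Psi - (r - s) * (c * ip (p s) Psi^`() + ip (g s) Psi)|
   + (`|(r - s) * (`|c| * (L2dist (p r) (p s) * nrm Psi^`()))|
   + `|(r - s) * (C * `|c| ^+ 2 * (nrm (p s) + 1) * (r - s))|))); last first.
  by apply: little_oD; [|apply: little_oD];
    [apply: little_o_le o1|apply: little_o_le o2|apply: little_o_le o3]; near=> r; rewrite normr_id.
near=> r.
have pr2 : in_L2 (p r) by near: r.
rewrite [leRHS]ger0_norm ?addr_ge0//.
rewrite (ipE p r)// (ipE p s)// (ipE g s)//.
pose a := - (c * (r - s)).
have PsiE : (fun x => psi (x - c * r)) = (fun x => Psi (x + a)).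
  by apply/funext => x; rewrite /Psi /a; congr psi; ring.
rewrite PsiE -/Psi.
have Pa2 := in_L2_shift a P2.
have aP := in_L2Z a P'2.
(* Three remainders: that of the weak equation, the change of [p] against the first-order shift of
   [Psi], and the Taylor remainder of the shift. Each is [o(r - s)]. *)
have E : ip (p r) (fun x => Psi (x + a)) - ip (p s) Psi - (r - s) * ip (g s) Psi =
  (ip (p r) Psi - ip (p s) Psi - (r - s) * (c * ip (p s) Psi^`() + ip (g s) Psi))
  + (- (c * (r - s)) * ip (fun x => p r x - p s x) Psi^`()
  + ip (p r) (fun x => Psi (x + a) - Psi x - a * Psi^`() x)).
  rewrite (ipBr (in_L2B Pa2 P2) aP pr2) (ipBr Pa2 P2 pr2) ipZr// ipBl// /a; ring.
rewrite E (le_trans (ler_normD _ _))// lerD// (le_trans (ler_normD _ _))// lerD//.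
  have n0 : 0 <= L2dist (p r) (p s) * nrm Psi^`().
    by apply: mulr_ge0; exact: nrm_ge0.
  rewrite [leRHS]normrM (ger0_norm (mulr_ge0 (normr_ge0 c) n0)).
  rewrite normrM normrN normrM mulrAC mulrC; apply: ler_wpM2l => //; apply: ler_wpM2l => //.
  exact: cauchy_schwarz (in_L2B pr2 p2s) P'2.
have a1 : `|a| <= 1.
  rewrite /a normrN normrM.
  have : `|r - s| < (`|c| + 1)^-1.
    by near: r; exact: near_dist.
  rewrite -[X in _ < X]mul1r ltr_pdivlMr; last by rewrite ltr_wpDl.
  by have := normr_ge0 (r - s); nra.
have l3 := in_L2B (in_L2B Pa2 P2) aP.
apply: (le_trans (cauchy_schwarz pr2 l3)).
have hp : nrm (p r) <= nrm (p s) + 1.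
  have : `|nrm (p s) - nrm (p r)| <= 1 by near: r; move/cvgrPdist_le : Np; apply.
  by rewrite ler_norml => /andP[]; lra.
apply: (le_trans (ler_pM (nrm_ge0 _) (nrm_ge0 _) hp (hC a a1))).
rewrite /a normrN normrM exprMn.
rewrite [leLHS](_ : _ = (r - s) * (C * `|c| ^+ 2 * (nrm (p s) + 1) * (r - s))); first exact: ler_norm.
by rewrite [`|r - s| ^+ 2]real_normK ?num_real//; ring.
Unshelve. all: by end_near. Qed.

End Transport.

(** * Weighted L^2 norms along characteristics *)

Section TransportEnergy.
Context {R : realType}.
Implicit Types (f g p m : R -> R -> R) (h psi phi : R -> R) (K M e t s c x a : R).

Definition bounded_C2 phi : Prop := bounded_C1 phi /\
  exists M, forall x, `|phi^`()^`() x| <= M.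

(** In the frame [x + c * s] the function becomes differentiable in L^2 with derivative the shifted
    source, while the weight becomes time-dependent: its derivative is the [c phi'] term. No space
    derivative of [p] is formed. *)
Lemma transport_energy p g c t phi : bounded_C2 phi ->
  (\forall s \near t, transport_at p g c s) -> L2cont g t ->
  is_derive t 1 (fun s => wsq phi (p s))
    (c * wsq phi^`() (p t) + 2 * ip (g t) (fun x => phi x * p t x)).
Proof.
move=> [bphi [M2 hM2]] tr gC; have [sphi [M0 hM0] [M1 hM1]] := bphi.
have [pC [_ _]] := nbhs_singleton tr.
have p2t := L2cont_at pC; have g2t := L2cont_at gC.
pose P s x := p s (x + c * s); pose G s x := g s (x + c * s).
have PC : L2cont P t := L2cont_moving c pC.
have GC : L2cont G t := L2cont_moving c gC.
have P2t := L2cont_at PC; have G2t := L2cont_at GC.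
have Pd : L2diff P (G t) t.
  apply: weak_L2diff => //; apply: filterS tr => s trs; split.
    by apply: in_L2_shift; case: trs => /L2cont_at.
  by move=> psi tp; exact: transport_is_derive trs _ tp.
pose m s x := phi (x + c * s).
have M00 : 0 <= M0 := le_trans (normr_ge0 _) (hM0 0).
have M10 : 0 <= M1 := le_trans (normr_ge0 _) (hM1 0).
have mm s : measurable_fun setT (m s) by exact: (smooth_measurable (smooth_shift (c * s) sphi)).
have mB s x : `|m s x| <= M0 + M1 * `|c|.
  by rewrite (le_trans (hM0 _))// lerDl mulr_ge0.
have mL s x : `|m s x - m t x| <= (M0 + M1 * `|c|) * `|s - t|.
  rewrite (le_trans (lipschitz_derive1 sphi hM1 _ _))//.
  rewrite (_ : x + c * s - (x + c * t) = c * (s - t)); last by ring.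
  by rewrite normrM mulrA ler_wpM2r// lerDr.
(* [m_s P_s^2 - m_t P_t^2 = (P_s - P_t) m_s (P_s + P_t) + (m_s - m_t) P_t^2]: the first part is a
   pairing with [w s], the second is expanded through [q], the Taylor remainder of the weight. *)
pose w s x := m s x * (P s x + P t x).
have wC : L2cont w t.
  by apply: (L2cont_mulvar mm mB mL); apply: L2contD => //; exact: L2cont_cst.
apply/little_oP.
have o1 := L2diff_pair Pd wC.
have o2 : little_o t (fun s => (s - t) * (M2 * `|c| ^+ 2 * ip (P t) (P t) * (s - t))).
  apply: little_o_cvg0.
  have -> : (0 : R) = M2 * `|c| ^+ 2 * ip (P t) (P t) * 0 by rewrite mulr0.
  by apply: cvgM; [exact: cvg_cst|apply/subr_cvg0; exact: cvg_id].
pose q s x := m s x - m t x - (s - t) * (c * phi^`() (x + c * t)).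
have mq s : measurable_fun setT (q s).
  apply: measurable_funB; first exact: measurable_funB.
  apply: measurable_funM => //; apply: measurable_funM => //.
  exact: (smooth_measurable (smooth_shift (c * t) (smooth_derive1 sphi))).
have qB s x : `|q s x| <= M2 * `|c| ^+ 2 * `|s - t| ^+ 2.
  have := taylor1_derive1 sphi hM2 (x + c * t) (x + c * s).
  rewrite (_ : x + c * s - (x + c * t) = c * (s - t)); last by ring.
  by rewrite normrM exprMn mulrA -mulrA mulrCA /q /m mulrCA -mulrA [c * _]mulrC -!mulrA.
apply: (little_o_le _ (little_oD o1 (little_o_le (r1 := fun s => ip (fun x => q s x * P t x) (P t)) _ o2))).
  near=> s; rewrite le_eqVlt; apply/orP; left; apply/eqP; congr `| _ |.
  have tps : transport_at p g c s by near: s.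
  have p2s : in_L2 (p s) by case: tps => /L2cont_at.
  have P2s : in_L2 (P s) := in_L2_shift _ p2s.
  have E r : in_L2 (p r) -> wsq phi (p r) = ip (fun x => m r x * P r x) (P r).
    by move=> pr2; rewrite -(ip_shift (c * r) (bounded_C1_L2 bphi pr2) pr2).
  rewrite (E s)// (E t)//.
  have mP r r' : in_L2 (P r) -> in_L2 (fun x => m r' x * P r x).
    by move=> Pr; exact: (in_L2M (mm r') (bounded_ess (mB r')) Pr).
  have w1 : w s = (fun x => m s x * P s x + m s x * P t x).
    by apply/funext => x; rewrite /w mulrDr.
  have w2 : w t = (fun x => 2 * (m t x * P t x)) by apply/funext => x; rewrite /w; ring.
  rewrite w1 w2 ipZr//; last exact: mP.
  rewrite (ipBl P2s P2t); last by apply: in_L2D; exact: mP.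
  rewrite !ipDr//; try exact: mP.
  have -> : ip (G t) (fun x => m t x * P t x) = ip (g t) (fun x => phi x * p t x).
    by rewrite -(ip_shift (c * t) g2t (bounded_C1_L2 bphi p2t)).
  pose d x := phi^`() (x + c * t).
  have dP : in_L2 (fun x => d x * P t x) by exact: (in_L2_shift (c * t) (bounded_C1_L2' bphi p2t)).
  have -> : wsq phi^`() (p t) = wsq d (P t).
    by rewrite -(ip_shift (c * t) (bounded_C1_L2' bphi p2t) p2t).
  have -> : ip (fun x => q s x * P t x) (P t) = ip (fun x => m s x * P t x) (P t)
     - ip (fun x => m t x * P t x) (P t) - (s - t) * (c * wsq d (P t)).
    rewrite -ipZl//; rewrite -ipZl//; last exact: in_L2Z.
    rewrite -ipBl//; try exact: mP.
    rewrite -ipBl//; last first.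
    - by apply: in_L2Z; exact: in_L2Z.
    - by apply: in_L2B; exact: mP.
    by congr ip; apply/funext => x; rewrite /q /d; ring.
  rewrite [ip (P s) (fun x => m s x * P s x)]ipC [ip (P t) (fun x => m s x * P t x)]ipC.
  have -> : ip (P s) (fun x => m s x * P t x) = ip (P t) (fun x => m s x * P s x).
    by rewrite -ipMr ipC.
  ring.
near=> s.
have qP := in_L2M (mq s) (bounded_ess (qB s)) P2t.
rewrite (le_trans (cauchy_schwarz qP P2t))//.
have := nrmM_le (mq s) (bounded_ess (qB s)) P2t => h.
rewrite (le_trans (ler_wpM2r (nrm_ge0 (P t)) h))//.
rewrite [leLHS](_ : _ = (s - t) * (M2 * `|c| ^+ 2 * ip (P t) (P t) * (s - t))); last first.
  by rewrite -sqr_nrm [`|s - t| ^+ 2]real_normK ?num_real//; ring.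
exact: ler_norm.
Unshelve. all: by end_near. Qed.

End TransportEnergy.

(** * Local mass and energy *)

Section ZakharovIdentities.
Context {R : realType}.
Implicit Types (f g : R -> R -> R) (psi phi : R -> R) (t s x : R).

Lemma ip_sqr_increment phi (f g : R -> R) : bounded_C1 phi -> in_L2 f -> in_L2 g ->
  ip (fun x => f x - g x) (fun x => phi x * (f x + g x)) =
  wsq phi f - wsq phi g.
Proof.
move=> bp f2 g2; have l1 := bounded_C1_L2 bp f2; have l2 := bounded_C1_L2 bp g2.
have -> : (fun x => phi x * (f x + g x)) = (fun x => phi x * f x + phi x * g x).
  by apply/funext => x; rewrite mulrDr.
rewrite ipBl//; last exact: in_L2D.
rewrite !ipDr// [ip f (fun x => phi x * f x)]ipC [ip g (fun x => phi x * g x)]ipC.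
by rewrite [ip f (fun x => phi x * g x)]ipC (ipMr g _ f); ring.
Qed.

Lemma H1dual_sqr_derive phi f (f' : R -> R -> R) F0 F1 t : bounded_C1 phi ->
  H1dual_diff f F0 F1 t -> H1cont f f' t ->
  is_derive t 1 (fun s => wsq phi (f s))
    (2 * (ip F0 (fun x => phi x * f t x) +
          ip F1 (fun x => phi^`() x * f t x + phi x * f' t x))).
Proof.
move=> bp fd fC; have wt := H1cont_at fC.
have [f2t f'2t _] := wt.
have cC : H1cont (fun=> f t) (fun=> f' t) t.
  by split; [near=> s|exact: L2cont_cst|exact: L2cont_cst].
have wC := H1cont_smoothM bp (H1contD fC cC).
have [fs2 F02 F12 _] := fd.
apply/little_oP; apply: little_o_le (H1dual_pair fd wC).
near=> s; rewrite le_eqVlt; apply/orP; left; apply/eqP; congr `| _ |.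
have f2s : in_L2 (f s) by near: s.
rewrite ip_sqr_increment//; congr (_ - (s - t) * _).
rewrite mulrDr; congr (_ + _).
  rewrite -ipZr//; last exact: bounded_C1_L2.
  by apply: eq_Rintegral => x _; ring.
rewrite -ipZr//; last by apply: in_L2D; [exact: bounded_C1_L2'|exact: bounded_C1_L2].
by apply: eq_Rintegral => x _; ring.
Unshelve. all: by end_near. Qed.

(** The system for [u = a + i b], with [a1] and [b1] the space derivatives: [a_t = b n - b_xx] and
    [b_t = a_xx - a n], tested in space at each positive time. *)
Record zak_H1 (a b a1 b1 n v : R -> R -> R) : Prop := ZakH1 {
  za : forall t, 0 < t -> H1cont a a1 t;
  zb : forall t, 0 < t -> H1cont b b1 t;
  zn : forall t, 0 < t -> L2cont n t;
  zv : forall t, 0 < t -> L2cont v t;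
  za_eq : forall t psi, 0 < t -> test_function psi ->
    is_derive t 1 (fun s => ip (a s) psi)
      (ip (fun x => b t x * n t x) psi - ip (b t) psi^`()^`());
  zb_eq : forall t psi, 0 < t -> test_function psi ->
    is_derive t 1 (fun s => ip (b s) psi)
      (ip (a t) psi^`()^`() - ip (fun x => a t x * n t x) psi);
  zn_eq : forall t psi, 0 < t -> test_function psi ->
    is_derive t 1 (fun s => ip (n s) psi) (ip (v t) psi^`());
  zv_eq : forall t psi, 0 < t -> test_function psi ->
    is_derive t 1 (fun s => ip (v s) psi)
      (ip (fun x => n t x + (a t x * a t x + b t x * b t x)) psi^`())
}.

Context (a b a1 b1 n v : R -> R -> R).
Hypothesis Z : zak_H1 a b a1 b1 n v.

Lemma near_gt0 (P : R -> Prop) t : 0 < t -> (forall s, 0 < s -> P s) -> \forall s \near t, P s.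
Proof. by move=> t0 P0; apply: filterS (lt_nbhsr t0) => s; exact: P0. Qed.

Lemma L2cont_bn t : 0 < t -> L2cont (fun s x => b s x * n s x) t.
Proof. by move=> t0; exact: H1cont_L2M (zb Z t0) (zn Z t0). Qed.

Lemma L2cont_an t : 0 < t -> L2cont (fun s x => a s x * n s x) t.
Proof. by move=> t0; exact: H1cont_L2M (za Z t0) (zn Z t0). Qed.

(** One of the two derivatives on the test function goes back to [b], so that [a_t = b n - (b1)_x]
    has the form [F0 - F1'] with both parts continuous in L^2. *)
Lemma a_H1dual t : 0 < t -> H1dual_diff a (fun x => b t x * n t x) (b1 t) t.
Proof.
move=> t0; have [_ _ b1C] := zb Z t0.
apply: (weak_H1dual_diff (L2cont_bn t0) b1C).
apply: (near_gt0 t0) => s s0.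
split; first by have /weakd_L2 := H1cont_at (za Z s0).
move=> psi tp; have := za_eq Z s0 tp.
have [_ _ ->//] := H1cont_at (zb Z s0); last exact: test_function_derive1.
by rewrite opprK.
Qed.

Lemma b_H1dual t : 0 < t -> H1dual_diff b (fun x => - (a t x * n t x)) (fun x => - a1 t x) t.
Proof.
move=> t0; have [_ _ a1C] := za Z t0.
apply: (weak_H1dual_diff (L2contN (L2cont_an t0)) (L2contN a1C)).
apply: (near_gt0 t0) => s s0.
split; first by have /weakd_L2 := H1cont_at (zb Z s0).
move=> psi tp; have := zb_eq Z s0 tp.
have [a2 a12 aa1] := H1cont_at (za Z s0).
rewrite aa1; last exact: test_function_derive1.
have an2 := L2cont_at (L2cont_an s0).
have p2 := test_in_L2 tp; have p'2 := test_derive1_L2 tp.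
rewrite !ipNl//.
by rewrite addrC.
Qed.

(** The potential terms [phi a b n] cancel between the two equations, as do the terms [phi a1 b1];
    only the flux through [phi'] is left. *)
Lemma mass_derive phi t : bounded_C1 phi -> 0 < t ->
  is_derive t 1 (fun s => wsq phi (a s) + wsq phi (b s))
    (2 * (ip (fun x => phi^`() x * a t x) (b1 t)
        - ip (fun x => phi^`() x * b t x) (a1 t))).
Proof.
move=> bp t0; have aC := za Z t0; have bC := zb Z t0.
have [a2 a12 _] := H1cont_at aC; have [b2 b12 _] := H1cont_at bC.
have n2 := L2cont_at (zn Z t0).
have bn2 := L2cont_at (L2cont_bn t0); have an2 := L2cont_at (L2cont_an t0).
have h := is_deriveD (H1dual_sqr_derive bp (a_H1dual t0) aC) (H1dual_sqr_derive bp (b_H1dual t0) bC).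
apply: (is_derive_eq h); rewrite -mulrDr; congr (2 * _).
have l1 := bounded_C1_L2 bp a2; have l2 := bounded_C1_L2 bp b2.
have l3 := bounded_C1_L2' bp a2; have l4 := bounded_C1_L2' bp b2.
have l5 := bounded_C1_L2 bp a12; have l6 := bounded_C1_L2 bp b12.
rewrite !ipDr//; try exact: in_L2N.
rewrite !ipNl//.
have -> : ip (fun x => a t x * n t x) (fun x => phi x * b t x) =
    ip (fun x => b t x * n t x) (fun x => phi x * a t x).
  by apply: eq_Rintegral => x _; ring.
have -> : ip (a1 t) (fun x => phi x * b1 t x) = ip (b1 t) (fun x => phi x * a1 t x).
  by apply: eq_Rintegral => x _; ring.
by rewrite [ip (b1 t) (fun x => _ * a t x)]ipC [ip (a1 t) (fun x => _ * b t x)]ipC; ring.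
Qed.

End ZakharovIdentities.

(** * The local energy identity for solutions in H^2 *)

Section EnergyIdentity.
Context {R : realType}.
Implicit Types (psi phi : R -> R) (t s x : R).

Context (a b a1 b1 a2 b2 n v : R -> R -> R).
Hypothesis Z : zak_H1 a b a1 b1 n v.
Hypothesis za1 : forall t, 0 < t -> H1cont a1 a2 t.
Hypothesis zb1 : forall t, 0 < t -> H1cont b1 b2 t.

(** [dta] and [dtb] are the time derivatives of [a] and [b]; the second space derivatives place them
    in L^2. *)
Definition dta t x : R := b t x * n t x - b2 t x.
Definition dtb t x : R := a2 t x - a t x * n t x.

Lemma L2cont_dta t : 0 < t -> L2cont dta t.
Proof. by move=> t0; have [_ _ h] := zb1 t0; exact: L2contB (L2cont_bn Z t0) h. Qed.

Lemma L2cont_dtb t : 0 < t -> L2cont dtb t.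
Proof. by move=> t0; have [_ _ h] := za1 t0; exact: L2contB h (L2cont_an Z t0). Qed.

Lemma a_L2diff t : 0 < t -> L2diff a (dta t) t.
Proof.
move=> t0; apply: (weak_L2diff (L2cont_dta t0)).
apply: (near_gt0 t0) => s s0.
have wb := H1cont_at (zb Z s0); have wb1 := H1cont_at (zb1 s0).
have [b12 b22 bb] := wb1; have [_ _ b0] := wb.
split; first by have /weakd_L2 := H1cont_at (za Z s0).
move=> psi tp; have tp' := test_function_derive1 tp; have p2 := test_in_L2 tp.
have := za_eq Z s0 tp.
rewrite b0// opprK bb// ipBl//; first exact: L2cont_at (L2cont_bn Z s0).
Qed.

Lemma b_L2diff t : 0 < t -> L2diff b (dtb t) t.
Proof.
move=> t0; apply: (weak_L2diff (L2cont_dtb t0)).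
apply: (near_gt0 t0) => s s0.
have wa := H1cont_at (za Z s0); have wa1 := H1cont_at (za1 s0).
have [a12 a22 aa] := wa1; have [_ _ a0] := wa.
split; first by have /weakd_L2 := H1cont_at (zb Z s0).
move=> psi tp; have tp' := test_function_derive1 tp; have p2 := test_in_L2 tp.
have := zb_eq Z s0 tp.
rewrite a0// aa// opprK ipBl//; exact: L2cont_at (L2cont_an Z s0).
Qed.

(** Integration by parts transfers the increment of [f'] to that of [f] tested with [h']: the time
    derivative of [f'] is [F'] in the dual of H^1. *)
Lemma H1dual_derivative (f f' : R -> R -> R) (F : R -> R) t : L2diff f F t -> H1cont f f' t ->
  H1dual_diff f' (fun=> 0) (fun x => - F x) t.
Proof.
move=> [f2 F2 fd] [wf fC f'C]; have wft := nbhs_singleton wf; have [f'2 _] := f'C.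
split => //; [exact: in_L2_0|exact: in_L2N|move=> e e0].
near=> s => h h' wh; have [h2 h'2 _] := wh.
have wfs : weakd (f s) (f' s) by near: s.
have fs2 := weakd_L2 wfs; have ft2 := weakd_L2 wft.
have hfd : nrm (fun x => f s x - f t x - (s - t) * F x) <= e * `|s - t|.
  by rewrite -[leLHS]ger0_norm ?nrm_ge0//; near: s; exact: fd.
have := integration_by_parts_H1 (weakdB wfs wft) wh.
rewrite ip0l.
rewrite ipNl// add0r mulrN opprK => /(congr1 -%R); rewrite opprK => <-.
have dfs := in_L2B fs2 ft2.
rewrite [X in `|X|](_ : _ = - ip (fun x => f s x - f t x - (s - t) * F x) h'); last first.
  by rewrite (ipBl dfs (in_L2Z (s - t) F2) h'2) ipZl//; ring.
rewrite normrN (le_trans (cauchy_schwarz _ h'2))//.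
  by apply: in_L2B => //; exact: in_L2Z.
rewrite (le_trans (ler_wpM2r (nrm_ge0 h') hfd))// ler_wpM2l//.
  by rewrite mulr_ge0// ltW.
by rewrite lerDr nrm_ge0.
Unshelve. all: by end_near. Qed.

Lemma gradient_derive phi t : bounded_C1 phi -> 0 < t ->
  is_derive t 1
    (fun s => wsq phi (a1 s) + wsq phi (b1 s))
    (- 2 * (ip (dta t) (fun x => phi^`() x * a1 t x + phi x * a2 t x)
          + ip (dtb t) (fun x => phi^`() x * b1 t x + phi x * b2 t x))).
Proof.
move=> bp t0.
have ha := H1dual_sqr_derive bp (H1dual_derivative (a_L2diff t0) (za Z t0)) (za1 t0).
have hb := H1dual_sqr_derive bp (H1dual_derivative (b_L2diff t0) (zb Z t0)) (zb1 t0).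
have h := is_deriveD ha hb; apply: (is_derive_eq h).
have [a12 a22 _] := H1cont_at (za1 t0); have [b12 b22 _] := H1cont_at (zb1 t0).
have A2 := L2cont_at (L2cont_dta t0); have B2 := L2cont_at (L2cont_dtb t0).
rewrite !ip0l !add0r !ipNl//; try by apply: in_L2D; [exact: bounded_C1_L2'|exact: bounded_C1_L2].
by ring.
Qed.

Definition dens t x : R := a t x * a t x + b t x * b t x.
(** The space derivative of [dens], left in the unsimplified form given by the product rule
    [H1contM]. *)
Definition dens1 t x : R := (a1 t x * a t x + a t x * a1 t x) + (b1 t x * b t x + b t x * b1 t x).

Lemma H1cont_dens t : 0 < t -> H1cont dens dens1 t.
Proof. by move=> t0; apply: H1contD; apply: H1contM; [exact: (za Z)|exact: (za Z)|exact: (zb Z)|exact: (zb Z)]. Qed.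

Lemma n_H1dual t : 0 < t -> H1dual_diff n (fun=> 0) (v t) t.
Proof.
move=> t0; apply: (@weak_H1dual_diff _ n (fun=> (fun=> 0)) v).
- exact/L2cont_cst/in_L2_0.
- exact: zv Z _ t0.
apply: (near_gt0 t0) => s s0.
split; first exact: L2cont_at (zn Z s0).
move=> psi tp; have := zn_eq Z s0 tp.
rewrite ip0l.
by rewrite add0r.
Qed.

Lemma interaction_derive phi t : bounded_C1 phi -> 0 < t ->
  is_derive t 1 (fun s => ip (n s) (fun x => phi x * dens s x))
    (ip (v t) (fun x => phi^`() x * dens t x + phi x * dens1 t x)
     + 2 * (ip (dta t) (fun x => phi x * (a t x * n t x)) + ip (dtb t) (fun x => phi x * (b t x * n t x)))).
Proof.
move=> bp t0; have aC := za Z t0; have bC := zb Z t0.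
have nC := zn Z t0; have n2 := L2cont_at nC.
have gC := H1cont_smoothM bp (H1cont_dens t0).
have o1 := H1dual_pair (n_H1dual t0) gC.
have cst f f' : weakd f f' -> H1cont (fun=> f) (fun=> f') t.
  by move=> w; have [f2 f'2 _] := w; split; [near=> s|exact: L2cont_cst|exact: L2cont_cst].
have pn2 := bounded_C1_L2 bp n2.
have waC : L2cont (fun s x => (a s x + a t x) * (phi x * n t x)) t.
  exact: H1cont_L2M (H1contD aC (cst _ _ (H1cont_at aC))) (L2cont_cst _ pn2).
have wbC : L2cont (fun s x => (b s x + b t x) * (phi x * n t x)) t.
  exact: H1cont_L2M (H1contD bC (cst _ _ (H1cont_at bC))) (L2cont_cst _ pn2).
have o2 := L2diff_pair (a_L2diff t0) waC.
have o3 := L2diff_pair (b_L2diff t0) wbC.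
apply/little_oP; apply: little_o_le (little_oD o1 (little_oD o2 o3)).
apply: (near_gt0 t0) => s s0.
rewrite le_eqVlt; apply/orP; left; apply/eqP; congr `| _ |.
have as2 := weakd_L2 (H1cont_at (za Z s0)); have bs2 := weakd_L2 (H1cont_at (zb Z s0)).
have at2 := weakd_L2 (H1cont_at aC); have bt2 := weakd_L2 (H1cont_at bC).
have ns2 := L2cont_at (zn Z s0).
have ds2 := bounded_C1_L2 bp (weakd_L2 (H1cont_at (H1cont_dens s0))).
have dt2 := bounded_C1_L2 bp (weakd_L2 (H1cont_at (H1cont_dens t0))).
rewrite ip0l.
rewrite add0r ipBl//.
have k1 := L2cont_at (L2cont_an Z t0); have k2 := L2cont_at (L2cont_bn Z t0).
have A2 := L2cont_at (L2cont_dta t0); have B2 := L2cont_at (L2cont_dtb t0).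
have m1 := bounded_C1_L2 bp k1; have m2 := bounded_C1_L2 bp k2.
have -> : ip (dta t) (fun x => (a t x + a t x) * (phi x * n t x)) =
    2 * ip (dta t) (fun x => phi x * (a t x * n t x)).
  by rewrite -ipZr//; apply: eq_Rintegral => x _; ring.
have -> : ip (dtb t) (fun x => (b t x + b t x) * (phi x * n t x)) =
    2 * ip (dtb t) (fun x => phi x * (b t x * n t x)).
  by rewrite -ipZr//; apply: eq_Rintegral => x _; ring.
(* With [n] frozen at [t], the increment of [a^2 + b^2] factors as differences times sums. *)
have E : ip (n t) (fun x => phi x * dens s x) - ip (n t) (fun x => phi x * dens t x) =
   ip (fun x => a s x - a t x) (fun x => (a s x + a t x) * (phi x * n t x)) +
   ip (fun x => b s x - b t x) (fun x => (b s x + b t x) * (phi x * n t x)).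
  rewrite -ipBr// [LHS]/ip [X in X + _]/ip [X in _ + X]/ip -RintegralD//; last 2 first.
  - apply: integrable_ip; first exact: in_L2B.
    exact: (H1_in_L2M (weakdD (H1cont_at (za Z s0)) (H1cont_at aC)) pn2).
  - apply: integrable_ip; first exact: in_L2B.
    exact: (H1_in_L2M (weakdD (H1cont_at (zb Z s0)) (H1cont_at bC)) pn2).
  by apply: eq_Rintegral => x _; rewrite /dens; ring.
have {}E : ip (n t) (fun x => phi x * dens s x) = ip (n t) (fun x => phi x * dens t x) +
   (ip (fun x => a s x - a t x) (fun x => (a s x + a t x) * (phi x * n t x)) +
   ip (fun x => b s x - b t x) (fun x => (b s x + b t x) * (phi x * n t x))).
  by rewrite -E; ring.
rewrite E; ring.
Unshelve. all: by end_near. Qed.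

(** The combinations [n + v] and [n - v] diagonalise the wave part, with speeds [1] and [-1];
    integrating [dens] by parts makes the source an L^2 function. *)
Lemma transport_characteristic c t : c * c = 1 -> 0 < t ->
  transport_at (fun s x => n s x + c * v s x) (fun s x => - c * dens1 s x) c t.
Proof.
move=> cc t0; have nC := zn Z t0; have vC := zv Z t0.
have n2 := L2cont_at nC; have v2 := L2cont_at vC; have cv2 := in_L2Z c v2.
have [d2 d12 dd] := H1cont_at (H1cont_dens t0).
split; [exact: L2contD nC (L2contZ c vC)|split; first exact: in_L2Z].
move=> psi tp; have p2 := test_in_L2 tp; have p'2 := test_derive1_L2 tp.
have h : is_derive t 1 (fun s => ip (n s) psi + c * ip (v s) psi)
  (c * ip (fun x => n t x + c * v t x) psi^`() + ip (fun x => - c * dens1 t x) psi).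
  apply: (is_derive_eq (is_deriveD (zn_eq Z t0 tp) (is_deriveZ c (zv_eq Z t0 tp)))).
  rewrite /GRing.scale/= -/(dens t) (ipDl n2 d2)// (ipDl n2 cv2)// !ipZl// dd//.
  by rewrite (mulrDr c _ (c * _)) (mulrA c c) cc; ring.
apply: (is_derive_near _ h); apply: (near_gt0 t0) => s s0.
have ns2 := L2cont_at (zn Z s0); have vs2 := L2cont_at (zv Z s0).
by rewrite ipDl ?ipZl//; exact: in_L2Z.
Qed.

Lemma wsq_addZ phi c (f g : R -> R) : in_L2 f -> in_L2 g ->
  in_L2 (fun x => phi x * f x) -> in_L2 (fun x => phi x * g x) ->
  wsq phi (fun x => f x + c * g x) =
  wsq phi f + 2 * c * ip (fun x => phi x * f x) g + c ^+ 2 * wsq phi g.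
Proof.
move=> f2 g2 pf2 pg2; have cg2 := in_L2Z c g2; have cpg2 := in_L2Z c pg2.
have -> : (fun x => phi x * (f x + c * g x)) = (fun x => phi x * f x + c * (phi x * g x)).
  by apply/funext => x; ring.
rewrite (ipDl pf2 cpg2 (in_L2D f2 cg2)) !(ipDr f2 cg2)// !ipZl// !ipZr//.
have -> : ip (fun x => phi x * g x) f = ip (fun x => phi x * f x) g.
  by apply: eq_Rintegral => x _; ring.
by ring.
Qed.

Lemma wave_derive phi t : bounded_C2 phi -> 0 < t ->
  is_derive t 1 (fun s => 2^-1 * (wsq phi (n s) + wsq phi (v s)))
    (ip (fun x => phi^`() x * n t x) (v t) - ip (dens1 t) (fun x => phi x * v t x)).
Proof.
move=> bp2 t0; have [bp _] := bp2; have [_ _ d1C] := H1cont_dens t0.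
have tr c : c * c = 1 -> \forall s \near t,
    transport_at (fun s x => n s x + c * v s x) (fun s x => - c * dens1 s x) c s.
  by move=> cc; apply: (near_gt0 t0) => s; exact: transport_characteristic.
have hd c cc := transport_energy bp2 (tr c cc) (L2contZ (- c) d1C).
(* By the parallelogram identity this is half the weighted norm of [n] and [v], written in the two
   characteristic variables. *)
pose e s := 4^-1 * (wsq phi (fun x => n s x + 1 * v s x) + wsq phi (fun x => n s x + -1 * v s x)).
have he : is_derive t 1 e _ :=
  is_deriveZ 4^-1 (is_deriveD (hd 1 (mulr1 1)) (hd (-1) (etrans (mulrNN 1 1) (mulr1 1)))).
apply: (is_derive_near (g := e)).
  apply: (near_gt0 t0) => s s0.
  have ns2 := L2cont_at (zn Z s0); have vs2 := L2cont_at (zv Z s0).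
  by rewrite /e !wsq_addZ//; try exact: bounded_C1_L2; field.
have n2 := L2cont_at (zn Z t0); have v2 := L2cont_at (zv Z t0); have d12 := L2cont_at d1C.
have k1 := bounded_C1_L2 bp n2; have k2 := bounded_C1_L2 bp v2.
apply: (is_derive_eq he); rewrite /GRing.scale/= !wsq_addZ//; try exact: bounded_C1_L2'.
have E c : ip (fun x => - c * dens1 t x) (fun x => phi x * (n t x + c * v t x)) =
    - c * ip (dens1 t) (fun x => phi x * n t x) - c ^+ 2 * ip (dens1 t) (fun x => phi x * v t x).
  have -> : (fun x => phi x * (n t x + c * v t x)) = (fun x => phi x * n t x + c * (phi x * v t x)).
    by apply/funext => x; ring.
  rewrite ipZl//; last exact: in_L2D k1 (in_L2Z c k2).
  by rewrite (ipDr k1 (in_L2Z c k2))// ipZr//; ring.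
by rewrite !E; field.
Qed.

Definition local_energy phi s : R :=
  wsq phi (a1 s) + wsq phi (b1 s) +
  2^-1 * (wsq phi (n s) + wsq phi (v s)) +
  ip (n s) (fun x => phi x * dens s x).

(** The source of the wave part cancels the [phi dens1] part of the interaction, and the gradient
    and interaction terms cancel by symmetry of the product [dta dtb]. Every remaining term carries
    [phi']. *)
Lemma energy_derive phi t : bounded_C2 phi -> 0 < t ->
  is_derive t 1 (local_energy phi)
    (- 2 * (ip (dta t) (fun x => phi^`() x * a1 t x)
          + ip (dtb t) (fun x => phi^`() x * b1 t x))
     + ip (fun x => phi^`() x * n t x) (v t)
     + ip (v t) (fun x => phi^`() x * dens t x)).
Proof.
move=> bp2 t0; have [bp _] := bp2.
have h := is_deriveD (is_deriveD (gradient_derive bp t0) (wave_derive bp2 t0)) (interaction_derive bp t0).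
apply: (is_derive_eq h).
have [a12 a22 _] := H1cont_at (za1 t0); have [b12 b22 _] := H1cont_at (zb1 t0).
have A2 := L2cont_at (L2cont_dta t0); have B2 := L2cont_at (L2cont_dtb t0).
have an2 := L2cont_at (L2cont_an Z t0); have bn2 := L2cont_at (L2cont_bn Z t0).
have [d2 d12 _] := H1cont_at (H1cont_dens t0).
have v2 := L2cont_at (zv Z t0).
have l1 := bounded_C1_L2' bp a12; have l2 := bounded_C1_L2' bp b12.
have l3 := bounded_C1_L2 bp a22; have l4 := bounded_C1_L2 bp b22.
have l5 := bounded_C1_L2 bp an2; have l6 := bounded_C1_L2 bp bn2.
have l7 := bounded_C1_L2' bp d2; have l8 := bounded_C1_L2 bp d12.
rewrite (ipDr l1 l3)// (ipDr l2 l4)// (ipDr l7 l8)//.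
have -> : ip (dens1 t) (fun x => phi x * v t x) = ip (v t) (fun x => phi x * dens1 t x).
  by apply: eq_Rintegral => x _; ring.
(* the bulk terms cancel: [dta = b n - b2] and [dtb = a2 - a n] *)
have E1 : ip (dta t) (fun x => phi x * dtb t x) =
    ip (dta t) (fun x => phi x * a2 t x) - ip (dta t) (fun x => phi x * (a t x * n t x)).
  by rewrite -ipBr//; congr ip; apply/funext => x; rewrite -mulrBr.
have E2 : ip (dtb t) (fun x => phi x * dta t x) =
    ip (dtb t) (fun x => phi x * (b t x * n t x)) - ip (dtb t) (fun x => phi x * b2 t x).
  by rewrite -ipBr//; congr ip; apply/funext => x; rewrite -mulrBr.
have E3 : ip (dta t) (fun x => phi x * dtb t x) = ip (dtb t) (fun x => phi x * dta t x).
  by apply: eq_Rintegral => x _; ring.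
by move: E1 E2 E3; lra.
Qed.

End EnergyIdentity.

(** * A priori bounds and smallness of the tails *)

Section Estimates.
Context {R : realType}.
Implicit Types (psi phi : R -> R) (t s x r e C : R).

Lemma nrm_mul_H1_le (f f' g : R -> R) (A A1 G : R) : weakd f f' -> in_L2 g ->
  nrm f <= A -> nrm f' <= A1 -> nrm g <= G ->
  nrm (fun x => f x * g x) <= Num.sqrt (2 * (A * A1)) * G.
Proof.
move=> wf g2 fA fA1 gG; rewrite (le_trans (H1_nrmM wf g2))//.
apply: ler_pM => //; rewrite ?nrm_ge0 ?sqrtr_ge0//.
by rewrite ler_wsqrtr// ler_wpM2l// ler_pM// nrm_ge0.
Qed.

Lemma ip_weight_ge0 phi (f : R -> R) : (forall x, 0 <= phi x) -> 0 <= wsq phi f.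
Proof.
by move=> p0; apply: Rintegral_ge0 => x _; rewrite -mulrA -expr2 mulr_ge0// sqr_ge0.
Qed.

Lemma norm_ip_weight_le phi M (f g : R -> R) (F G : R) : measurable_fun setT phi ->
  (forall x, `|phi x| <= M) -> in_L2 f -> in_L2 g -> nrm f <= F -> nrm g <= G ->
  `|ip (fun x => phi x * f x) g| <= M * (F * G).
Proof.
move=> mp pM f2 g2 fF gG; have pf2 := in_L2M mp (bounded_ess pM) f2.
have M0 : 0 <= M := le_trans (normr_ge0 _) (pM 0).
rewrite (le_trans (cauchy_schwarz pf2 g2))// mulrA ler_pM ?nrm_ge0//.
rewrite (le_trans (nrmM_le mp (bounded_ess pM) f2))//.
by rewrite ler_wpM2l.
Qed.

(** The interaction has no sign, but the supremum bound makes it at most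
    [N^2 / 4 + 4 A^3 A1 + 4 B^3 B1], with capitals for norms. Young's inequality absorbs half of the
    gradient and leaves [8 A^6 + 8 B^6 <= 16 Ms^3], the origin of the constant. *)
Lemma energy_bound (a b a1 b1 n v : R -> R) (Ms Es : R) :
  weakd a a1 -> weakd b b1 -> in_L2 n -> in_L2 v ->
  ip a a + ip b b = Ms ->
  ip a1 a1 + ip b1 b1 + 2^-1 * (ip n n + ip v v) + ip n (fun x => a x * a x + b x * b x) = Es ->
  let C := Ms + 4 * (Es + 16 * Ms ^+ 3) + 1 in
  [/\ nrm a <= C, nrm b <= C, nrm a1 <= C & nrm b1 <= C] /\ (nrm n <= C /\ nrm v <= C).
Proof.
move=> wa wb n2 v2 mass energy C.
have [a2 a12 _] := wa; have [b2 b12 _] := wb.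
have aa2 := H1_in_L2M wa a2; have bb2 := H1_in_L2M wb b2.
have nD : `|ip n (fun x => a x * a x + b x * b x)| <=
    nrm n * (Num.sqrt (2 * (nrm a * nrm a1)) * nrm a + Num.sqrt (2 * (nrm b * nrm b1)) * nrm b).
  apply: (norm_ip_le n2 (in_L2D aa2 bb2)).
  rewrite (le_trans (nrmD aa2 bb2))// lerD//; exact: H1_nrmM.
have sa : Num.sqrt (2 * (nrm a * nrm a1)) ^+ 2 = 2 * (nrm a * nrm a1).
  by rewrite sqr_sqrtr// mulr_ge0// mulr_ge0// nrm_ge0.
have sb : Num.sqrt (2 * (nrm b * nrm b1)) ^+ 2 = 2 * (nrm b * nrm b1).
  by rewrite sqr_sqrtr// mulr_ge0// mulr_ge0// nrm_ge0.
move: mass energy nD; rewrite -!sqr_nrm.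
have := nrm_ge0 v; have := nrm_ge0 n; have := nrm_ge0 a; have := nrm_ge0 b.
have := nrm_ge0 a1; have := nrm_ge0 b1; move: sa sb; rewrite /C.
have := sqrtr_ge0 (2 * (nrm a * nrm a1)); have := sqrtr_ge0 (2 * (nrm b * nrm b1)).
move: (nrm a) (nrm b) (nrm a1) (nrm b1) (nrm n) (nrm v)
  (Num.sqrt (2 * (nrm a * nrm a1))) (Num.sqrt (2 * (nrm b * nrm b1)))
  (ip n (fun x => a x * a x + b x * b x)).
move=> A B A1 B1 N V SA SB I SB0 SA0 eA eB B10 A10 B0 A0 N0 V0 mass energy.
rewrite ler_norml => /andP[I1 _].
have M0 : 0 <= Ms by rewrite -mass addr_ge0// sqr_ge0.
have AM : A ^+ 2 <= Ms by rewrite -mass lerDl sqr_ge0.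
have BM : B ^+ 2 <= Ms by rewrite -mass lerDr sqr_ge0.
have pow3 (X : R) : 0 <= X -> X ^+ 2 <= Ms -> (X ^+ 3) ^+ 2 <= Ms ^+ 3.
  by move=> X0 XM; rewrite -exprM mulnC exprM lerXn2r// nnegrE ?sqr_ge0.
have A6 := pow3 A A0 AM; have B6 := pow3 B B0 BM.
have h1 : N * (SA * A + SB * B) <= 4^-1 * N ^+ 2 + (SA * A + SB * B) ^+ 2.
  by have := sqr_ge0 (2^-1 * N - (SA * A + SB * B)); lra.
have h2 : (SA * A + SB * B) ^+ 2 <= 2 * (SA ^+ 2 * A ^+ 2 + SB ^+ 2 * B ^+ 2).
  by have := sqr_ge0 (SA * A - SB * B); lra.
have h3 : 4 * (A ^+ 3 * A1) <= 2^-1 * A1 ^+ 2 + 8 * (A ^+ 3) ^+ 2.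
  by have := sqr_ge0 (A1 - 4 * A ^+ 3); lra.
have h4 : 4 * (B ^+ 3 * B1) <= 2^-1 * B1 ^+ 2 + 8 * (B ^+ 3) ^+ 2.
  by have := sqr_ge0 (B1 - 4 * B ^+ 3); lra.
have h5 : 2 * (SA ^+ 2 * A ^+ 2 + SB ^+ 2 * B ^+ 2) = 4 * (A ^+ 3 * A1) + 4 * (B ^+ 3 * B1).
  by rewrite eA eB; ring.
pose Q := Es + 16 * Ms ^+ 3; rewrite -/Q.
have key : 2^-1 * (A1 ^+ 2 + B1 ^+ 2) + 4^-1 * N ^+ 2 + 2^-1 * V ^+ 2 <= Q.
  rewrite /Q; lra.
(* Trades sharpness for a bound free of square roots, so that a single [C] fits all six norms. *)
have sqle (X K : R) : 0 <= X -> X ^+ 2 <= K -> X <= K + 1.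
  by move=> X0 XK; have := sqr_ge0 (X - 1); rewrite sqrrB1; lra.
have := sqr_ge0 A1; have := sqr_ge0 B1; have := sqr_ge0 N; have := sqr_ge0 V => V2 N2 B12 A12.
have Q0 : 0 <= Q by lra.
split; first split.
- by have := sqle A Ms A0 AM; lra.
- by have := sqle B Ms B0 BM; lra.
- have := sqle A1 (4 * Q) A10; lra.
- have := sqle B1 (4 * Q) B10; lra.
by split; [have := sqle N (4 * Q) N0|have := sqle V (4 * Q) V0]; lra.
Qed.

Lemma cut_ip_small (f g : R -> R) e : in_L2 f -> in_L2 g -> 0 < e ->
  exists2 r0, 0 < r0 & forall r, r0 <= r -> `|ip (fun x => cut r x * f x) g| <= e.
Proof.
move=> f2 g2 e0; have G0 : 0 < nrm g + 1 by rewrite ltr_wpDl// nrm_ge0.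
have [r0 r00 h] := cut_small f2 (divr_gt0 e0 G0); exists r0 => // r r0r.
have rp : 0 < r := lt_le_trans r00 r0r.
rewrite ipC (le_trans (norm_ip_le g2 (cut_L2 rp f2) (h r r0r)))//.
rewrite mulrC mulrAC ler_pdivrMr// ler_wpM2l ?(ltW e0)//.
by rewrite lerDl.
Qed.

Context (a b a1 b1 n v : R -> R -> R).
Hypothesis Z : zak_H1 a b a1 b1 n v.
Variable C : R.
Hypothesis bound : forall t, 0 < t -> [/\ nrm (a t) <= C, nrm (b t) <= C,
  nrm (a1 t) <= C & nrm (b1 t) <= C] /\ (nrm (n t) <= C /\ nrm (v t) <= C).

Let C_ge0 : 0 <= C.
Proof. by have [[h _ _ _] _] := bound ltr01; exact: le_trans (nrm_ge0 _) h. Qed.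

Definition local_mass r s : R :=
  wsq (cut r) (a s) + wsq (cut r) (b s).

(** One third of [e] goes to each of the two tails at time [1], and one third to the growth between
    [1] and [T], of rate at most [4 * D * C ^+ 2 / r]. *)
Lemma mass_tail e : 0 < e -> exists eta r0, [/\ 0 < eta, 0 < r0 &
  forall T r, 1 <= T -> r0 <= r -> T / r <= eta -> local_mass r T <= e].
Proof.
move=> e0; have e30 : 0 < e / 3 by rewrite divr_gt0.
have a2 := weakd_L2 (H1cont_at (za Z ltr01)); have b2 := weakd_L2 (H1cont_at (zb Z ltr01)).
have [r1 r10 h1] := cut_ip_small a2 a2 e30; have [r2 r20 h2] := cut_ip_small b2 b2 e30.
have [D D0 hD] := tail_derive (@cutP R).
pose K := 4 * D * C ^+ 2 + 1.
have K0 : 0 < K by rewrite ltr_wpDl// mulr_ge0 ?sqr_ge0// mulr_ge0// ltW.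
exists (e / 3 / K), (r1 + r2); split; [by rewrite divr_gt0|by rewrite addr_gt0|].
move=> T r T1 rr Tr.
have rp : 0 < r by rewrite (lt_le_trans _ rr)// addr_gt0.
have bp := cut_bounded_C1 rp.
have m1 : local_mass r 1 <= e / 3 + e / 3.
  rewrite /local_mass lerD// (le_trans (ler_norm _))//.
    by rewrite h1// (le_trans _ rr)// lerDl ltW.
  by rewrite h2// (le_trans _ rr)// lerDr ltW.
have mc := smooth_measurable (smooth_derive1 (tail_smooth (@cutP R) rp)).
pose dM t := 2 * (ip (fun x => (cut r)^`() x * a t x) (b1 t)
        - ip (fun x => (cut r)^`() x * b t x) (a1 t)).
have inc : `|local_mass r T - local_mass r 1| <= 4 * D * C ^+ 2 / r * (T - 1).
  apply: (@ler_increment R (local_mass r) dM) => // t /andP[t1 _].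
  have t0 : 0 < t := lt_le_trans ltr01 t1.
  split; first exact: (mass_derive Z bp).
  have [[aC bC a1C b1C] _] := bound t0.
  have [at2 at12 _] := H1cont_at (za Z t0); have [bt2 bt12 _] := H1cont_at (zb Z t0).
  have k1 := norm_ip_weight_le mc (fun x => hD r x rp) at2 bt12 aC b1C.
  have k2 := norm_ip_weight_le mc (fun x => hD r x rp) bt2 at12 bC a1C.
  have -> : 4 * D * C ^+ 2 / r = 2 * (D / r * (C * C) + D / r * (C * C)) by ring.
  by rewrite /dM normrM ger0_norm// ler_wpM2l// (le_trans (ler_normB _ _))// lerD.
have hK : 4 * D * C ^+ 2 / r * (T - 1) <= e / 3.
  have : T / r * K <= e / 3 by rewrite -ler_pdivlMr.
  have Tr0 : 0 <= T / r by rewrite divr_ge0// ltW// (lt_le_trans ltr01).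
  have -> : 4 * D * C ^+ 2 / r * (T - 1) = T / r * (K - 1) - r^-1 * (K - 1).
    by rewrite /K; ring.
  have : 0 <= r^-1 * (K - 1).
    rewrite mulr_ge0 ?invr_ge0 ?(ltW rp)// /K addrK.
    by rewrite mulr_ge0 ?sqr_ge0// mulr_ge0// ltW.
  lra.
by move: inc; rewrite ler_norml => /andP[_]; lra.
Qed.

Context (a2 b2 : R -> R -> R).
Hypothesis za1 : forall t, 0 < t -> H1cont a1 a2 t.
Hypothesis zb1 : forall t, 0 < t -> H1cont b1 b2 t.
Variable F : R -> R.
Hypothesis F_gt0 : forall t, 0 < F t.
Hypothesis F_homo : {homo F : s t / s <= t}.
Variable C2 : R.
Hypothesis bound2 : forall t, 0 < t -> nrm (a2 t) <= C2 * F t /\ nrm (b2 t) <= C2 * F t.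

(** An almost everywhere bound for the real and imaginary parts of [u], uniform in time, read off
    from [H1_ess_le]. *)
Let S := Num.sqrt (2 * (C * C)).

Let S_ge0 : 0 <= S. Proof. exact: sqrtr_ge0. Qed.

Lemma nrm_dens t : 0 < t -> nrm (dens a b t) <= S * C + S * C.
Proof.
move=> t0; have [[aC bC a1C b1C] _] := bound t0.
have wa := H1cont_at (za Z t0); have wb := H1cont_at (zb Z t0).
have k1 := nrm_mul_H1_le wa (weakd_L2 wa) aC a1C aC.
have k2 := nrm_mul_H1_le wb (weakd_L2 wb) bC b1C bC.
have l1 := H1_in_L2M wa (weakd_L2 wa); have l2 := H1_in_L2M wb (weakd_L2 wb).
by rewrite (le_trans (nrmD l1 l2))// lerD.
Qed.

Lemma nrm_dta t : 0 < t ->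
  nrm (dta b b2 n t) <= S * C + C2 * F t /\ nrm (dtb a a2 n t) <= S * C + C2 * F t.
Proof.
move=> t0; have [[aC bC a1C b1C] [nC vC]] := bound t0; have [a2C b2C] := bound2 t0.
have wa := H1cont_at (za Z t0); have wb := H1cont_at (zb Z t0).
have nt2 := L2cont_at (zn Z t0).
have k1 := nrm_mul_H1_le wa nt2 aC a1C nC.
have k2 := nrm_mul_H1_le wb nt2 bC b1C nC.
have l1 := H1_in_L2M wa nt2; have l2 := H1_in_L2M wb nt2.
have at22 := weakd_L2' (H1cont_at (za1 t0)); have bt22 := weakd_L2' (H1cont_at (zb1 t0)).
split; first by rewrite (le_trans (nrmB l2 bt22))// lerD.
by rewrite (le_trans (nrmB at22 l1))// addrC lerD.
Qed.

(** The density is at most [2 S^2] almost everywhere, so one factor of its square can be replaced by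
    this constant. *)
Lemma dens_weight_le phi t : bounded_C1 phi -> (forall x, 0 <= phi x) -> 0 < t ->
  wsq phi (dens a b t) <= (S ^+ 2 + S ^+ 2) *
    (wsq phi (a t) + wsq phi (b t)).
Proof.
move=> bp p0 t0; have [[aC bC a1C b1C] _] := bound t0.
have wa := H1cont_at (za Z t0); have wb := H1cont_at (zb Z t0).
have at2 := weakd_L2 wa; have bt2 := weakd_L2 wb.
have d2 := weakd_L2 (H1cont_at (H1cont_dens Z t0)).
have pa2 := bounded_C1_L2 bp at2; have pb2 := bounded_C1_L2 bp bt2.
have wd := H1cont_at (H1cont_dens Z t0).
have da2 := H1_in_L2M wd at2; have db2 := H1_in_L2M wd bt2.
have dle : ess_le (dens a b t) (S ^+ 2 + S ^+ 2).
  have h1 := H1_ess_le wa; have h2 := H1_ess_le wb.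
  apply: ae_imp2 h1 h2 => x h1 h2.
  have Sa : Num.sqrt (2 * (nrm (a t) * nrm (a1 t))) <= S.
    by rewrite ler_wsqrtr// ler_wpM2l// ler_pM// nrm_ge0.
  have Sb : Num.sqrt (2 * (nrm (b t) * nrm (b1 t))) <= S.
    by rewrite ler_wsqrtr// ler_wpM2l// ler_pM// nrm_ge0.
  rewrite ger0_norm; last by rewrite /dens -!expr2 addr_ge0// sqr_ge0.
  rewrite /dens -!expr2 -[a t x ^+ 2]real_normK ?num_real// -[b t x ^+ 2]real_normK ?num_real//.
  by rewrite lerD// lerXn2r// ?nnegrE//; [exact: le_trans h1 Sa|exact: le_trans h2 Sb].
have E : wsq phi (dens a b t) =
   ip (fun x => phi x * a t x) (fun x => dens a b t x * a t x) +
   ip (fun x => phi x * b t x) (fun x => dens a b t x * b t x).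
  rewrite /ip -RintegralD//; [|exact: integrable_ip..].
  by apply: eq_Rintegral => x _; rewrite /dens; ring.
rewrite E mulrDr -!ipZr// lerD//; apply: le_ip => //; try exact: in_L2Z.
- apply: ae_imp dle => x dx.
  rewrite mulrCA [leRHS]mulrCA ler_wpM2r//; last exact: le_trans (ler_norm _) dx.
  by rewrite -mulrA mulr_ge0// -expr2 sqr_ge0.
- apply: ae_imp dle => x dx.
  rewrite mulrCA [leRHS]mulrCA ler_wpM2r//; last exact: le_trans (ler_norm _) dx.
  by rewrite -mulrA mulr_ge0// -expr2 sqr_ge0.
Qed.

(** Completing the square: [n^2 / 2 + n dens = n^2 / 4 + (n / 2 + dens)^2 - dens^2], and the
    weighted integral of [dens^2] is controlled by the local mass. *)
Lemma local_energy_ge phi t : bounded_C1 phi -> (forall x, 0 <= phi x) -> 0 < t ->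
  wsq phi (a1 t) + wsq phi (b1 t) +
  4^-1 * (wsq phi (n t) + wsq phi (v t)) <=
  local_energy a b a1 b1 n v phi t + (S ^+ 2 + S ^+ 2) *
    (wsq phi (a t) + wsq phi (b t)).
Proof.
move=> bp p0 t0; have := dens_weight_le bp p0 t0.
have n2 := L2cont_at (zn Z t0).
have d2 := weakd_L2 (H1cont_at (H1cont_dens Z t0)).
have pn2 := bounded_C1_L2 bp n2; have pd2 := bounded_C1_L2 bp d2.
have hn2 := in_L2Z 2^-1 n2; have hpn2 := in_L2Z 2^-1 pn2.
have := @ip_weight_ge0 phi (fun x => 2^-1 * n t x + dens a b t x) p0.
have -> : (fun x => phi x * (2^-1 * n t x + dens a b t x)) =
    (fun x => 2^-1 * (phi x * n t x) + phi x * dens a b t x).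
  by apply/funext => x; ring.
rewrite (ipDl hpn2 pd2); last exact: in_L2D.
rewrite !(ipDr hn2 d2)// !ipZl// !ipZr//.
rewrite [ip (fun x => phi x * dens a b t x) (n t)]ipC.
have -> : ip (fun x => phi x * n t x) (dens a b t) = ip (n t) (fun x => phi x * dens a b t x).
  by apply: eq_Rintegral => x _; ring.
have := @ip_weight_ge0 phi (v t) p0; rewrite /local_energy; lra.
Qed.

Lemma energy_tail e : 0 < e -> exists eta r0, [/\ 0 < eta, 0 < r0 &
  forall T r, 1 <= T -> r0 <= r -> T * F T / r <= eta ->
  local_mass r T + (wsq (cut r) (a1 T) + wsq (cut r) (b1 T)) +
  (wsq (cut r) (n T) + wsq (cut r) (v T)) <= e].
Proof.
move=> e0.
(* Chosen for the final count: at most [21 + 8 S^2] copies of [e1] accumulate, while [e] is worth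
   [8 Q = 40 + 64 S^2] of them. *)
pose Q := 4 * (1 + S ^+ 2 + S ^+ 2) + 1.
have Q1 : 1 <= Q by have := sqr_ge0 S; rewrite /Q; lra.
have Q0 : 0 < Q := lt_le_trans ltr01 Q1.
pose e1 := e / (8 * Q); have e10 : 0 < e1 by rewrite divr_gt0// mulr_gt0.
have [eta1 [r1 [eta10 r10 hM]]] := mass_tail e10.
have wa := H1cont_at (za Z ltr01); have wb := H1cont_at (zb Z ltr01).
have n2 := L2cont_at (zn Z ltr01); have v2 := L2cont_at (zv Z ltr01).
have d2 := weakd_L2 (H1cont_at (H1cont_dens Z ltr01)).
have [ra1 ra10 ha1] := cut_ip_small (weakd_L2' wa) (weakd_L2' wa) e10.
have [rb1 rb10 hb1] := cut_ip_small (weakd_L2' wb) (weakd_L2' wb) e10.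
have [rn rn0 hn] := cut_ip_small n2 n2 e10.
have [rv rv0 hv] := cut_ip_small v2 v2 e10.
have [rd rd0 hd] := cut_ip_small d2 n2 e10.
have [D D0 hD] := tail_derive (@cutP R).
pose B := S * C + S * C.
have SC0 : 0 <= S * C by rewrite mulr_ge0.
have B0 : 0 <= B by rewrite addr_ge0.
have C20 : 0 <= C2.
  by have [h _] := bound2 ltr01; have := le_trans (nrm_ge0 _) h; rewrite pmulr_lge0.
(* constants are absorbed by [F t >= F 1] *)
pose K1 := 4 * (S * C * C) + C ^+ 2 + C * B.
have K10 : 0 <= K1 by rewrite !addr_ge0 ?mulr_ge0 ?sqr_ge0.
pose K := D * (K1 / F 1 + 4 * (C2 * C)) + 1.
have K10F : 0 <= K1 / F 1 by rewrite divr_ge0// ltW.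
have K0 : 0 < K by rewrite ltr_wpDl// mulr_ge0 ?(ltW D0)// addr_ge0// mulr_ge0// mulr_ge0.
(* Since [F 1 <= F T], the first bound gives [T / r <= eta1], the condition of [mass_tail]; the
   second controls the energy flux. *)
exists (Num.min (eta1 * F 1) (e1 / K)), (r1 + ra1 + rb1 + rn + rv + rd); split.
- by rewrite lt_min mulr_gt0//= divr_gt0.
- by rewrite !addr_gt0.
move=> T r T1 rr; rewrite le_min => /andP[Tr1 Tr2].
have T0 : 0 < T := lt_le_trans ltr01 T1.
have rp : 0 < r by lra.
have bp := cut_bounded_C1 rp.
have bp2 : bounded_C2 (cut r) by split => //; exact: (tail_derive2 (@cutP R)).
have cut0 x : 0 <= cut r x by have /andP[] := tail_itv (@cutP R) x rp.
have mass_le : local_mass r T <= e1.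
  apply: hM => //; first lra.
  have FT : F 1 <= F T by exact: F_homo.
  have T_r0 : 0 <= T / r by rewrite divr_ge0// ltW.
  rewrite -(ler_pM2r (F_gt0 1)); apply: le_trans Tr1.
  by rewrite [leRHS]mulrAC; apply: ler_wpM2l.
have mc := smooth_measurable (smooth_derive1 (tail_smooth (@cutP R) rp)).
have E1 : local_energy a b a1 b1 n v (cut r) 1 <= 4 * e1.
  have k1 : `|wsq (cut r) (a1 1)| <= e1 by apply: ha1; lra.
  have k2 : `|wsq (cut r) (b1 1)| <= e1 by apply: hb1; lra.
  have k3 : `|wsq (cut r) (n 1)| <= e1 by apply: hn; lra.
  have k4 : `|wsq (cut r) (v 1)| <= e1 by apply: hv; lra.
  have k5 : `|ip (n 1) (fun x => cut r x * dens a b 1 x)| <= e1 by rewrite ipC; apply: hd; lra.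
  rewrite /local_energy; move: k1 k2 k3 k4 k5; rewrite !ler_norml.
  by move=> /andP[_ ?] /andP[_ ?] /andP[_ ?] /andP[_ ?] /andP[_ ?]; lra.
pose dE t := - 2 * (ip (dta b b2 n t) (fun x => (cut r)^`() x * a1 t x)
          + ip (dtb a a2 n t) (fun x => (cut r)^`() x * b1 t x))
     + ip (fun x => (cut r)^`() x * n t x) (v t)
     + ip (v t) (fun x => (cut r)^`() x * dens a b t x).
have inc : `|local_energy a b a1 b1 n v (cut r) T - local_energy a b a1 b1 n v (cut r) 1|
    <= D / r * (K1 / F 1 + 4 * (C2 * C)) * F T * (T - 1).
  apply: (@ler_increment R _ dE) => // t /andP[t1 tT].
  have t0 : 0 < t := lt_le_trans ltr01 t1.
  split; first exact: (energy_derive Z za1 zb1 bp2 t0).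
  have [[aC bC a1C b1C] [nC vC]] := bound t0.
  have [A_le B_le] := nrm_dta t0; have d_le := nrm_dens t0.
  have at12 := weakd_L2' (H1cont_at (za Z t0)); have bt12 := weakd_L2' (H1cont_at (zb Z t0)).
  have A2 := L2cont_at (L2cont_dta Z zb1 t0); have B2 := L2cont_at (L2cont_dtb Z za1 t0).
  have nt2 := L2cont_at (zn Z t0); have vt2 := L2cont_at (zv Z t0).
  have dt2 := weakd_L2 (H1cont_at (H1cont_dens Z t0)).
  have Dr := fun x => hD r x rp.
  have k1 := norm_ip_weight_le mc Dr at12 A2 a1C A_le.
  have k2 := norm_ip_weight_le mc Dr bt12 B2 b1C B_le.
  have k3 := norm_ip_weight_le mc Dr nt2 vt2 nC vC.
  have k4 := norm_ip_weight_le mc Dr dt2 vt2 d_le vC.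
  rewrite /dE [ip (dta _ _ _ _) _]ipC [ip (dtb _ _ _ _) _]ipC [ip (v t) _]ipC.
  have FtT : F t <= F T by exact: F_homo.
  have F1t : F 1 <= F t by exact: F_homo.
  have K1F : K1 <= K1 / F 1 * F T.
    rewrite mulrAC ler_pdivlMr// ler_wpM2l//; exact: le_trans FtT.
  have C2F : 4 * (C2 * C) * F t <= 4 * (C2 * C) * F T.
    by rewrite ler_wpM2l// mulr_ge0// mulr_ge0.
  have Dr0 : 0 <= D / r by rewrite divr_ge0// ltW.
  have tot : D / r * (K1 + 4 * (C2 * C) * F t) <= D / r * (K1 / F 1 + 4 * (C2 * C)) * F T.
    by rewrite -[leRHS]mulrA; apply: ler_wpM2l => //; rewrite (mulrDl (K1 / F 1)) lerD.
  apply: le_trans tot.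
  have -> : D / r * (K1 + 4 * (C2 * C) * F t) = 2 * (D / r * (C * (S * C + C2 * F t)) +
      D / r * (C * (S * C + C2 * F t))) + D / r * (C * C) + D / r * (B * C).
    by rewrite /K1; ring.
  rewrite (le_trans (ler_normD _ _))// lerD// (le_trans (ler_normD _ _))// lerD//.
  by rewrite normrM normrN [`|2|]ger0_norm// ler_pM2l// (le_trans (ler_normD _ _))// lerD.
have incE : D / r * (K1 / F 1 + 4 * (C2 * C)) * F T * (T - 1) <= e1.
  have : T * F T / r * K <= e1 by rewrite -ler_pdivlMr.
  have KF0 : 0 <= (K - 1) * F T / r.
    rewrite divr_ge0 ?(ltW rp)// mulr_ge0 ?(ltW (F_gt0 _))// /K addrK.
    by rewrite mulr_ge0 ?(ltW D0)// addr_ge0// mulr_ge0// mulr_ge0.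
  have TFr0 : 0 <= T * F T / r by rewrite divr_ge0 ?(ltW rp)// mulr_ge0// ltW.
  have -> : D / r * (K1 / F 1 + 4 * (C2 * C)) * F T * (T - 1) =
      T * F T / r * (K - 1) - (K - 1) * F T / r by rewrite /K; field; rewrite !gt_eqF.
  lra.
have low := local_energy_ge bp cut0 T0.
have ET : local_energy a b a1 b1 n v (cut r) T <= 5 * e1.
  by move: inc; rewrite ler_norml => /andP[_]; lra.
have a0 := ip_weight_ge0 (a1 T) cut0; have b0 := ip_weight_ge0 (b1 T) cut0.
have n0 := ip_weight_ge0 (n T) cut0; have v0 := ip_weight_ge0 (v T) cut0.
have Se : (S ^+ 2 + S ^+ 2) * local_mass r T <= (S ^+ 2 + S ^+ 2) * e1.
  by rewrite ler_wpM2l// addr_ge0// sqr_ge0.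
have eE : e = 8 * (Q * e1) by rewrite /e1; field; rewrite gt_eqF.
rewrite eE /Q; rewrite /local_mass in low mass_le Se *.
have S2e : 0 <= S ^+ 2 * e1 by rewrite mulr_ge0 ?sqr_ge0// ltW.
lra.
Qed.

End Estimates.

(** * Real and imaginary parts *)

Section ComplexParts.
Context {R : realType}.
Notation mu := (@lebesgue_measure R).
Implicit Types (f g h : R -> R[i]) (psi r : R -> R) (A : set R).

Lemma ReMr (z : R[i]) (c : R) : complex.Re (z * c%:C) = complex.Re z * c.
Proof. by case: z => x y /=; rewrite mulr0 subr0. Qed.

Lemma ImMr (z : R[i]) (c : R) : complex.Im (z * c%:C) = complex.Im z * c.
Proof. by case: z => x y /=; rewrite mulr0 add0r mulrC. Qed.

Lemma ReB (z w : R[i]) : complex.Re (z - w) = complex.Re z - complex.Re w.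
Proof. by case: z w => [x y] [x' y']. Qed.

Lemma ImB (z w : R[i]) : complex.Im (z - w) = complex.Im z - complex.Im w.
Proof. by case: z w => [x y] [x' y']. Qed.

Lemma cintegralMr f psi : cintegral (fun x => f x * (psi x)%:C) =
  ip (cRe f) psi +i* ip (cIm f) psi.
Proof.
rewrite /cintegral; congr (_ +i* _); apply: eq_Rintegral => x _.
  by rewrite /cRe ReMr.
by rewrite /cIm ImMr.
Qed.

Lemma cabs_sqr f x : cabs f x * cabs f x = cRe f x * cRe f x + cIm f x * cIm f x.
Proof.
rewrite /cabs /cRe /cIm -expr2; case: (f x) => y z /=.
by rewrite sqr_sqrtr ?addr_ge0 ?sqr_ge0// !expr2.
Qed.

Lemma measurable_cabs f : measurable_fun setT (cRe f) -> measurable_fun setT (cIm f) ->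
  measurable_fun setT (cabs f).
Proof.
move=> mr mi.
have -> : cabs f = (@Num.sqrt R) \o (fun x => cRe f x ^+ 2 + cIm f x ^+ 2).
  by apply/funext => x; rewrite /cabs /cRe /cIm /=; case: (f x).
apply: measurableT_comp; first exact: (continuous_measurable_fun (@sqrt_continuous R)).
by apply: measurable_funD; apply: measurable_funX.
Qed.

Lemma in_L2_cabs f : in_cL2 f -> in_L2 (cabs f).
Proof.
move=> [r2 i2]; have mr := in_L2_measurable r2; have mi := in_L2_measurable i2.
apply: (@in_L2_le _ _ (fun x => `|cRe f x| + `|cIm f x|)).
- exact: measurable_cabs.
- by apply: in_L2D; exact: in_L2_normr.
- apply: aeW => x; rewrite expr2 cabs_sqr sqrrD -!expr2 !real_normK ?num_real//.
  by have := mulr_ge0 (normr_ge0 (cRe f x)) (normr_ge0 (cIm f x)); lra.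
Qed.

Lemma ip_cabs phi f (bp : bounded_C1 phi) : in_cL2 f ->
  wsq phi (cabs f) =
  wsq phi (cRe f) + wsq phi (cIm f).
Proof.
move=> [r2 i2]; have h1 := bounded_C1_L2 bp r2; have h2 := bounded_C1_L2 bp i2.
rewrite /ip -RintegralD//; [|exact: integrable_ip..].
by apply: eq_Rintegral => x _; rewrite -mulrA cabs_sqr; ring.
Qed.

Lemma nrm_cRe_le f : in_cL2 f -> nrm (cRe f) <= nrm (cabs f) /\ nrm (cIm f) <= nrm (cabs f).
Proof.
move=> f2; have [r2 i2] := f2; have c2 := in_L2_cabs f2.
split; apply: le_nrm => //; try exact: in_L2_measurable; apply: aeW => x.
  rewrite -(ler_pXn2r (ltn0Sn 1)) ?nnegrE// !real_normK ?num_real//.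
  by rewrite !expr2 cabs_sqr lerDl -expr2 sqr_ge0.
rewrite -(ler_pXn2r (ltn0Sn 1)) ?nnegrE// !real_normK ?num_real//.
by rewrite !expr2 cabs_sqr lerDr -expr2 sqr_ge0.
Qed.

(** Equality almost everywhere by parts, the only kind available between [wderiv] and other weak
    derivatives of the same function. *)
Definition cae f g : Prop :=
  {ae mu, forall x, cRe f x = cRe g x} /\ {ae mu, forall x, cIm f x = cIm g x}.

Lemma cae_in_cL2 f g : clocally_integrable f -> cae f g -> in_cL2 g -> in_cL2 f.
Proof.
move=> [[mr _ _] [mi _ _]] [fgr fgi] [r2 i2]; split.
- by apply: (in_L2_le mr r2); apply: ae_imp fgr => x ->.
- by apply: (in_L2_le mi i2); apply: ae_imp fgi => x ->.
Qed.

Lemma weak_derivative_parts f g : weak_derivative f g ->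
  [/\ locally_integrable setT (cRe g), locally_integrable setT (cIm g) &
  forall psi, test_function psi ->
    ip (cRe f) psi^`() = - ip (cRe g) psi /\ ip (cIm f) psi^`() = - ip (cIm g) psi].
Proof.
move=> [_ [lr li] fg]; split => // psi tp; have := fg psi tp.
by rewrite !cintegralMr => -[-> ->].
Qed.

(** The difference of two weak derivatives is locally integrable and orthogonal to all test
    functions. *)
Lemma weak_derivative_unique f g g' : weak_derivative f g -> weak_derivative f g' -> cae g g'.
Proof.
move=> /weak_derivative_parts[lr li fg] /weak_derivative_parts[lr' li' fg'].
have ipE (h k psi : R -> R) : locally_integrable setT h -> locally_integrable setT k ->
    test_function psi -> \int[mu]_y ((h \- k) y * psi y) = ip h psi - ip k psi.
  move=> lh lk tp; rewrite /ip -RintegralB//; [|exact: locally_integrable_test..].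
  by apply: eq_Rintegral => y _; rewrite mulrBl.
split.
- have h : {ae mu, forall x, (cRe g \- cRe g') x = 0}.
    apply: locally_integrable_ae0; first exact: locally_integrableB.
    by move=> psi tp; rewrite ipE//; have [] := fg psi tp; have [] := fg' psi tp; lra.
  by apply: ae_imp h => x /eqP; rewrite subr_eq0 => /eqP.
- have h : {ae mu, forall x, (cIm g \- cIm g') x = 0}.
    apply: locally_integrable_ae0; first exact: locally_integrableB.
    by move=> psi tp; rewrite ipE//; have [] := fg psi tp; have [] := fg' psi tp; lra.
  by apply: ae_imp h => x /eqP; rewrite subr_eq0 => /eqP.
Qed.

Lemma weak_derivative_wderiv f g : weak_derivative f g -> weak_derivative f (wderiv f).
Proof. by move=> fg; rewrite /wderiv; apply: (@xgetPex _ _ [set g | weak_derivative f g]); exists g. Qed.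

Lemma in_L2_locally_integrable (k : R -> R) : in_L2 k -> locally_integrable setT k.
Proof.
move=> k2; split; [exact: in_L2_measurable|exact: openT|move=> K _ cK].
have [M [Mr HM]] := compact_bounded cK.
pose L := M + 1.
have KL x : K x -> `|x| <= L by move=> Kx; apply: HM => //; rewrite ltrDl.
have := integrable_ip (in_L2_indic_itv L) k2 => /integrableP[mI]; apply: le_lt_trans.
rewrite integral_mkcond; apply: ge0_le_integral => //.
- by move=> x _; rewrite patchE; case: ifP.
- apply/(measurable_restrictT _ _).1; first exact: compact_measurable.
  apply/measurable_EFinP/measurableT_comp => //.
  by apply: measurable_funTS; exact: in_L2_measurable.
- exact: measurableT_comp.
- move=> x _; rewrite patchE; case: ifPn => [/set_mem/KL xL /=|_]; last exact: abse_ge0.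
  by rewrite lee_fin indicE mem_set ?mul1r//= in_itv/= -ler_norml.
Qed.

Definition cweakd f g : Prop := weakd (cRe f) (cRe g) /\ weakd (cIm f) (cIm g).

Lemma cweakd_weak f g : cweakd f g -> weak_derivative f g.
Proof.
move=> [[fr gr wr] [fi gi wi]]; split.
- by split; exact: in_L2_locally_integrable.
- by split; exact: in_L2_locally_integrable.
- move=> psi tp; rewrite !cintegralMr wr// wi//.
Qed.

Lemma weak_cweakd f g : weak_derivative f g -> in_cL2 f -> in_cL2 g -> cweakd f g.
Proof.
move=> /weak_derivative_parts[_ _ fg] [fr fi] [gr gi].
by split; split => // psi tp; have [] := fg psi tp.
Qed.

Lemma cweakd_cL2 f g : cweakd f g -> in_cL2 f /\ in_cL2 g.
Proof. by move=> [[? ? _] [? ? _]]. Qed.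

(** The chosen representative is only known to be locally integrable; agreeing almost everywhere
    with an L^2 derivative makes it square integrable. *)
Lemma cweakd_wderiv f g : cweakd f g -> cae (wderiv f) g /\ cweakd f (wderiv f).
Proof.
move=> fg; have wfg := cweakd_weak fg; have wfw := weak_derivative_wderiv wfg.
have e := weak_derivative_unique wfw wfg; split => //.
have [f2 g2] := cweakd_cL2 fg.
apply: weak_cweakd => //; apply: (cae_in_cL2 _ e g2).
by case: wfw.
Qed.

Lemma cweakdB f f' g g' : cweakd f f' -> cweakd g g' -> cweakd (f \- g) (f' \- g').
Proof.
move=> [fr fi] [gr gi]; split.
  have -> : cRe (f \- g) = (fun x => cRe f x - cRe g x) by apply/funext => x; exact: ReB.
  have -> : cRe (f' \- g') = (fun x => cRe f' x - cRe g' x) by apply/funext => x; exact: ReB.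
  exact: weakdB.
have -> : cIm (f \- g) = (fun x => cIm f x - cIm g x) by apply/funext => x; exact: ImB.
have -> : cIm (f' \- g') = (fun x => cIm f' x - cIm g' x) by apply/funext => x; exact: ImB.
exact: weakdB.
Qed.

Lemma cweakd_ae f f' g : in_cL2 f' -> cae f' f -> cweakd f g -> cweakd f' g.
Proof.
move=> [r2 i2] [er ei] [[fr gr wr] [fi gi wi]]; split; split => // psi tp.
  rewrite -wr//; apply: ip_ae => //; try exact: in_L2_measurable.
  exact: (in_L2_measurable (test_derive1_L2 tp)).
rewrite -wi//; apply: ip_ae => //; try exact: in_L2_measurable.
exact: (in_L2_measurable (test_derive1_L2 tp)).
Qed.

Lemma in_sobolev_in_cL2 k f : in_sobolev k f -> in_cL2 f.
Proof. by case: k => // k []. Qed.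

Lemma cae_in_sobolev k f g : in_cL2 f -> cae f g -> in_sobolev k g -> in_sobolev k f.
Proof.
case: k => // k f2 fg [g2 [h gh hs]]; split => //; exists h => //.
by apply/cweakd_weak/(cweakd_ae f2 fg)/weak_cweakd => //; exact: in_sobolev_in_cL2 hs.
Qed.

Lemma in_sobolevB k f g : in_sobolev k f -> in_sobolev k g -> in_sobolev k (f \- g).
Proof.
elim: k f g => [f g [fr fi] [gr gi]|k ih f g [f2 [f' ff' fs]] [g2 [g' gg' gs]]].
  split.
    by rewrite (_ : cRe _ = fun x => cRe f x - cRe g x); [exact: in_L2B|apply/funext => x; exact: ReB].
  by rewrite (_ : cIm _ = fun x => cIm f x - cIm g x); [exact: in_L2B|apply/funext => x; exact: ImB].
have h := cweakdB (weak_cweakd ff' f2 (in_sobolev_in_cL2 fs))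
  (weak_cweakd gg' g2 (in_sobolev_in_cL2 gs)).
split; first exact: (cweakd_cL2 h).1.
by exists (f' \- g'); [exact: cweakd_weak|exact: ih].
Qed.

(** [in_sobolev] provides some derivative at each order, while iterating [wderiv] picks its own; the
    induction transfers regularity between them with [cae_in_sobolev]. *)
Lemma in_sobolev_cweakd k j f : in_sobolev k f -> (j < k)%N ->
  cweakd (iter j wderiv f) (iter j.+1 wderiv f).
Proof.
elim: k j f => // k ih j f [f2 [g wfg gs]] jk.
have [e ff] := cweakd_wderiv (weak_cweakd wfg f2 (in_sobolev_in_cL2 gs)).
case: j jk => [_|j jk]; first exact: ff.
have h := ih j _ (cae_in_sobolev (cweakd_cL2 ff).2 e gs) jk.
by rewrite !(iterSr _ wderiv f).
Qed.

Lemma in_sobolev_iter k j f : in_sobolev k f -> (j <= k)%N -> in_cL2 (iter j wderiv f).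
Proof.
case: j => [fs _|j fs jk]; first exact: in_sobolev_in_cL2 fs.
exact: (cweakd_cL2 (in_sobolev_cweakd fs jk)).2.
Qed.

(** Being a choice of representative, [wderiv] is linear only up to null sets. *)
Lemma iter_wderivB k j f g : in_sobolev k f -> in_sobolev k g -> (j <= k)%N ->
  cae (iter j wderiv (f \- g)) (iter j wderiv f \- iter j wderiv g).
Proof.
move=> fs gs; elim: j => [_|j ih jk]; first by split; exact: aeW.
have w := cweakdB (in_sobolev_cweakd fs jk) (in_sobolev_cweakd gs jk).
have h2 := in_sobolev_iter (in_sobolevB fs gs) (ltnW jk).
exact: (cweakd_wderiv (cweakd_ae h2 (ih (ltnW jk)) w)).1.
Qed.

Lemma sobolev_normE k A f : measurable A -> in_sobolev k f ->
  sobolev_norm k A f =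
  (Num.sqrt (\sum_(j < k.+1) nrm (fun x => \1_A x * cabs (iter j wderiv f) x) ^+ 2))%:E.
Proof.
move=> mA fs; rewrite /sobolev_norm.
have -> : (\sum_(j < k.+1) L2norm A (cabs (iter j wderiv f)) ^+ 2 =
  (\sum_(j < k.+1) nrm (fun x => \1_A x * cabs (iter j wderiv f) x) ^+ 2)%:E)%E.
  rewrite -sumEFin; apply: eq_bigr => j _.
  by rewrite Lnorm2E//; apply/in_L2_cabs/(in_sobolev_iter fs); rewrite -ltnS.
by rewrite poweR_EFin powR12_sqrt// sumr_ge0// => j _; rewrite sqr_ge0.
Qed.

Lemma nrm_setT (k : R -> R) : nrm (fun x => \1_[set: R] x * k x) = nrm k.
Proof. by congr nrm; apply/funext => x; rewrite indicT mul1r. Qed.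

Lemma sobolev_norm_ge k j f e : (j <= k)%N -> in_sobolev k f ->
  (sobolev_norm k setT f <= e%:E)%E -> nrm (cabs (iter j wderiv f)) <= e.
Proof.
move=> jk fs; rewrite sobolev_normE// lee_fin; apply: le_trans.
rewrite -[leLHS]ger0_norm ?nrm_ge0// -sqrtr_sqr ler_wsqrtr//.
rewrite -ltnS in jk; rewrite (bigD1 (Ordinal jk))//= nrm_setT lerDl.
by apply: sumr_ge0 => i _; rewrite sqr_ge0.
Qed.

End ComplexParts.

(** * From the hypotheses of the theorem to the real system *)

Section Assembly.
Context {R : realType}.
Notation mu := (@lebesgue_measure R).
Implicit Types (u : R -> R -> R[i]) (n v : R -> R -> R) (psi : R -> R) (t s r e c : R).

Lemma near_within_gt0 (P : R -> Prop) t : 0 < t ->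
  (\forall s \near within [set s | 0 <= s] (nbhs t), P s) -> \forall s \near t, P s.
Proof.
move=> t0; rewrite near_withinE => H; have s0 := lt_nbhsr t0.
by apply: filterS2 H s0 => s Ps s0; apply/Ps/ltW.
Qed.

Lemma cvge0_near (T : Type) (G : set_system T) {FG : Filter G} (h : T -> \bar R) e : 0 < e ->
  h x @[x --> G] --> 0%E -> \forall x \near G, (h x <= e%:E)%E.
Proof.
move=> e0 /fine_cvgP[hf hc].
move/cvgrPdist_le : hc => /(_ e e0) hc.
apply: filterS2 hf hc => x hx; rewrite /= sub0r normrN => he.
by rewrite -(fineK hx) lee_fin (le_trans (ler_norm _)).
Qed.

Lemma continuous_in_L2_L2cont n t : continuous_in_L2 n -> 0 < t -> L2cont n t.
Proof.
move=> [n2 nc] t0; have n2t := n2 t (ltW t0).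
have nr : \forall s \near t, in_L2 (n s).
  by apply: (near_gt0 t0) => s s0; exact/n2/ltW.
split => //; apply/cvgrPdist_le => e e0.
have H := near_within_gt0 t0 (cvge0_near e0 (nc t (ltW t0))).
near=> s; have s2 : in_L2 (n s) by near: s.
have : (L2norm setT (n s \- n t)%R <= e%:E)%E by near: s; exact: H.
rewrite Lnorm2E//; last exact: in_L2B.
by rewrite lee_fin nrm_setT dist0_nrm.
Unshelve. all: by end_near. Qed.

Lemma sobolev_L2cont (k j : nat) u t : continuous_in_sobolev k u -> 0 < t -> (j <= k)%N ->
  L2cont (fun s => cRe (iter j wderiv (u s))) t /\ L2cont (fun s => cIm (iter j wderiv (u s))) t.
Proof.
move=> [us uc] t0 jk; have ust := us t (ltW t0).
have u2 s : 0 < s -> in_cL2 (iter j wderiv (u s)).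
  by move=> s0; apply: in_sobolev_iter jk; exact/us/ltW.
have key e : 0 < e -> \forall s \near t,
    nrm (fun x => cRe (iter j wderiv (u s)) x - cRe (iter j wderiv (u t)) x) <= e /\
    nrm (fun x => cIm (iter j wderiv (u s)) x - cIm (iter j wderiv (u t)) x) <= e.
  move=> e0; have H := near_within_gt0 t0 (cvge0_near e0 (uc t (ltW t0))).
  near=> s; have s0 : 0 < s by near: s; exact: lt_nbhsr.
  have hs : (sobolev_norm k setT (u s \- u t)%R <= e%:E)%E by near: s; exact: H.
  have uss := us s (ltW s0).
  have ds := in_sobolevB uss ust; have d2 := in_sobolev_iter ds jk.
  have hj := sobolev_norm_ge jk ds hs; have [h1 h2] := nrm_cRe_le d2.
  have [er ei] := iter_wderivB uss ust jk.
  have [[mr1 mi1] [mr2 mi2]] := (u2 s s0, u2 t t0); have [mr mi] := d2.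
  split.
    rewrite (@nrm_ae _ _ (cRe (iter j wderiv (u s \- u t)))) ?(le_trans h1)//.
    - by apply: in_L2_measurable; exact: in_L2B.
    - exact: in_L2_measurable.
    - by apply: ae_imp er => x ->; rewrite -ReB.
  rewrite (@nrm_ae _ _ (cIm (iter j wderiv (u s \- u t)))) ?(le_trans h2)//.
  - by apply: in_L2_measurable; exact: in_L2B.
  - exact: in_L2_measurable.
  - by apply: ae_imp ei => x ->; rewrite -ImB.
split; split.
- by apply: (near_gt0 t0) => s /u2[].
- apply/cvgrPdist_le => e /key; apply: filterS => s [h _].
  by rewrite dist0_nrm.
- by apply: (near_gt0 t0) => s /u2[].
- apply/cvgrPdist_le => e /key; apply: filterS => s [_ h].
  by rewrite dist0_nrm.
Unshelve. all: by end_near. Qed.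

Lemma sobolev_H1cont (k j : nat) u t : continuous_in_sobolev k u -> 0 < t -> (j < k)%N ->
  H1cont (fun s => cRe (iter j wderiv (u s))) (fun s => cRe (iter j.+1 wderiv (u s))) t /\
  H1cont (fun s => cIm (iter j wderiv (u s))) (fun s => cIm (iter j.+1 wderiv (u s))) t.
Proof.
move=> uc t0 jk; have [c1 c2] := sobolev_L2cont uc t0 (ltnW jk).
have [c3 c4] := sobolev_L2cont uc t0 jk.
have w s : 0 < s -> cweakd (iter j wderiv (u s)) (iter j.+1 wderiv (u s)).
  by move=> s0; apply: in_sobolev_cweakd jk; apply: uc.1; exact: ltW.
by split; split => //; apply: (near_gt0 t0) => s /w[].
Qed.

Lemma zakharov_zak_H1 k u n v : (0 < k)%N -> zakharov_solution u n v ->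
  continuous_in_sobolev k u -> continuous_in_L2 n -> continuous_in_L2 v ->
  zak_H1 (fun t => cRe (u t)) (fun t => cIm (u t))
    (fun t => cRe (wderiv (u t))) (fun t => cIm (wderiv (u t))) n v.
Proof.
move=> k0 sol uc nc vc.
have E2 psi : psi^`(2)%classic = psi^`()^`() by rewrite derive1Sn derive1n1.
have nuE t psi : cintegral (fun x => (n t x)%:C * u t x * (psi x)%:C) =
    ip (fun x => cRe (u t) x * n t x) psi +i* ip (fun x => cIm (u t) x * n t x) psi.
  rewrite cintegralMr; congr (_ +i* _); congr ip; apply/funext => x; rewrite /cRe /cIm.
    by rewrite mulrC ReMr.
  by rewrite mulrC ImMr.
have schr t psi : 0 < t -> test_function psi ->
    is_derive t 1 (fun s => ip (cRe (u s)) psi)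
      (ip (fun x => cIm (u t) x * n t x) psi - ip (cIm (u t)) psi^`()^`()) /\
    is_derive t 1 (fun s => ip (cIm (u s)) psi)
      (ip (cRe (u t)) psi^`()^`() - ip (fun x => cRe (u t) x * n t x) psi).
  move=> t0 tp; have [[d [dr di] eq] _ _] := sol psi t tp t0.
  have crE : cRe (fun s => cintegral (fun x => u s x * (psi x)%:C)) = (fun s => ip (cRe (u s)) psi).
    by apply/funext => s; rewrite /cRe cintegralMr.
  have ciE : cIm (fun s => cintegral (fun x => u s x * (psi x)%:C)) = (fun s => ip (cIm (u s)) psi).
    by apply/funext => s; rewrite /cIm cintegralMr.
  rewrite crE in dr; rewrite ciE in di.
  (* Because of the factor [i], the imaginary part of the equation gives the derivative of the real
     part of [u], and the real part gives that of the imaginary part. *)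
  move: eq; rewrite cintegralMr nuE E2; case: d dr di => x y /= dr di [e1 e2].
  split.
    by apply: (is_derive_eq dr); lra.
  by apply: (is_derive_eq di); lra.
split.
- by move=> t t0; exact: (sobolev_H1cont uc t0 k0).1.
- by move=> t t0; exact: (sobolev_H1cont uc t0 k0).2.
- by move=> t t0; exact: continuous_in_L2_L2cont.
- by move=> t t0; exact: continuous_in_L2_L2cont.
- by move=> t psi t0 tp; exact: (schr t psi t0 tp).1.
- by move=> t psi t0 tp; exact: (schr t psi t0 tp).2.
- move=> t psi t0 tp; have [_ [d dd de] _] := sol psi t tp t0.
  by apply: (is_derive_eq dd); apply/eqP; rewrite -subr_eq0 de.
- move=> t psi t0 tp; have [_ _ [d dd de]] := sol psi t tp t0.
  apply: (is_derive_eq dd); apply/eqP; rewrite -subr_eq0 -[X in _ == X]de; apply/eqP.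
  by congr (d - _); apply: eq_Rintegral => x _; rewrite expr2 cabs_sqr.
Qed.

(** Splitting the energy integral requires each term to be integrable; for the interaction this
    holds because the squares of H^1 functions are in L^2. *)
Lemma mass_energy_real u n v t (Es Ms : R) : cweakd (u t) (wderiv (u t)) -> in_L2 (n t) -> in_L2 (v t) ->
  energy (u t) (n t) (v t) = Es%:E -> mass (u t) = Ms%:E ->
  let a := cRe (u t) in let b := cIm (u t) in
  let a1 := cRe (wderiv (u t)) in let b1 := cIm (wderiv (u t)) in
  ip a a + ip b b = Ms /\
  ip a1 a1 + ip b1 b1 + 2^-1 * (ip (n t) (n t) + ip (v t) (v t))
    + ip (n t) (fun x => a x * a x + b x * b x) = Es.
Proof.
move=> [wa wb] n2 v2 en ma a b a1 b1.
have [a2 a12 _] := wa; have [b2 b12 _] := wb.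
have ab2 := in_L2D (H1_in_L2M wa a2) (H1_in_L2M wb b2).
have aa1 := integrable_ip a2 a2; have bb1 := integrable_ip b2 b2.
split.
  rewrite /ip -RintegralD//.
  have -> : Ms = fine (mass (u t)) by rewrite ma.
  by apply: eq_Rintegral => x _; rewrite -cabs_sqr expr2.
have -> : Es = fine (energy (u t) (n t) (v t)) by rewrite en.
have i1 := integrable_ip a12 a12; have i2 := integrable_ip b12 b12.
have i3 := integrable_ip (in_L2Z 2^-1 n2) n2; have i4 := integrable_ip (in_L2Z 2^-1 v2) v2.
have i5 := integrable_ip n2 ab2.
rewrite mulrDr -!ipZl// /ip.
have addI (f g : R -> R) : mu.-integrable setT (EFin \o f) -> mu.-integrable setT (EFin \o g) ->
    mu.-integrable setT (EFin \o (fun x => f x + g x)).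
  move=> fi gi; have := integrableD measurableT fi gi.
  by apply: eq_integrable => // x _.
have j12 := addI _ _ i1 i2; have j34 := addI _ _ i3 i4; have j := addI _ _ j12 j34.
rewrite -(RintegralD measurableT i1 i2) -(RintegralD measurableT i3 i4).
rewrite -(RintegralD measurableT j12 j34) -(RintegralD measurableT j i5).
apply: eq_Rintegral => x _.
rewrite [cabs (wderiv (u t)) x ^+ 2]expr2 cabs_sqr.
rewrite [cabs (u t) x ^+ 2]expr2 cabs_sqr !real_normK ?num_real// /a /b /a1 /b1; ring.
Qed.

End Assembly.

(** * Conclusion *)

Section Final.
Context {R : realType}.
Implicit Types (t s r e c : R).

Lemma measurable_region (c1 c2 r : R) : measurable (region c1 c2 r).
Proof.
have -> : region c1 c2 r = (@Num.norm R R) @^-1` `[c1 * r, c2 * r]%classic.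
  by apply/seteqP; split=> x /=; rewrite in_itv.
by rewrite -[X in measurable X]setTI; exact: normr_measurable measurableT _ (measurable_itv _).
Qed.

(** With radius [r = c1 * m], the cutoff equals one on the whole region, so tail bounds dominate the
    regional norm. *)
Lemma region_le_cut (c1 c2 m : R) (k : R -> R) : 0 < c1 * m -> in_L2 k ->
  nrm (fun x => \1_(region c1 c2 m) x * k x) ^+ 2 <= wsq (cut (c1 * m)) k.
Proof.
move=> m0 k2; have mA := measurable_region c1 c2 m.
have Ak2 : in_L2 (fun x => \1_(region c1 c2 m) x * k x).
  apply: (@in_L2M _ 1 _ _ (measurable_indic mA)) => //.
  by apply: bounded_ess => x; rewrite indicE; case: (_ \in _); rewrite ?normr1 ?normr0.
rewrite sqr_nrm; apply: le_ip => //; first exact: cut_L2.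
apply: aeW => x; rewrite indicE; case: (boolP (x \in _)) => [|_].
  rewrite inE /region/= => /andP[mx _].
  by rewrite !mul1r (tail_eq1 (@cutP R))// mul1r.
rewrite !mul0r -mulrA -expr2 mulr_ge0 ?sqr_ge0//.
by have /andP[] := tail_itv (@cutP R) x m0.
Qed.

Lemma cvge0P (h : R -> \bar R) : (forall e, 0 < e -> \forall t \near +oo, (0 <= h t <= e%:E)%E) ->
  h t @[t --> +oo] --> 0%E.
Proof.
move=> H; apply/fine_cvgP; split.
  have := H 1 ltr01; apply: filterS => t /andP[h0 h1].
  by rewrite ge0_fin_numE// (le_lt_trans h1)// ltry.
apply/cvgrPdist_le => e e0; have := H e e0; apply: filterS => t /andP[h0 h1] /=.
have hf : h t \is a fin_num by rewrite ge0_fin_numE// (le_lt_trans h1)// ltry.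
rewrite sub0r normrN ger0_norm; last exact: fine_ge0.
by rewrite -lee_fin fineK.
Qed.

(** Once [ln t >= 1], its power [1 + delta] is at least [ln t], which eventually exceeds [L / c]. *)
Lemma growth (m F : R -> R) (c delta L : R) : 0 < c -> 0 < delta -> (forall t, 0 < F t) ->
  (forall t, 2 <= t -> c * (t * (ln t) `^ (1 + delta) * F t) <= m t) ->
  \forall t \near +oo, L * (t * F t) <= m t.
Proof.
move=> c0 d0 F0 hm; pose M := Num.max 1 (L / c).
near=> t.
have t2 : 2 <= t by near: t; apply: nbhs_pinfty_ge; exact: num_real.
have tM : expR M <= t by near: t; apply: nbhs_pinfty_ge; exact: num_real.
have t0 : 0 < t by lra.
have lM : M <= ln t by rewrite -ler_expR lnK.
have l1 : 1 <= ln t by apply: le_trans lM; rewrite le_max lexx.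
have lL : L / c <= ln t by apply: le_trans lM; rewrite le_max lexx orbT.
have lp : L / c <= (ln t) `^ (1 + delta).
  by apply: (le_trans lL); apply: le1r_powR => //; rewrite lerDl ltW.
apply: le_trans (hm t t2).
have tF : 0 < t * F t by rewrite mulr_gt0.
move: lp; rewrite ler_pdivrMr// => lp.
have -> : c * (t * (ln t) `^ (1 + delta) * F t) = (ln t) `^ (1 + delta) * c * (t * F t) by ring.
by rewrite ler_pM2r.
Unshelve. all: by end_near. Qed.

End Final.

Theorem theorem1p2 (R : realType) (u : R -> R -> R[i]) (n v : R -> R -> R)
    (Es Ms : R)
    (solution : zakharov_solution u n v)
    (finite_energy : forall t : R, 0 <= t -> energy (u t) (n t) (v t) = Es%:E)
    (finite_mass : forall t : R, 0 <= t -> mass (u t) = Ms%:E) :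
  ((continuous_in_sobolev 1 u /\ continuous_in_L2 n /\ continuous_in_L2 v) ->
   forall (delta : R) (mu : R -> R), 0 < delta -> is_C1 mu ->
   (exists2 c : R, 0 < c &
      forall t : R, 2 <= t -> c * (t * (ln t) `^ (1 + delta)) <= mu t) ->
   forall c1 c2 : R, 0 < c1 -> c1 < c2 ->
   L2norm (region c1 c2 (mu t)) (cabs (u t))
     @[t --> +oo] --> 0%E)
  /\
  ((continuous_in_sobolev 2 u /\ continuous_in_L2 n /\ continuous_in_L2 v) ->
   forall f : R -> R,
   is_C1 f -> {homo f : s t / s <= t} -> (forall t, 0 < f t) ->
   (exists2 C : R, 0 < C &
      forall t : R, 0 <= t -> (sobolev_norm 2 setT (u t) <= (C * f t)%:E)%E) ->
   forall (delta : R) (mu : R -> R), 0 < delta -> is_C1 mu ->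
   (exists2 c : R, 0 < c &
      forall t : R, 2 <= t -> c * (t * (ln t) `^ (1 + delta) * f t) <= mu t) ->
   forall c1 c2 : R, 0 < c1 -> c1 < c2 ->
   (sobolev_norm 1 (region c1 c2 (mu t)) (u t)
      + L2norm (region c1 c2 (mu t)) (n t)
      + L2norm (region c1 c2 (mu t)) (v t))%E
     @[t --> +oo] --> 0%E).
Proof.
(* The constant of [energy_bound]. It is independent of time because [Ms] and [Es] are conserved. *)
pose C := Ms + 4 * (Es + 16 * Ms ^+ 3) + 1.
have bound k : (0 < k)%N -> continuous_in_sobolev k u -> continuous_in_L2 n -> continuous_in_L2 v ->
    forall t, 0 < t -> [/\ nrm (cRe (u t)) <= C, nrm (cIm (u t)) <= C,
    nrm (cRe (wderiv (u t))) <= C & nrm (cIm (wderiv (u t))) <= C] /\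
    (nrm (n t) <= C /\ nrm (v t) <= C).
  move=> k0 [us _] [n2 _] [v2 _] t t0; have t0' := ltW t0.
  have w := in_sobolev_cweakd (us t t0') k0; have [wa wb] := w.
  have [hm he] := mass_energy_real w (n2 t t0') (v2 t t0')
    (finite_energy t t0') (finite_mass t t0').
  exact: (energy_bound wa wb (n2 t t0') (v2 t t0') hm he).
split.
- move=> [uc [nc vc]] delta m d0 _ [c c0 hm] c1 c2 c10 c12.
  have Z := zakharov_zak_H1 (ltn0Sn _) solution uc nc vc.
  have hm' t : 2 <= t -> c * (t * (ln t) `^ (1 + delta) * 1) <= m t by rewrite mulr1; exact: hm.
  apply: cvge0P => e e0; have e20 : 0 < e ^+ 2 by rewrite exprn_gt0.
  have [eta [r0 [eta0 r00 tail]]] := mass_tail Z (bound _ (ltn0Sn _) uc nc vc) e20.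
  (* From [L * t <= m t] follows [t / eta + t <= c1 * m t]: the first summand makes [t / r] at most
     [eta], the second makes [r = c1 * m t] exceed [r0]. *)
  pose L := (c1 * eta)^-1 + c1^-1.
  have L1 : 1 / (c1 * eta) <= L by rewrite div1r lerDl invr_ge0 ltW.
  near=> t.
  have mL : L * (t * 1) <= m t.
    by near: t; exact: (@growth R m (fun=> 1) c delta L).
  have t1 : 1 <= t by near: t; apply: nbhs_pinfty_ge; exact: num_real.
  have tr0 : r0 <= t by near: t; apply: nbhs_pinfty_ge; exact: num_real.
  have t0 : 0 < t by lra.
  have rt : t / eta + t <= c1 * m t.
    have -> : t / eta + t = c1 * (L * (t * 1)) by rewrite /L; field; rewrite !gt_eqF.
    by rewrite ler_pM2l.
  have te0 : 0 < t / eta by rewrite divr_gt0.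
  have rp : 0 < c1 * m t by lra.
  have u2 : in_cL2 (u t) by have [us _] := uc; have [] := us t (ltW t0).
  have c2' := in_L2_cabs u2.
  have bp := cut_bounded_C1 rp.
  rewrite Lnorm2E//; last exact: measurable_region.
  rewrite !lee_fin nrm_ge0/= -(ler_pXn2r (ltn0Sn 1)) ?nnegrE ?nrm_ge0 ?(ltW e0)//.
  apply: (le_trans (region_le_cut c2 rp c2')); rewrite (ip_cabs bp u2).
  apply: tail => //; first lra.
  rewrite ler_pdivrMr// mulrC -ler_pdivrMr//; lra.
move=> [uc [nc vc]] f _ fhomo f0 [CF CF0 hF] delta m d0 _ [c c0 hm] c1 c2 c10 c12.
have Z := zakharov_zak_H1 (ltn0Sn _) solution uc nc vc.
have [us _] := uc.
have bound2 t : 0 < t -> nrm (cRe (wderiv (wderiv (u t)))) <= CF * f t /\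
    nrm (cIm (wderiv (wderiv (u t)))) <= CF * f t.
  move=> t0; have ut := us t (ltW t0); have h := sobolev_norm_ge (leqnn 2) ut (hF t (ltW t0)).
  have [h1 h2] := nrm_cRe_le (in_sobolev_iter ut (leqnn 2)).
  by split; [exact: le_trans h1 h|exact: le_trans h2 h].
have za1 t (t0 : 0 < t) := (@sobolev_H1cont R 2 1 u t uc t0 (ltnSn 1)).1.
have zb1 t (t0 : 0 < t) := (@sobolev_H1cont R 2 1 u t uc t0 (ltnSn 1)).2.
(* The tail bound concerns squares; each of the three norms will be at most [e / 4]. *)
apply: cvge0P => e e0; have e30 : 0 < (e / 4) ^+ 2 by rewrite exprn_gt0// divr_gt0.
have [eta [r0 [eta0 r00 tail]]] := energy_tail Z (bound _ (ltn0Sn _) uc nc vc) za1 zb1 f0 fhomo bound2 e30.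
(* As in the first part, with [t * f t] in place of [t]; dividing by [f 1] keeps the second summand
   at least [t], since [f 1 <= f t]. *)
pose L := (c1 * eta)^-1 + (c1 * f 1)^-1.
near=> t.
have mL : L * (t * f t) <= m t.
  by near: t; exact: (@growth R m f c delta L).
have t1 : 1 <= t by near: t; apply: nbhs_pinfty_ge; exact: num_real.
have tr0 : r0 <= t by near: t; apply: nbhs_pinfty_ge; exact: num_real.
have t0 : 0 < t by lra.
have ft : 1 <= f t / f 1 by rewrite ler_pdivlMr// mul1r fhomo.
have rt : t * f t / eta + t <= c1 * m t.
  apply: (@le_trans _ _ (c1 * (L * (t * f t)))); last by rewrite ler_pM2l.
  have -> : c1 * (L * (t * f t)) = t * f t / eta + t * (f t / f 1).
    by rewrite /L; field; rewrite !gt_eqF.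
  by rewrite lerD2l ler_peMr// ltW.
have te0 : 0 < t * f t / eta by rewrite divr_gt0// mulr_gt0.
have rp : 0 < c1 * m t by lra.
have cut0 x : 0 <= cut (c1 * m t) x by have /andP[] := tail_itv (@cutP R) x rp.
have ut := us t (ltW t0); have w := @in_sobolev_cweakd R 2 0 _ ut (ltn0Sn 1).
have [u2 u12] := cweakd_cL2 w.
have n2 : in_L2 (n t) by have [h _] := nc; exact/h/ltW.
have v2 : in_L2 (v t) by have [h _] := vc; exact/h/ltW.
have bp := cut_bounded_C1 rp.
have mA := measurable_region c1 c2 (m t).
have tl : local_mass (fun t => cRe (u t)) (fun t => cIm (u t)) (c1 * m t) t +
  (ip (fun x => cut (c1 * m t) x * cRe (wderiv (u t)) x) (cRe (wderiv (u t))) +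
   ip (fun x => cut (c1 * m t) x * cIm (wderiv (u t)) x) (cIm (wderiv (u t)))) +
  (wsq (cut (c1 * m t)) (n t) +
   wsq (cut (c1 * m t)) (v t)) <= (e / 4) ^+ 2.
  apply: tail => //; first lra.
  by rewrite ler_pdivrMr// [leRHS]mulrC -ler_pdivrMr//; lra.
have k1 := region_le_cut c2 rp (in_L2_cabs u2); rewrite (ip_cabs bp u2) in k1.
have k2 := region_le_cut c2 rp (in_L2_cabs u12); rewrite (ip_cabs bp u12) in k2.
have k3 := region_le_cut c2 rp n2; have k4 := region_le_cut c2 rp v2.
have p1 := ip_weight_ge0 (cRe (u t)) cut0; have p2 := ip_weight_ge0 (cIm (u t)) cut0.
have p3 := ip_weight_ge0 (cRe (wderiv (u t))) cut0.
have p4 := ip_weight_ge0 (cIm (wderiv (u t))) cut0.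
have p5 := ip_weight_ge0 (n t) cut0; have p6 := ip_weight_ge0 (v t) cut0.
rewrite /local_mass in tl.
have u1 : in_sobolev 1 (u t) by split => //; exists (wderiv (u t)) => //; exact: cweakd_weak.
rewrite (sobolev_normE mA u1) !Lnorm2E// -!EFinD !lee_fin.
have e40 : 0 <= e / 4 by rewrite divr_ge0// ltW.
rewrite !addr_ge0 ?nrm_ge0 ?sqrtr_ge0//=.
have q1 : Num.sqrt (\sum_(j < 2) nrm (fun x => \1_(region c1 c2 (m t)) x * cabs (iter j wderiv (u t)) x) ^+ 2) <= e / 4.
  rewrite -[leRHS]ger0_norm// -sqrtr_sqr ler_wsqrtr// !big_ord_recl big_ord0 /= addr0; lra.
have q2 : nrm (fun x => \1_(region c1 c2 (m t)) x * n t x) <= e / 4.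
  rewrite -(ler_pXn2r (ltn0Sn 1)) ?nnegrE ?nrm_ge0//.
  apply: (le_trans k3); apply: le_trans tl; lra.
have q3 : nrm (fun x => \1_(region c1 c2 (m t)) x * v t x) <= e / 4.
  rewrite -(ler_pXn2r (ltn0Sn 1)) ?nnegrE ?nrm_ge0//.
  apply: (le_trans k4); apply: le_trans tl; lra.
lra.
Unshelve. all: by end_near. Qed.
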